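(* (i) Let $R$ be a ring which is coherent and such that every finitely presented $R$-module has finite projective dimension. Let $M$ be an $R$-module. Then the projective dimension of $\mathbf{y}M$ in $\mathrm{Mod}\text{-}\mathcal{T}^c$, where $\mathcal{T}=D(R)$, equals the pure projective dimension of $M$. Hence $$\mathrm{pgldim}\,R\;\leq\;\mathrm{pgldim}\,D(R).$$ (ii) Let $R$ be a hereditary ring. Then $$\mathrm{pgldim}\,R\;=\;\mathrm{pgldim}\,D(R).$$
   Context: Rings are associative with unit; modules are right unitary modules. A ring $R$ is coherent if the kernel of every map between finitely generated projective (right) $R$-modules is finitely presented; it is hereditary if its (right) global dimension is at most $1$ (hereditary rings satisfy the hypothesis of (i)). $\mathcal{T}=D(R)$ is the unbounded derived category of right $R$-modules, and $\mathcal{T}^c\subset\mathcal{T}$ is the full subcategory of compact objects, i.e. objects $c$ such that $\mathcal{T}(c,-)$ commutes with coproducts (equivalently, complexes quasi-isomorphic to bounded complexes of finitely generated projectives). An $R$-module is viewed as a complex concentrated in degree $0$. $\mathrm{Mod}\text{-}\mathcal{T}^c$ is the abelian category of additive functors $\{\mathcal{T}^c\}^{op}\to\mathrm{Ab}$, and for $X\in\mathcal{T}$, $\mathbf{y}X=\mathcal{T}(-,X)|_{\mathcal{T}^c}$. A short exact sequence of $R$-modules is pure exact if it remains exact under $\mathrm{Hom}(P,-)$ for every finitely presented module $P$ (equivalently, after tensoring with any left $R$-module). A module $P$ is pure projective if $\mathrm{Hom}(P,-)$ takes pure exact sequences to exact sequences. The pure projective dimension of a module is the length of its shortest pure (exact)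 resolution by pure projectives ($\infty$ if there is no finite one). $\mathrm{pgldim}\,R$ is the supremum over all $R$-modules $M$ of the pure projective dimension of $M$. $\mathrm{pgldim}\,D(R)$ is the supremum over all $X\in D(R)$ of the projective dimension of $\mathbf{y}X$ in $\mathrm{Mod}\text{-}\mathcal{T}^c$. *)

(* Defs.v *)
From Stdlib Require List.
From HB Require Import structures.
From mathcomp Require Import all_boot all_algebra boolp.

Set Implicit Arguments.
Unset Strict Implicit.
Unset Printing Implicit Defensive.

Import GRing.Theory.
Local Open Scope ring_scope.

(* Right R-modules are left modules over the converse ring; R may be zero. *)
Notation rmod R := (lmodType R^c).

(* None stands for oo. *)
Definition enat := option nat.

Definition enat_le (a b : enat) : Prop :=
  match a, b with
  | _, None => True
  | None, Some _ => False
  | Some m, Some n => (m <= n)%N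
  end.

Definition einf (P : nat -> Prop) : enat :=
  match pselect (exists n, `[< P n >]) with
  | left ex => Some (ex_minn ex)
  | right _ => None
  end.

(* The least upper bound: the least finite one if there is any, and oo if not. *)
Definition esup (S : enat -> Prop) : enat :=
  einf (fun n => forall a, S a -> enat_le a (Some n)).

(* A resolution ... -> P 1 -> P 0 -> A -> 0 with P k = 0 for k > n, in a
   category given by its morphisms, its zero objects, and the surjectivity
   and exactness conditions that the resolution is required to satisfy. *)
Definition resolution (O : Type) (hom : O -> O -> Type) (zero : O -> Prop)
    (surj : forall X Y, hom X Y -> Prop)
    (exact : forall X Y Z, hom X Y -> hom Y Z -> Prop)
    (proj : O -> Prop) (A : O) (n : nat) : Prop :=
  exists (P : nat -> O) (d : forall k, hom (P k.+1) (P k)) (e : hom (P 0%N) A),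
    [/\ forall k, proj (P k),
        surj _ _ e,
        exact _ _ _ (d 0%N) e,
        forall k, exact _ _ _ (d k.+1) (d k) &
        forall k, (n < k)%N -> zero (P k)].

Section Modules.
Variable R : pzRingType.
Implicit Types M N P F X Y Z : rmod R.

Definition mhom X Y := {linear X -> Y}.

Definition mzero X := forall x : X, x = 0.
Definition minj X Y (f : mhom X Y) := forall x, f x = 0 -> x = 0.
Definition msurj X Y (f : mhom X Y) := forall y, exists x, f x = y.
Definition mexact X Y Z (f : mhom X Y) (g : mhom Y Z) :=
  forall y, g y = 0 <-> exists x, f x = y.

(* The same conditions for the maps induced on Hom(F, -). *)
Definition hom_inj F X Y (f : mhom X Y) :=
  forall u : mhom F X, (forall a, f (u a) = 0) -> forall a, u a = 0.
Definition hom_surj F X Y (f : mhom X Y) :=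
  forall v : mhom F Y, exists u : mhom F X, forall a, f (u a) = v a.
Definition hom_exact F X Y Z (f : mhom X Y) (g : mhom Y Z) :=
  forall v : mhom F Y,
    (forall a, g (v a) = 0) <-> exists u : mhom F X, forall a, f (u a) = v a.

Definition mses X Y Z (f : mhom X Y) (g : mhom Y Z) :=
  [/\ minj f, mexact f g & msurj g].
Definition hom_ses F X Y Z (f : mhom X Y) (g : mhom Y Z) :=
  [/\ hom_inj F f, hom_exact F f g & hom_surj F g].

(* 'rV[R^c]_n is the free right R-module of rank n. *)
Definition fin_gen M := exists n (p : mhom 'rV[R^c]_n M), msurj p.
Definition fin_pres M :=
  exists m n (r : mhom 'rV[R^c]_m 'rV[R^c]_n) (p : mhom 'rV[R^c]_n M),
    mexact r p /\ msurj p.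

Definition mprojective P :=
  forall X Y (g : mhom X Y), msurj g -> hom_surj P g.

Definition coherent :=
  forall P Q (f : mhom P Q) K (i : mhom K P),
    mprojective P -> fin_gen P -> mprojective Q -> fin_gen Q ->
    minj i -> mexact i f -> fin_pres K.

Definition pure_ses X Y Z (f : mhom X Y) (g : mhom Y Z) :=
  mses f g /\ forall F, fin_pres F -> hom_ses F f g.

Definition pure_projective P :=
  forall X Y Z (f : mhom X Y) (g : mhom Y Z), pure_ses f g -> hom_ses P f g.

(* Purity of a long exact sequence, at its last and at its inner terms. *)
Definition pure_surj X Y (f : mhom X Y) :=
  msurj f /\ forall F, fin_pres F -> hom_surj F f.
Definition pure_exact X Y Z (f : mhom X Y) (g : mhom Y Z) :=
  mexact f g /\ forall F, fin_pres F -> hom_exact F f g.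

Definition pdim M : enat :=
  einf (resolution mzero msurj mexact mprojective M).
Definition ppdim M : enat :=
  einf (resolution mzero pure_surj pure_exact pure_projective M).

Definition gldim : enat := esup (fun a => exists M, a = pdim M).
Definition hereditary := enat_le gldim (Some 1%N).

Definition pgldim : enat := esup (fun a => exists M, a = ppdim M).

End Modules.

(* Not zmodType: the words that make up a morphism of a localization run
   through arbitrary complexes of modules, so that its morphism groups lie in a
   universe above that of the carriers of a zmodType. *)
Record abgrp := AbGrp {
  ab_car :> Type;
  ab0 : ab_car;
  abN : ab_car -> ab_car;
  abD : ab_car -> ab_car -> ab_car;
  abDA : forall a b c, abD a (abD b c) = abD (abD a b) c;
  abDC : forall a b, abD a b = abD b a;
  abD0 : forall a, abD a ab0 = a;
  abDN : forall a, abD a (abN a) = ab0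
}.
Arguments ab0 {_}.

(* Composition is in diagrammatic order: pcomp f g is "f, then g". *)
Record preadd := PreAdd {
  pob :> Type;
  phom : pob -> pob -> abgrp;
  pid : forall X, phom X X;
  pcomp : forall X Y Z, phom X Y -> phom Y Z -> phom X Z;
  pcompA : forall W X Y Z (f : phom W X) (g : phom X Y) (h : phom Y Z),
    pcomp f (pcomp g h) = pcomp (pcomp f g) h;
  pcomp1l : forall X Y (f : phom X Y), pcomp (pid X) f = f;
  pcomp1r : forall X Y (f : phom X Y), pcomp f (pid Y) = f;
  pcompDl : forall X Y Z (f g : phom X Y) (h : phom Y Z),
    pcomp (abD f g) h = abD (pcomp f h) (pcomp g h);
  pcompDr : forall X Y Z (h : phom X Y) (f g : phom Y Z),
    pcomp h (abD f g) = abD (pcomp h f) (pcomp h g)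
}.
Arguments pid {p} X.

Section Compact.
Variable T : preadd.

Definition is_coproduct (I : Type) (X : I -> T) (S : T)
    (iota : forall i, phom (X i) S) :=
  forall (Z : T) (g : forall i, phom (X i) Z),
    exists! h : phom S Z, forall i, pcomp (iota i) h = g i.

(* f is the image of the finitely supported family g under the canonical map
   from the direct sum of the T(c, X i) to T(c, S). *)
Definition is_sum_of (I : Type) (X : I -> T) (S : T)
    (iota : forall i, phom (X i) S) (c : T)
    (g : forall i, phom c (X i)) (f : phom c S) :=
  exists s : list I,
    [/\ List.NoDup s,
        forall i, g i <> ab0 -> List.In i s &
        f = foldr (fun i a => abD (pcomp (g i) (iota i)) a) ab0 s].

(* The canonical map from the direct sum is bijective. *)
Definition compact (c : T) :=
  forall (I : Type) (X : I -> T) (S : T) (iota : forall i, phom (X i) S),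
    is_coproduct iota ->
    forall f : phom c S,
      exists! g : (forall i, phom c (X i)), is_sum_of iota g f.

Definition fullsub (A : T -> Prop) : preadd :=
  @PreAdd {X : T | A X}
    (fun X Y => phom (sval X) (sval Y)) (fun X => pid (sval X))
    (fun X Y Z => @pcomp T (sval X) (sval Y) (sval Z))
    (fun W X Y Z => @pcompA T (sval W) (sval X) (sval Y) (sval Z))
    (fun X Y => @pcomp1l T (sval X) (sval Y))
    (fun X Y => @pcomp1r T (sval X) (sval Y))
    (fun X Y Z => @pcompDl T (sval X) (sval Y) (sval Z))
    (fun X Y Z => @pcompDr T (sval X) (sval Y) (sval Z)).

Definition compacts : preadd := fullsub compact.

End Compact.

Section FunctorCategory.
Variable C : preadd.

(* The objects of Mod-C: additive functors from C^op to abelian groups. *)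
Record addfun := AddFun {
  fob :> C -> abgrp;
  fmap : forall a b, phom a b -> fob b -> fob a;
  fmapD : forall a b (u : phom a b) x y,
    fmap u (abD x y) = abD (fmap u x) (fmap u y);
  fmap_add : forall a b (u v : phom a b) x,
    fmap (abD u v) x = abD (fmap u x) (fmap v x);
  fmap1 : forall a x, fmap (pid a) x = x;
  fmap_comp : forall a b c (u : phom a b) (v : phom b c) x,
    fmap (pcomp u v) x = fmap u (fmap v x)
}.

Record nat_trans (F G : addfun) := NatTrans {
  nt :> forall a, F a -> G a;
  ntD : forall a (x y : F a), nt (abD x y) = abD (nt x) (nt y);
  nt_nat : forall a b (u : phom a b) x, nt (fmap u x) = fmap u (nt x)
}.

(* Epimorphisms and exactness in Mod-C are computed objectwise. *)
Definition fzero (F : addfun) := forall a (x : F a), x = ab0.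
Definition fepi F G (t : nat_trans F G) := forall a y, exists x, t a x = y.
Definition fexact F G H (s : nat_trans F G) (t : nat_trans G H) :=
  forall a y, t a y = ab0 <-> exists x, s a x = y.

Definition fprojective (P : addfun) :=
  forall F G (t : nat_trans F G), fepi t ->
  forall v : nat_trans P G, exists u : nat_trans P F, forall a x, t a (u a x) = v a x.

Definition fpdim (F : addfun) : enat :=
  einf (resolution fzero fepi fexact fprojective F).

End FunctorCategory.

(* X |-> T(-, X) restricted to the compact objects. *)
Definition yoneda (T : preadd) (X : T) : addfun (compacts T) :=
  @AddFun (compacts T)
    (fun c => phom (sval c) X)
    (fun a b u x => pcomp (u : phom (sval a) (sval b)) x)
    (fun a b u x y => pcompDr (u : phom (sval a) (sval b)) x y)
    (fun a b u v x => pcompDl (u : phom (sval a) (sval b)) v x)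
    (fun a x => pcomp1l x)
    (fun a b c u v x =>
       esym (pcompA (u : phom (sval a) (sval b)) (v : phom (sval b) (sval c)) x)).

Definition pgldim_cat (T : preadd) : enat :=
  esup (fun a => exists X : T, a = fpdim (yoneda X)).

Definition mklin (R : pzRingType) (U V : lmodType R) (f : U -> V)
  (Hf : linear f) : {linear U -> V} :=
  HB.pack f (GRing.isLinear.Build R U V *:%R f Hf).

Section Complexes.
Variable R : pzRingType.

(* Cohomologically graded unbounded complexes.  There is a map cd i j for all
   i and j, which vanishes unless j = i + 1. *)
Record cpx := Cpx {
  cob :> int -> rmod R;
  cd : forall i j, {linear cob i -> cob j};
  cd_shape : forall i j x, i + 1 != j -> cd i j x = 0;
  cdd : forall i j k x, cd j k (cd i j x) = 0
}.

Record cmap (X Y : cpx) := CMap {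
  cm :> forall n, {linear X n -> Y n};
  cm_d : forall i j x, cm j (cd X i j x) = cd Y i j (cm i x)
}.

Definition cycle (X : cpx) n (x : X n) := forall j, cd X n j x = 0.
Definition boundary (X : cpx) n (x : X n) := exists i y, cd X i n y = x.

(* H^n(f) is injective and surjective for all n. *)
Definition qis (X Y : cpx) (f : cmap X Y) :=
  (forall n (x : X n), cycle x -> boundary (f n x) -> boundary x) /\
  (forall n (y : Y n), cycle y -> exists x : X n, cycle x /\ boundary (f n x - y)).

Definition cmap_of (X Y : cpx) (f : forall n, X n -> Y n)
    (fl : forall n, linear (f n))
    (fd : forall i j x, f j (cd X i j x) = cd Y i j (f i x)) : cmap X Y :=
  @CMap X Y (fun n => mklin (fl n)) fd.

Definition cmap_id (X : cpx) : cmap X X.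
Proof. by apply: (@cmap_of X X (fun n x => x)). Defined.

Definition cmap_comp (X Y Z : cpx) (f : cmap X Y) (g : cmap Y Z) : cmap X Z.
Proof.
apply: (@cmap_of X Z (fun n x => g n (f n x))).
- by move=> n a x y; rewrite !linearP.
- by move=> i j x; rewrite !cm_d.
Defined.

Definition cmap_zero (X Y : cpx) : cmap X Y.
Proof.
apply: (@cmap_of X Y (fun n x => 0)).
- by move=> n a x y; rewrite scaler0 addr0.
- by move=> i j x; rewrite linear0.
Defined.

Definition cmap_opp (X : cpx) : cmap X X.
Proof.
apply: (@cmap_of X X (fun n x => - x)).
- by move=> n a x y; rewrite opprD scalerN.
- by move=> i j x; rewrite linearN.
Defined.

Definition cmap_add (X Y : cpx) (f g : cmap X Y) : cmap X Y.
Proof.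
apply: (@cmap_of X Y (fun n x => f n x + g n x)).
- by move=> n a x y; rewrite !linearP scalerDr addrACA.
- by move=> i j x; rewrite linearD !cm_d.
Defined.

Fact cpx_sum_linear (X Y : cpx) i j :
  linear (fun p : X i * Y i => (cd X i j p.1, cd Y i j p.2)).
Proof. by move=> a [x y] [x' y'] /=; rewrite !linearP. Qed.

Definition cpx_sum (X Y : cpx) : cpx.
Proof.
apply: (@Cpx (fun n => (X n * Y n)%type) (fun i j => mklin (@cpx_sum_linear X Y i j))).
- by move=> i j [x y] ne /=; rewrite !cd_shape.
- by move=> i j k [x y] /=; rewrite !cdd.
Defined.

Definition cpx_diag (X : cpx) : cmap X (cpx_sum X X).
Proof. by apply: (@cmap_of X (cpx_sum X X) (fun n x => (x, x))). Defined.

Definition cpx_pr1 (X Y : cpx) : cmap (cpx_sum X Y) X.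
Proof. by apply: (@cmap_of (cpx_sum X Y) X (fun n p => p.1)). Defined.

Definition cpx_pr2 (X Y : cpx) : cmap (cpx_sum X Y) Y.
Proof. by apply: (@cmap_of (cpx_sum X Y) Y (fun n p => p.2)). Defined.

Definition cpx_codiag (X : cpx) : cmap (cpx_sum X X) X :=
  cmap_add (cpx_pr1 X X) (cpx_pr2 X X).

Definition cmap_sum (X X' Y Y' : cpx) (f : cmap X X') (g : cmap Y Y') :
  cmap (cpx_sum X Y) (cpx_sum X' Y').
Proof.
apply: (@cmap_of (cpx_sum X Y) (cpx_sum X' Y') (fun n p => (f n p.1, g n p.2))).
- by move=> n a [x y] [x' y'] /=; rewrite !linearP.
- by move=> i j [x y] /=; rewrite !cm_d.
Defined.

Lemma qis_id X : qis (cmap_id X).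
Proof.
split=> // n y cy; exists y; split=> //=.
by exists n, 0; rewrite linear0 subrr.
Qed.

(* Boundaries can be reindexed to come from degree n - 1. *)
Lemma boundaryE (X : cpx) n (x : X n) :
  boundary x -> exists y, cd X (n - 1) n y = x.
Proof.
case=> i [y <-]; have [e|ne] := eqVneq (i + 1) n; last first.
  by exists 0; rewrite linear0 cd_shape.
have e' : i = n - 1 by rewrite -e addrK.
by move: y; rewrite e' => y; exists y.
Qed.

Lemma qis_sum X X' Y Y' (f : cmap X X') (g : cmap Y Y') :
  qis f -> qis g -> qis (cmap_sum f g).
Proof.
move=> [fi fs] [gi gs]; split=> n [x y] cxy.
  move=> [i [[u v] /= [bu bv]]].
  have /boundaryE[x' <-] : boundary x.
    by apply: fi; [move=> j; case: (cxy j) | exists i, u].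
  have /boundaryE[y' <-] : boundary y.
    by apply: gi; [move=> j; case: (cxy j) | exists i, v].
  by exists (n - 1), (x', y').
have [j|x' [cx /boundaryE[u eu]]] := fs n x; first by case: (cxy j).
have [j|y' [cy /boundaryE[v ev]]] := gs n y; first by case: (cxy j).
exists (x', y'); split=> [j /=|]; first by rewrite cx cy.
by exists (n - 1), (u, v); rewrite /= eu ev.
Qed.

(* The derived category is the localization (of Gabriel and Zisman) of the
   category of complexes at the quasi-isomorphisms: morphisms are words in
   chain maps and formal inverses of quasi-isomorphisms, modulo zz_eq. *)
Inductive zz : cpx -> cpx -> Type :=
| zz_map X Y : cmap X Y -> zz X Y
| zz_inv X Y (s : cmap X Y) : qis s -> zz Y X
| zz_comp X Y Z : zz X Y -> zz Y Z -> zz X Z.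

Inductive zz_eq : forall X Y, zz X Y -> zz X Y -> Prop :=
| zz_refl X Y (u : zz X Y) : zz_eq u u
| zz_sym X Y (u v : zz X Y) : zz_eq u v -> zz_eq v u
| zz_trans X Y (u v w : zz X Y) : zz_eq u v -> zz_eq v w -> zz_eq u w
| zz_congr X Y Z (u u' : zz X Y) (v v' : zz Y Z) :
    zz_eq u u' -> zz_eq v v' -> zz_eq (zz_comp u v) (zz_comp u' v')
| zz_assoc W X Y Z (u : zz W X) (v : zz X Y) (w : zz Y Z) :
    zz_eq (zz_comp u (zz_comp v w)) (zz_comp (zz_comp u v) w)
| zz_idl X Y (u : zz X Y) : zz_eq (zz_comp (zz_map (cmap_id X)) u) u
| zz_idr X Y (u : zz X Y) : zz_eq (zz_comp u (zz_map (cmap_id Y))) u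
| zz_ext X Y (f g : cmap X Y) :
    (forall n x, f n x = g n x) -> zz_eq (zz_map f) (zz_map g)
| zz_mapM X Y Z (f : cmap X Y) (g : cmap Y Z) :
    zz_eq (zz_comp (zz_map f) (zz_map g)) (zz_map (cmap_comp f g))
| zz_invr X Y (s : cmap X Y) (q : qis s) :
    zz_eq (zz_comp (zz_map s) (zz_inv q)) (zz_map (cmap_id X))
| zz_invl X Y (s : cmap X Y) (q : qis s) :
    zz_eq (zz_comp (zz_inv q) (zz_map s)) (zz_map (cmap_id Y)).

Definition dhom X Y := {A : zz X Y -> Prop | exists u, A = zz_eq u}.

Definition dpi X Y (u : zz X Y) : dhom X Y :=
  exist _ (zz_eq u) (ex_intro _ u erefl).

Definition drepr X Y (f : dhom X Y) : zz X Y := sval (cid (svalP f)).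

Lemma dreprK X Y (f : dhom X Y) : dpi (drepr f) = f.
Proof.
rewrite /drepr; case: cid => u /=; case: f => A H /= e.
exact/eq_exist/esym.
Qed.

Lemma dpiP X Y (u v : zz X Y) : dpi u = dpi v <-> zz_eq u v.
Proof.
split=> [/(congr1 sval) /= ->|uv]; first exact: zz_refl.
apply: eq_exist; apply/funext => w; apply/propext.
split=> h; last exact: zz_trans uv h.
exact: zz_trans (zz_sym uv) h.
Qed.

Lemma drepr_dpi X Y (u : zz X Y) : zz_eq (drepr (dpi u)) u.
Proof. by apply/dpiP; rewrite dreprK. Qed.

Definition dcomp X Y Z (f : dhom X Y) (g : dhom Y Z) : dhom X Z :=
  dpi (zz_comp (drepr f) (drepr g)).

Local Notation "f ;; g" := (dcomp f g) (at level 40, left associativity).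

Definition dmap X Y (f : cmap X Y) : dhom X Y := dpi (zz_map f).
Definition dinv X Y (s : cmap X Y) (q : qis s) : dhom Y X := dpi (zz_inv q).

Lemma dcompE X Y Z (u : zz X Y) (v : zz Y Z) : dpi (zz_comp u v) = dpi u ;; dpi v.
Proof. by apply/dpiP; apply: zz_congr; apply: zz_sym; apply: drepr_dpi. Qed.

Lemma dhom_ind (P : forall X Y, dhom X Y -> Prop) :
  (forall X Y (f : cmap X Y), P _ _ (dmap f)) ->
  (forall X Y (s : cmap X Y) (q : qis s), P _ _ (dinv q)) ->
  (forall X Y Z (f : dhom X Y) (g : dhom Y Z), P _ _ f -> P _ _ g -> P _ _ (f ;; g)) ->
  forall X Y (f : dhom X Y), P _ _ f.
Proof.
move=> Pm Pi Pc X Y f; rewrite -(dreprK f).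
elim: (drepr f) => {X Y f} [X Y f|X Y s q|X Y Z u Pu v Pv]; [exact: Pm|exact: Pi|].
by rewrite dcompE; apply: Pc.
Qed.

Lemma dcompA W X Y Z (f : dhom W X) (g : dhom X Y) (h : dhom Y Z) :
  f ;; (g ;; h) = f ;; g ;; h.
Proof.
rewrite -(dreprK f) -(dreprK g) -(dreprK h) -!dcompE.
by apply/dpiP; apply: zz_assoc.
Qed.

Lemma dcomp1l X Y (f : dhom X Y) : dmap (cmap_id X) ;; f = f.
Proof. by rewrite -(dreprK f) -dcompE; apply/dpiP; apply: zz_idl. Qed.

Lemma dcomp1r X Y (f : dhom X Y) : f ;; dmap (cmap_id Y) = f.
Proof. by rewrite -(dreprK f) -dcompE; apply/dpiP; apply: zz_idr. Qed.

Lemma dmap_ext X Y (f g : cmap X Y) :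
  (forall n x, f n x = g n x) -> dmap f = dmap g.
Proof. by move=> fg; apply/dpiP; apply: zz_ext. Qed.

Lemma dmapM X Y Z (f : cmap X Y) (g : cmap Y Z) :
  dmap f ;; dmap g = dmap (cmap_comp f g).
Proof. by rewrite -dcompE; apply/dpiP; apply: zz_mapM. Qed.

Lemma dinvr X Y (s : cmap X Y) (q : qis s) :
  dmap s ;; dinv q = dmap (cmap_id X).
Proof. by rewrite -dcompE; apply/dpiP; apply: zz_invr. Qed.

Lemma dinvl X Y (s : cmap X Y) (q : qis s) :
  dinv q ;; dmap s = dmap (cmap_id Y).
Proof. by rewrite -dcompE; apply/dpiP; apply: zz_invl. Qed.

(* The extension to words of an endofunctor of the category of complexes that
   preserves quasi-isomorphisms. *)
Record qfun := QFun {
  q0 :> cpx -> cpx;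
  q1 : forall X Y, cmap X Y -> cmap (q0 X) (q0 Y);
  q1_ext : forall X Y (f g : cmap X Y),
    (forall n x, f n x = g n x) -> forall n x, q1 f n x = q1 g n x;
  q1_id : forall X n x, q1 (cmap_id X) n x = x;
  q1_comp : forall X Y Z (f : cmap X Y) (g : cmap Y Z) n x,
    q1 (cmap_comp f g) n x = q1 g n (q1 f n x);
  q1_qis : forall X Y (f : cmap X Y), qis f -> qis (q1 f)
}.

Fixpoint zz_lift (F : qfun) X Y (u : zz X Y) : zz (F X) (F Y) :=
  match u with
  | zz_map X Y f => zz_map (q1 F f)
  | zz_inv X Y s q => zz_inv (q1_qis F q)
  | zz_comp X Y Z u v => zz_comp (zz_lift F u) (zz_lift F v)
  end.

Definition dlift (F : qfun) X Y (f : dhom X Y) : dhom (F X) (F Y) :=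
  dpi (zz_lift F (drepr f)).

Lemma zz_lift_eq (F : qfun) X Y (u v : zz X Y) :
  zz_eq u v -> zz_eq (zz_lift F u) (zz_lift F v).
Proof.
have Fid Z : zz_eq (zz_map (q1 F (cmap_id Z))) (zz_map (cmap_id (F Z))).
  by apply: zz_ext => n x; rewrite q1_id.
elim=> {X Y u v} /=.
- by move=> X Y u; apply: zz_refl.
- by move=> X Y u v _; apply: zz_sym.
- by move=> X Y u v w _ h _; apply: zz_trans h.
- by move=> X Y Z u u' v v' _ h _ h'; apply: zz_congr.
- by move=> W X Y Z u v w; apply: zz_assoc.
- move=> X Y u; apply: zz_trans (zz_idl _).
  by apply: zz_congr; [apply: Fid | apply: zz_refl].
- move=> X Y u; apply: zz_trans (zz_idr _).
  by apply: zz_congr; [apply: zz_refl | apply: Fid].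
- by move=> X Y f g fg; apply: zz_ext; apply: q1_ext.
- move=> X Y Z f g; apply: zz_trans (zz_mapM _ _) _.
  by apply: zz_ext => n x; rewrite q1_comp.
- by move=> X Y s q; apply: zz_trans (zz_invr _) (zz_sym (Fid _)).
- by move=> X Y s q; apply: zz_trans (zz_invl _) (zz_sym (Fid _)).
Qed.

Lemma dlift_pi (F : qfun) X Y (u : zz X Y) : dlift F (dpi u) = dpi (zz_lift F u).
Proof. by apply/dpiP; apply: zz_lift_eq; apply: drepr_dpi. Qed.

Lemma dlift_map (F : qfun) X Y (f : cmap X Y) : dlift F (dmap f) = dmap (q1 F f).
Proof. exact: dlift_pi. Qed.

Lemma dlift_inv (F : qfun) X Y (s : cmap X Y) (q : qis s) :
  dlift F (dinv q) = dinv (q1_qis F q).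
Proof. exact: dlift_pi. Qed.

Lemma dlift_comp (F : qfun) X Y Z (f : dhom X Y) (g : dhom Y Z) :
  dlift F (f ;; g) = dlift F f ;; dlift F g.
Proof. by rewrite -(dreprK f) -(dreprK g) -dcompE !dlift_pi /= dcompE. Qed.

Definition qfun_sumL (Y : cpx) : qfun.
Proof.
exists (fun X => cpx_sum X Y) (fun X X' f => cmap_sum f (cmap_id Y)).
- by move=> X X' f g fg n [x y] /=; rewrite fg.
- by move=> X n [x y].
- by move=> X X' X'' f g n [x y].
- by move=> X X' f qf; apply: qis_sum => //; apply: qis_id.
Defined.

Definition qfun_sumR (X : cpx) : qfun.
Proof.
exists (fun Y => cpx_sum X Y) (fun Y Y' f => cmap_sum (cmap_id X) f).
- by move=> Y Y' f g fg n [x y] /=; rewrite fg.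
- by move=> Y n [x y].
- by move=> Y Y' Y'' f g n [x y].
- by move=> Y Y' f qf; apply: qis_sum => //; apply: qis_id.
Defined.

(* Addition: X -> X + X -> Y + X -> Y + Y -> Y, where the outer maps are the
   diagonal and the codiagonal, and the inner ones are f + 1 and 1 + g. *)
Definition dpair X Y Z (f : dhom X Y) (g : dhom X Z) : dhom X (cpx_sum Y Z) :=
  dmap (cpx_diag X) ;; dlift (qfun_sumL X) f ;; dlift (qfun_sumR Y) g.

Definition dadd X Y (f g : dhom X Y) : dhom X Y :=
  dpair f g ;; dmap (cpx_codiag Y).

Definition dzero X Y : dhom X Y := dmap (cmap_zero X Y).
Definition dopp X Y (f : dhom X Y) : dhom X Y := f ;; dmap (cmap_opp Y).

Local Notation L Z := (dlift (qfun_sumL Z)).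
Local Notation Rr Z := (dlift (qfun_sumR Z)).

Lemma dinv_square X Y X' Y' (s : cmap X Y) (q : qis s) (s' : cmap X' Y')
    (q' : qis s') (a : dhom X X') (b : dhom Y Y') :
  dmap s ;; b = a ;; dmap s' -> dinv q ;; a = b ;; dinv q'.
Proof.
move=> e; rewrite -[LHS]dcomp1r -(dinvr q') dcompA -[_ ;; a ;; _]dcompA -e.
by rewrite dcompA dinvl dcomp1l.
Qed.

Lemma dpr1L X X' Y (f : dhom X X') :
  L Y f ;; dmap (cpx_pr1 X' Y) = dmap (cpx_pr1 X Y) ;; f.
Proof.
elim/dhom_ind: f => {X X'} [X X' f|X X' s q|X X' X'' f g IHf IHg].
- by rewrite dlift_map !dmapM; apply: dmap_ext => n [x y].
- rewrite dlift_inv; apply: dinv_square.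
  by rewrite !dmapM; apply: dmap_ext => n [x y].
- by rewrite dlift_comp -[LHS]dcompA IHg [LHS]dcompA IHf -dcompA.
Qed.

Lemma dpr2R X Y Y' (f : dhom Y Y') :
  Rr X f ;; dmap (cpx_pr2 X Y') = dmap (cpx_pr2 X Y) ;; f.
Proof.
elim/dhom_ind: f => {Y Y'} [X' X'' f|X' X'' s q|X' X'' X''' f g IHf IHg].
- by rewrite dlift_map !dmapM; apply: dmap_ext => n [x y].
- rewrite dlift_inv; apply: dinv_square.
  by rewrite !dmapM; apply: dmap_ext => n [x y].
- by rewrite dlift_comp -[LHS]dcompA IHg [LHS]dcompA IHf -dcompA.
Qed.

Lemma dpr2L X X' Y (f : dhom X X') :
  L Y f ;; dmap (cpx_pr2 X' Y) = dmap (cpx_pr2 X Y).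
Proof.
elim/dhom_ind: f => {X X'} [X X' f|X X' s q|X X' X'' f g IHf IHg].
- by rewrite dlift_map !dmapM; apply: dmap_ext => n [x y].
- rewrite dlift_inv -[RHS]dcomp1l -(dinvl (q1_qis (qfun_sumL Y) q)) -dcompA.
  by congr (_ ;; _); rewrite dmapM; apply: dmap_ext => n [x y].
- by rewrite dlift_comp -dcompA IHg IHf.
Qed.

Lemma dpr1R X Y Y' (f : dhom Y Y') :
  Rr X f ;; dmap (cpx_pr1 X Y') = dmap (cpx_pr1 X Y).
Proof.
elim/dhom_ind: f => {Y Y'} [X' X'' f|X' X'' s q|X' X'' X''' f g IHf IHg].
- by rewrite dlift_map !dmapM; apply: dmap_ext => n [x y].
- rewrite dlift_inv -[RHS]dcomp1l -(dinvl (q1_qis (qfun_sumR X) q)) -dcompA.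
  by congr (_ ;; _); rewrite dmapM; apply: dmap_ext => n [x y].
- by rewrite dlift_comp -dcompA IHg IHf.
Qed.

Lemma dsumC X X' Y Y' (f : dhom X X') (g : dhom Y Y') :
  L Y f ;; Rr X' g = Rr X g ;; L Y' f.
Proof.
have sumC_map Z Z' (h : cmap Z Z') (k : dhom X X') :
    L Z k ;; Rr X' (dmap h) = Rr X (dmap h) ;; L Z' k.
  elim/dhom_ind: k => {X X' f} [A A' f|A A' s q|A A' A'' f f' IHf IHf'].
  - by rewrite !dlift_map !dmapM; apply: dmap_ext => n [x y].
  - rewrite !dlift_map !dlift_inv; apply: dinv_square.
    by rewrite !dmapM; apply: dmap_ext => n [x y].
  - by rewrite !dlift_comp -dcompA IHf' dcompA IHf dcompA.
elim/dhom_ind: g => {Y Y'} [Y Y' g|Y Y' s q|Y Y' Y'' g g' IHg IHg'].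
- exact: sumC_map.
- rewrite !dlift_inv; apply/esym; apply: dinv_square.
  by have := sumC_map _ _ s f; rewrite !dlift_map => ->.
- by rewrite !dlift_comp [LHS]dcompA IHg -[LHS]dcompA IHg' dcompA.
Qed.

Lemma ddiag X Y (f : dhom X Y) :
  f ;; dmap (cpx_diag Y) = dmap (cpx_diag X) ;; L X f ;; Rr Y f.
Proof.
elim/dhom_ind: f => {X Y} [X Y f|X Y s q|X Y Z f g IHf IHg].
- by rewrite !dlift_map !dmapM; apply: dmap_ext.
- rewrite -[LHS]dcomp1r.
  have e : dmap (cmap_id (cpx_sum X X)) =
      dmap (q1 (qfun_sumR X) s) ;; dmap (q1 (qfun_sumL Y) s) ;;
      (dinv (q1_qis (qfun_sumL Y) q) ;; dinv (q1_qis (qfun_sumR X) q)).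
    by rewrite dcompA -[_ ;; dinv _]dcompA dinvr dcomp1r dinvr.
  rewrite e -!dlift_map -!dlift_inv !dcompA -[_ ;; Rr X _ ;; L Y _]dcompA -dsumC.
  have -> : dinv q ;; dmap (cpx_diag X) ;; (L X (dmap s) ;; Rr Y (dmap s))
          = dmap (cpx_diag Y).
    rewrite -[RHS]dcomp1l -(dinvl q) -!dcompA; congr (_ ;; _).
    by rewrite !dlift_map !dmapM; apply: dmap_ext.
  by rewrite -!dcompA dsumC.
- rewrite -dcompA IHg !dcompA IHf !dlift_comp -!dcompA.
  by congr (_ ;; (_ ;; _)); rewrite !dcompA dsumC.
Qed.

Lemma dpair1 X Y Z (f : dhom X Y) (g : dhom X Z) :
  dpair f g ;; dmap (cpx_pr1 Y Z) = f.
Proof.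
rewrite /dpair -[LHS](dcompA (_ ;; _) (Rr Y g)) dpr1R -(dcompA _ (L X f)) dpr1L.
rewrite dcompA dmapM -[RHS]dcomp1l; congr (_ ;; _).
exact: dmap_ext.
Qed.

Lemma dpair2 X Y Z (f : dhom X Y) (g : dhom X Z) :
  dpair f g ;; dmap (cpx_pr2 Y Z) = g.
Proof.
rewrite /dpair -[LHS](dcompA (_ ;; _) (Rr Y g)) dpr2R [LHS]dcompA.
rewrite -(dcompA _ (L X f)) dpr2L dmapM -[RHS]dcomp1l; congr (_ ;; _).
exact: dmap_ext.
Qed.

Lemma dadd_map X Y Z (u : dhom X Y) (a b : cmap Y Z) :
  dadd (u ;; dmap a) (u ;; dmap b) = u ;; dmap (cmap_add a b).
Proof.
rewrite /dadd /dpair !dlift_comp.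
have -> : dmap (cpx_diag X) ;; (L X u ;; L X (dmap a)) ;; (Rr Z u ;; Rr Z (dmap b))
   = u ;; dmap (cpx_diag Y) ;; (L Y (dmap a) ;; Rr Z (dmap b)).
  by rewrite ddiag !dcompA -[_ ;; L X (dmap a) ;; _]dcompA dsumC !dcompA.
rewrite -!dcompA; congr (_ ;; _).
by rewrite !dlift_map !dmapM; apply: dmap_ext.
Qed.

Lemma dadd_pair X Y (f g : dhom X Y) :
  dadd f g = dpair f g ;; dmap (cmap_add (cpx_pr1 Y Y) (cpx_pr2 Y Y)).
Proof. by []. Qed.

Lemma daddC X Y (f g : dhom X Y) : dadd f g = dadd g f.
Proof.
rewrite dadd_pair -[in RHS](dpair1 f g) -[in X in dadd X _](dpair2 f g) dadd_map.
by congr (_ ;; _); apply: dmap_ext => n x /=; rewrite addrC.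
Qed.

Lemma daddA X Y (f g h : dhom X Y) : dadd f (dadd g h) = dadd (dadd f g) h.
Proof.
pose u := dpair f (dpair g h).
have uf : f = u ;; dmap (cpx_pr1 _ _) by rewrite dpair1.
have ugh : dpair g h = u ;; dmap (cpx_pr2 _ _) by rewrite dpair2.
have ug : g = u ;; dmap (cmap_comp (cpx_pr2 _ _) (cpx_pr1 _ _)).
  by rewrite -dmapM dcompA -ugh dpair1.
have uh : h = u ;; dmap (cmap_comp (cpx_pr2 _ _) (cpx_pr2 _ _)).
  by rewrite -dmapM dcompA -ugh dpair2.
move: u uf ug uh {ugh} => u -> -> ->; rewrite !dadd_map.
by congr (_ ;; _); apply: dmap_ext => n x /=; rewrite addrA.
Qed.

Lemma dcomp0 X Y Z (f : dhom X Y) : f ;; dzero Y Z = dzero X Z.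
Proof.
rewrite /dzero; elim/dhom_ind: f => {X Y} [X Y f|X Y s q|X Y W f g IHf IHg].
- by rewrite dmapM; apply: dmap_ext.
- rewrite -[RHS]dcomp1l -(dinvl q) -dcompA dmapM; congr (_ ;; _).
  exact: dmap_ext.
- by rewrite -dcompA IHg.
Qed.

Lemma dadd0 X Y (f : dhom X Y) : dadd f (dzero X Y) = f.
Proof.
rewrite -(dcomp0 Y f) -[in X in dadd X _](dcomp1r f) dadd_map -[RHS]dcomp1r.
by congr (_ ;; _); apply: dmap_ext => n x /=; rewrite addr0.
Qed.

Lemma daddN X Y (f : dhom X Y) : dadd f (dopp f) = dzero X Y.
Proof.
rewrite -(dcomp0 Y f) -[in X in dadd X _](dcomp1r f) dadd_map.
by congr (_ ;; _); apply: dmap_ext => n x /=; rewrite subrr.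
Qed.

Lemma dcompDr X Y Z (h : dhom X Y) (f g : dhom Y Z) :
  h ;; dadd f g = dadd (h ;; f) (h ;; g).
Proof.
rewrite dadd_pair dcompA -dadd_map -(dcompA h _ (dmap (cpx_pr1 _ _))) dpair1.
by rewrite -(dcompA h _ (dmap (cpx_pr2 _ _))) dpair2.
Qed.

Lemma dcodiag Y Z (h : dhom Y Z) :
  dmap (cpx_codiag Y) ;; h =
  dadd (dmap (cpx_pr1 Y Y) ;; h) (dmap (cpx_pr2 Y Y) ;; h).
Proof.
pose D := L Y h ;; Rr Z h.
have -> : dmap (cpx_pr1 Y Y) ;; h = D ;; dmap (cpx_pr1 Z Z).
  by rewrite /D -dcompA dpr1R dpr1L.
have -> : dmap (cpx_pr2 Y Y) ;; h = D ;; dmap (cpx_pr2 Z Z).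
  by rewrite /D dsumC -dcompA dpr2L dpr2R.
rewrite dadd_map {}/D.
elim/dhom_ind: h => {Y Z} [Y Z h|Y Z s q|Y Y' Z h k IHh IHk].
- by rewrite !dlift_map !dmapM; apply: dmap_ext => n x /=; rewrite linearD.
- rewrite -[LHS]dcomp1l.
  have <- : L Z (dinv q) ;; Rr Y (dinv q) ;; (Rr Y (dmap s) ;; L Z (dmap s)) =
       dmap (cmap_id (cpx_sum Z Z)).
    rewrite !dlift_inv !dlift_map dcompA -[_ ;; dinv _ ;; _]dcompA.
    by rewrite dinvl dcomp1r dinvl.
  rewrite -!dcompA; congr (_ ;; (_ ;; _)).
  rewrite -[RHS]dcomp1r -(dinvr q) !dcompA; congr (_ ;; _).
  by rewrite !dlift_map !dmapM; apply: dmap_ext => n x /=; rewrite linearD.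
- rewrite dcompA IHh !dlift_comp.
  have -> : L Y h ;; L Y k ;; (Rr Z h ;; Rr Z k)
          = L Y h ;; Rr Y' h ;; (L Y' k ;; Rr Z k).
    by rewrite !dcompA -[_ ;; L Y k ;; _]dcompA dsumC !dcompA.
  rewrite -[RHS](dcompA (_ ;; _) (_ ;; _)) -IHk.
  exact: esym (dcompA _ _ _).
Qed.

Lemma dcompDl X Y Z (f g : dhom X Y) (h : dhom Y Z) :
  dadd f g ;; h = dadd (f ;; h) (g ;; h).
Proof. by rewrite {1}/dadd -dcompA dcodiag dcompDr !dcompA dpair1 dpair2. Qed.

(* The localization functor is additive. *)
Lemma dmapD X Y (f g : cmap X Y) : dmap (cmap_add f g) = dadd (dmap f) (dmap g).
Proof. by rewrite -[LHS]dcomp1l -dadd_map !dcomp1l. Qed.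

Definition dgrp X Y : abgrp :=
  AbGrp (@daddA X Y) (@daddC X Y) (@dadd0 X Y) (@daddN X Y).

Definition derived : preadd :=
  @PreAdd cpx dgrp (fun X => dmap (cmap_id X)) (fun X Y Z => @dcomp X Y Z)
    dcompA dcomp1l dcomp1r dcompDl dcompDr.

Definition stalk_ob (M : rmod R) (n : int) : rmod R :=
  if n is Posz 0 then M else 'rV[R^c]_0.

Definition stalk_d (M : rmod R) i j : {linear stalk_ob M i -> stalk_ob M j} :=
  mklin (fun a (x y : stalk_ob M i) =>
           esym (etrans (addr0 _) (scaler0 (stalk_ob M j) a))).

(* M as a complex concentrated in degree 0. *)
Definition stalk (M : rmod R) : derived :=
  @Cpx (stalk_ob M) (stalk_d M) (fun i j x _ => erefl) (fun i j k x => erefl).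

End Complexes.

(* Main.v *)
(* Every complex has a resolution P by free modules that is cofibrant, so that
   morphisms P -> Y in D(R) are homotopy classes of chain maps; in particular direct
   sums of complexes are coproducts in D(R).  If c is compact and M a module, then
   every c -> M[n] factors through F[n] for some finitely presented F.  Hence a pure
   short exact sequence of modules stays exact under y.  If finitely presented
   modules are compact, then y moreover sends direct sums of them to projectives, and
   is fully faithful on them, so that it sends pure projective resolutions of M to
   projective resolutions of yM.  Conversely, let ... -> Q_1 -> Q_0 -> M be a pure
   resolution by direct sums of finitely presented modules.  If yM has a projective
   resolution of length n, comparing it with that by the yQ_k yields a map
   h : Q_n -> Q_(n+1) with d h d = d, so that the n-th syzygy of M is a direct summand
   of Q_n.  Over a hereditary ring every complex is isomorphic to its cohomology, and
   the same arguments apply to graded modules. *)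

From HB Require Import structures.
From mathcomp Require Import all_boot all_order all_algebra boolp zify.
Require Import Defs.

Set Implicit Arguments.
Unset Strict Implicit.
Unset Printing Implicit Defensive.

Import Order.TTheory GRing.Theory Num.Theory.
Local Open Scope ring_scope.

(** * Modules *)

(** Triangles are avoided. Over a cofibrant resolution [P] of [c], a morphism from [c] to a complex
    with zero differential is a family of cocycles [P n -> M], modulo maps that factor through the
    differential. Such targets include both the stalks and the cohomology of a complex over a
    hereditary ring, and they leave one independent problem per degree.

    A cocycle [P n -> M] lifts along every epimorphism, as [P n] is projective, but the lift need
    not be a cocycle. If it factors as a cocycle [P n -> F] followed by [F -> M] with [F] finitely
    presented, then it suffices to lift [F -> M], which is what purity grants. This is where purity
    meets compactness.

    Compactness speaks of direct sums only, so the factorization invokes it twice: for a sum over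
    all degrees, which tells where the induction on the degree starts, and for a free module, seen
    as a sum of copies of [R], in the inductive step.

    The hypotheses on finitely presented modules serve to give them finite resolutions by finitely
    generated projectives, hence compact stalks. *)

Section ZmodReflection.
Variable V : zmodType.
Inductive zexp := ZAtom of nat | ZZero | ZAdd of zexp & zexp | ZOpp of zexp.

Fixpoint zeval (r : seq V) e :=
  match e with
  | ZAtom i => nth 0 r i
  | ZZero => 0
  | ZAdd a b => zeval r a + zeval r b
  | ZOpp a => - zeval r a
  end.

(* Positive and negative multiplicities of an atom. *)
Fixpoint zcoef e i : nat * nat :=
  match e with
  | ZAtom j => (nat_of_bool (eqn i j), 0)%N
  | ZZero => (0, 0)%N
  | ZAdd a b => let: (p, q) := zcoef a i in let: (p', q') := zcoef b i in
                (Nat.add p p', Nat.add q q')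
  | ZOpp a => let: (p, q) := zcoef a i in (q, p)
  end.

Lemma zevalE r e : zeval r e =
  \sum_(i < size r) (nth 0 r i *+ (zcoef e i).1 - nth 0 r i *+ (zcoef e i).2).
Proof.
elim: e => [j||a IHa b IHb|a IHa] /=.
- have [jr|rj] := ltnP j (size r).
    rewrite (bigD1 (Ordinal jr)) //= big1 => [|i /negbTE ne].
      by rewrite eqnE eqxx mulr1n subr0 addr0.
    by rewrite eqnE -val_eqE in ne *; rewrite [X in nat_of_bool X]ne mulr0n subr0.
  rewrite nth_default // big1 // => i _.
  by rewrite eqnE ltn_eqF ?mulr0n ?subr0 // (leq_trans (ltn_ord i)).
- by rewrite big1 // => i _; rewrite subr0.
- rewrite IHa IHb -big_split; apply: eq_bigr => i _ /=.
  case: (zcoef a i) (zcoef b i) => p q [p' q'] /=; rewrite addrACA.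
  by rewrite -[Nat.add p p']/(addn p p') -[Nat.add q q']/(addn q q') !mulrnDr opprD.
- rewrite IHa -sumrN; apply: eq_bigr => i _.
  by case: (zcoef a i) => p q /=; rewrite opprB.
Qed.

(** Comparing p + q' with p' + q avoids subtraction. [Nat.add] and [eqn] are used because they
    compute: [zmod] discharges the check by conversion, with [isT] as proof. *)
Definition zcheck n a b := all (fun i =>
  let: (p, q) := zcoef a i in let: (p', q') := zcoef b i in
  eqn (Nat.add p q') (Nat.add p' q)) (iota 0 n).

Lemma zcheckP r a b : zcheck (size r) a b -> zeval r a = zeval r b.
Proof.
move/allP => h; rewrite !zevalE; apply: eq_bigr => i _.
have := h i; rewrite mem_iota /= add0n ltn_ord => /(_ isT).
case: (zcoef a i) (zcoef b i) => p q [p' q'] /=.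
rewrite -[Nat.add p q']/(addn p q') -[Nat.add p' q]/(addn p' q) eqnE => /eqP e.
by apply/eqP; rewrite subr_eq addrAC eq_sym subr_eq -!mulrnDr e.
Qed.
End ZmodReflection.

Ltac zm_index r x :=
  lazymatch r with
  | nil => constr:(O)
  | ?y :: ?r' => match constr:(O) with
      | _ => let _ := match constr:(O) with _ => unify x y end in constr:(O)
      | _ => let n := zm_index r' x in constr:(S n)
      end
  end.
Ltac zm_mem r x :=
  lazymatch r with
  | nil => constr:(false)
  | ?y :: ?r' => match constr:(O) with
      | _ => let _ := match constr:(O) with _ => unify x y end in constr:(true)
      | _ => zm_mem r' x
      end
  end.
Ltac zm_atoms r t :=
  lazymatch t with
  | (?a + ?b)%R => let r1 := zm_atoms r a in zm_atoms r1 b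
  | (- ?a)%R => zm_atoms r a
  | 0%R => constr:(r)
  | _ => let m := zm_mem r t in
         lazymatch m with true => constr:(r) | false => constr:(t :: r) end
  end.
Ltac zm_reify r t :=
  lazymatch t with
  | (?a + ?b)%R => let x := zm_reify r a in let y := zm_reify r b in constr:(ZAdd x y)
  | (- ?a)%R => let x := zm_reify r a in constr:(ZOpp x)
  | 0%R => constr:(ZZero)
  | _ => let n := zm_index r t in constr:(ZAtom n)
  end.
(* Decides equations between Z-linear combinations of atoms in a zmodType. *)
Ltac zmod :=
  lazymatch goal with
  | |- ?a = ?b =>
    let T := type of a in
    let r0 := zm_atoms (@nil T) a in
    let r := zm_atoms r0 b in
    let x := zm_reify r a in
    let y := zm_reify r b in
    exact: (@zcheckP _ r x y isT)
  end.
Ltac zmodl := rewrite ?(scalerDr, scalerN); zmod.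

Section MkMod.
Variables (R : pzRingType) (T : Type).
Variables (z : T) (o : T -> T) (a : T -> T -> T) (s : R -> T -> T).
Hypotheses (aA : associative a) (aC : commutative a) (a0 : left_id z a)
  (aN : left_inverse z o a).
Hypotheses (sA : forall x y v, s x (s y v) = s (x * y) v) (s1 : left_id 1 s)
  (sDr : right_distributive s a) (sDl : forall v x y, s (x + y) v = a (s x v) (s y v)).

(** Submodules and quotients are cut out by arbitrary propositions, so equality and choice on their
    carriers have to be classical. *)
Definition mkmod_choice : choiceType := HB.pack T (gen_eqMixin T) (gen_choiceMixin T).
Definition mkmod_zmod : zmodType :=
  HB.pack T (Choice.on mkmod_choice) (@GRing.isZmodule.Build mkmod_choice z o a aA aC a0 aN).
Definition mkmod : lmodType R :=
  HB.pack T (GRing.Zmodule.on mkmod_zmod)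
   (@GRing.Zmodule_isLmodule.Build R mkmod_zmod s sA s1 sDr sDl).
End MkMod.

Lemma lin_ext (R : pzRingType) (U V : lmodType R) (f g : {linear U -> V}) :
  f =1 g -> f = g.
Proof.
move=> e; have {}e : (f : U -> V) = g by apply/funext.
case: f g e => f cf [g cg] /= e.
move: cf cg; rewrite e => -[[a] [b]] [[a'] [b']].
by rewrite (Prop_irrelevance a a') (Prop_irrelevance b b').
Qed.

Lemma lin_sum (R : pzRingType) (U V : lmodType R) (f : {linear U -> V}) (I : Type)
    (s : seq I) (F : I -> U) :
  f (\sum_(i <- s) F i) = \sum_(i <- s) f (F i).
Proof. exact: raddf_sum. Qed.

Section Submodule.
Variables (R : pzRingType) (M : lmodType R).

Definition subm (S : M -> Prop) := S 0 /\ forall a x y, S x -> S y -> S (a *: x + y).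

Variables (S : M -> Prop) (HS : subm S).
Implicit Types x y : M.

Lemma subm0 : S 0. Proof. by case: HS. Qed.
Lemma submD x y : S x -> S y -> S (x + y).
Proof. by case: HS => _ h Sx Sy; rewrite -[x]scale1r; apply: h. Qed.
Lemma submZ a x : S x -> S (a *: x).
Proof. by case: HS => S0 h Sx; rewrite -[_ *: _]addr0; apply: h. Qed.
Lemma submN x : S x -> S (- x).
Proof. by rewrite -scaleN1r; apply: submZ. Qed.
Lemma submB x y : S x -> S y -> S (x - y).
Proof. by move=> Sx Sy; apply: submD => //; apply: submN. Qed.
Lemma subm_sum (I : Type) (s : seq I) (F : I -> M) :
  (forall i, S (F i)) -> S (\sum_(i <- s) F i).
Proof. by move=> h; elim/big_ind: _ => //; [exact: subm0|exact: submD]. Qed.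

Local Notation T := {x : M | S x}.
Lemma sub_eq (u v : T) : sval u = sval v -> u = v.
Proof. by case: u v => [x p] [y q] /= e; apply: eq_exist. Qed.

Definition smod : lmodType R.
Proof.
apply: (@mkmod R T (exist _ 0 subm0) (fun u => exist _ _ (submN (svalP u)))
  (fun u v => exist _ _ (submD (svalP u) (svalP v)))
  (fun a u => exist _ _ (submZ a (svalP u)))).
- by move=> u v w; apply: sub_eq => /=; rewrite addrA.
- by move=> u v; apply: sub_eq => /=; rewrite addrC.
- by move=> u; apply: sub_eq => /=; rewrite add0r.
- by move=> u; apply: sub_eq => /=; rewrite addNr.
- by move=> a b u; apply: sub_eq => /=; rewrite scalerA.
- by move=> u; apply: sub_eq => /=; rewrite scale1r.
- by move=> a u v; apply: sub_eq => /=; rewrite scalerDr.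
- by move=> u a b; apply: sub_eq => /=; rewrite scalerDl.
Defined.

Fact sinc_linear : linear (fun u : smod => sval (u : T)).
Proof. by []. Qed.
Definition sinc : {linear smod -> M} := mklin sinc_linear.

Lemma sinc_inj (u v : smod) : sinc u = sinc v -> u = v.
Proof. exact: sub_eq. Qed.
Lemma sincP (u : smod) : S (sinc u).
Proof. exact: svalP. Qed.
Lemma sinc_ex x : S x -> exists u, sinc u = x.
Proof. by move=> Sx; exists (exist _ x Sx). Qed.

Section Lift.
Variables (X : lmodType R) (f : {linear X -> M}) (Sf : forall x : X, S (f x)).
Definition slift_fun (x : X) : smod := exist _ (f x) (Sf x).
Fact slift_linear : linear slift_fun.
Proof. by move=> a u v; apply: sub_eq; rewrite /= linearP. Qed.
Definition slift : {linear X -> smod} := mklin slift_linear.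
Lemma sinc_lift (x : X) : sinc (slift x) = f x.
Proof. by []. Qed.
End Lift.
End Submodule.

Section Quotient.
Variables (R : pzRingType) (M : lmodType R) (S : M -> Prop) (HS : subm S).

Local Notation T := {A : M -> Prop | exists x, A = fun y => S (y - x)}.
Definition qcls (x : M) : T := exist _ (fun y => S (y - x)) (ex_intro _ x erefl).
Definition qrep (u : T) : M := sval (cid (svalP u)).

Lemma qclsP x y : qcls x = qcls y <-> S (x - y).
Proof.
split=> [/(congr1 sval) /= e|Sxy].
  have : S (x - x) by rewrite subrr; exact: subm0.
  by rewrite -[S (x - x)]/((fun z => S (z - x)) x) e.
apply: eq_exist; apply/funext => z; apply/propext; split=> h.
  by have := submD HS h Sxy; rewrite addrA subrK.
by have := submB HS h Sxy; rewrite opprB addrA subrK.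
Qed.

Lemma qrepK u : qcls (qrep u) = u.
Proof.
rewrite /qrep; case: cid => x /= e; case: u e => A H /= e.
exact/eq_exist/esym.
Qed.
Lemma qrep_cls x : S (qrep (qcls x) - x).
Proof. by apply/qclsP; rewrite qrepK. Qed.

Let qD (u v : T) := qcls (qrep u + qrep v).
Let qN (u : T) := qcls (- qrep u).
Let qZ a (u : T) := qcls (a *: qrep u).

Lemma qDE x y : qD (qcls x) (qcls y) = qcls (x + y).
Proof. by apply/qclsP; rewrite opprD addrACA; apply: submD => //; apply: qrep_cls. Qed.
Lemma qNE x : qN (qcls x) = qcls (- x).
Proof. by apply/qclsP; rewrite -opprD; apply: submN => //; apply: qrep_cls. Qed.
Lemma qZE a x : qZ a (qcls x) = qcls (a *: x).
Proof. by apply/qclsP; rewrite -scalerBr; apply: submZ => //; apply: qrep_cls. Qed.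

Definition qmod : lmodType R.
Proof.
apply: (@mkmod R T (qcls 0) qN qD qZ).
- by move=> u v w; rewrite -(qrepK u) -(qrepK v) -(qrepK w) !qDE addrA.
- by move=> u v; rewrite -(qrepK u) -(qrepK v) !qDE addrC.
- by move=> u; rewrite -(qrepK u) !qDE add0r.
- by move=> u; rewrite -(qrepK u) qNE !qDE addNr.
- by move=> a b u; rewrite -(qrepK u) !qZE scalerA.
- by move=> u; rewrite -(qrepK u) !qZE scale1r.
- by move=> a u v; rewrite -(qrepK u) -(qrepK v) qDE !qZE qDE scalerDr.
- by move=> u a b; rewrite -(qrepK u) !qZE qDE scalerDl.
Defined.

Fact qpi_linear : linear (qcls : M -> qmod).
Proof. by move=> a x y; rewrite -qDE -qZE. Qed.
Definition qpi : {linear M -> qmod} := mklin qpi_linear.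

Lemma qpi_surj (u : qmod) : exists x, qpi x = u.
Proof. by exists (qrep u); apply: qrepK. Qed.
Lemma qpi_eq x y : qpi x = qpi y <-> S (x - y).
Proof. exact: qclsP. Qed.
Lemma qpi0 x : qpi x = 0 <-> S x.
Proof. by rewrite -(linear0 qpi) qpi_eq subr0. Qed.

End Quotient.

#[global] Opaque smod qmod sinc qpi.

(** Preimages under [p] are chosen arbitrarily. Since [f] kills the kernel of [p], the choice does
    not affect the value, and linearity follows. *)
Lemma surj_desc (R : pzRingType) (M N X : lmodType R) (p : {linear M -> N})
    (f : {linear M -> X}) :
  (forall y, exists x, p x = y) -> (forall x, p x = 0 -> f x = 0) ->
  exists g : {linear N -> X}, forall x, g (p x) = f x.
Proof.
move=> sp f0; pose r y := sval (cid (sp y)).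
have rK y : p (r y) = y by rewrite /r; case: cid.
have fE x : f (r (p x)) = f x.
  by apply/eqP; rewrite -subr_eq0 -linearB; apply/eqP/f0; rewrite linearB rK subrr.
have lg : linear (fun u : N => f (r u)).
  move=> a u v; have [[x <-] [y <-]] := (sp u, sp v).
  by rewrite -linearP !fE linearP.
by exists (mklin lg).
Qed.

Lemma inj_lift (R : pzRingType) (M N X : lmodType R) (i : {linear M -> N})
    (f : {linear X -> N}) :
  (forall x, i x = 0 -> x = 0) -> (forall x, exists y, i y = f x) ->
  exists g : {linear X -> M}, forall x, i (g x) = f x.
Proof.
move=> ii fi; pose r x := sval (cid (fi x)).
have rK x : i (r x) = f x by rewrite /r; case: cid.
have lr : linear r.
  by move=> a u v; apply/eqP; rewrite -subr_eq0; apply/eqP/ii; rewrite linearB linearP !rK linearP subrr.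
by exists (mklin lr).
Qed.

(** Both sides reduce to the indices common to [s] and [t]. It shows that values defined through a
    chosen finite support are independent of that choice. *)
Lemma big_supp (A : Type) (idx : A) (op : Monoid.com_law idx) (J : eqType) (s t : seq J)
    (F : J -> A) :
  uniq s -> uniq t -> (forall j, j \notin s -> F j = idx) ->
  (forall j, j \notin t -> F j = idx) ->
  \big[op/idx]_(j <- s) F j = \big[op/idx]_(j <- t) F j.
Proof.
have restrict (r q : seq J) : (forall j, j \notin q -> F j = idx) ->
    \big[op/idx]_(j <- r) F j = \big[op/idx]_(j <- [seq j <- r | j \in q]) F j.
  move=> Fq; rewrite [LHS](bigID (mem q)) /= big_filter.
  by rewrite [X in op _ X]big1 ?Monoid.mulm1 // => j /Fq.
move=> us ut Fs Ft; rewrite (restrict s t) // (restrict t s) //.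
apply: perm_big; apply: uniq_perm; try exact: filter_uniq.
by move=> j; rewrite !mem_filter andbC.
Qed.

Section DirectSum.
Variables (R : pzRingType) (J : Type) (M : J -> lmodType R).
Local Notation K := {classic J}.

Definition fsupp (f : forall j, M j) := exists s : seq K, forall j : K, j \notin s -> f j = 0.
Local Notation T := {f : forall j, M j | fsupp f}.

Lemma dsum_ext (u v : T) : (forall j : J, sval u j = sval v j) -> u = v.
Proof. by case: u v => [x p] [y q] /= e; apply: eq_exist; apply: functional_extensionality_dep. Qed.

Fact fsupp0 : fsupp (fun j : J => 0 : M j).
Proof. by exists [::]. Qed.
Fact fsuppN (u : T) : fsupp (fun j : J => - sval u j).
Proof. by case: (svalP u) => s us; exists s => j /us ->; rewrite oppr0. Qed.
Fact fsuppZ a (u : T) : fsupp (fun j : J => a *: sval u j).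
Proof. by case: (svalP u) => s us; exists s => j /us ->; rewrite scaler0. Qed.
Fact fsuppD (u v : T) : fsupp (fun j : J => sval u j + sval v j).
Proof.
case: (svalP u) (svalP v) => s us [t vt]; exists (s ++ t) => j.
by rewrite mem_cat negb_or => /andP[/us -> /vt ->]; rewrite addr0.
Qed.

Definition dsum : lmodType R.
Proof.
apply: (@mkmod R T (exist _ _ fsupp0) (fun u => exist _ _ (fsuppN u))
  (fun u v => exist _ _ (fsuppD u v)) (fun a u => exist _ _ (fsuppZ a u))).
- by move=> u v w; apply: dsum_ext => j /=; rewrite addrA.
- by move=> u v; apply: dsum_ext => j /=; rewrite addrC.
- by move=> u; apply: dsum_ext => j /=; rewrite add0r.
- by move=> u; apply: dsum_ext => j /=; rewrite addNr.
- by move=> a b u; apply: dsum_ext => j /=; rewrite scalerA.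
- by move=> u; apply: dsum_ext => j /=; rewrite scale1r.
- by move=> a u v; apply: dsum_ext => j /=; rewrite scalerDr.
- by move=> u a b; apply: dsum_ext => j /=; rewrite scalerDl.
Defined.

Fact dpr_linear (j : J) : linear (fun u : dsum => sval (u : T) j).
Proof. by []. Qed.
Definition dpr (j : J) : {linear dsum -> M j} := mklin (dpr_linear j).

Definition din_fun (j : J) (x : M j) (i : J) : M i :=
  match pselect (j = i) with left e => eq_rect j M x i e | right _ => 0 end.

Lemma din_fun_id (j : J) (x : M j) : din_fun x j = x.
Proof. by rewrite /din_fun; case: pselect => // e; rewrite (Prop_irrelevance e erefl). Qed.
Lemma din_fun_ne (j : J) (x : M j) (i : J) : j <> i -> din_fun x i = 0.
Proof. by rewrite /din_fun; case: pselect. Qed.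

Fact din_fsupp (j : J) (x : M j) : fsupp (din_fun x).
Proof.
exists [:: (j : K)] => i; rewrite inE => /eqP ne.
by apply: din_fun_ne => e; apply: ne; rewrite e.
Qed.
Fact din_linear (j : J) : linear (fun x : M j => exist _ (din_fun x) (din_fsupp x) : dsum).
Proof.
move=> a x y; apply: dsum_ext => i /=.
have [<-|ne] := pselect (j = i); first by rewrite !din_fun_id.
by rewrite !din_fun_ne // scaler0 addr0.
Qed.
Definition din (j : J) : {linear M j -> dsum} := mklin (@din_linear j).

Lemma dpr_in j x : dpr j (din j x) = x.
Proof. exact: din_fun_id. Qed.
Lemma dpr_in_ne j i x : j <> i -> dpr i (din j x) = 0.
Proof. exact: din_fun_ne. Qed.

Lemma dsum_eq (u v : dsum) : (forall j, dpr j u = dpr j v) -> u = v.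
Proof. exact: dsum_ext. Qed.

Lemma dsum_fin (u : dsum) :
  exists2 s : seq K, uniq s & forall j : K, j \notin s -> dpr j u = 0.
Proof.
have [s us] := svalP u; exists (undup s); first exact: undup_uniq.
by move=> j; rewrite mem_undup; apply: us.
Qed.

Opaque din dpr.

Lemma dpr_sum (s : seq K) (F : forall j : J, M j) (i : K) : uniq s ->
  dpr i (\sum_(j <- s) din j (F j)) = if i \in s then F i else 0.
Proof.
move=> us; rewrite lin_sum; case: ifP => [si|/negbT si].
  rewrite (bigD1_seq i) //= dpr_in big1 ?addr0 // => j /eqP ne.
  exact: dpr_in_ne.
by rewrite big_seq big1 // => j sj; apply: dpr_in_ne => e; move: si; rewrite -e sj.
Qed.

Lemma dsum_dec (s : seq K) (u : dsum) : uniq s -> (forall j : K, j \notin s -> dpr j u = 0) ->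
  u = \sum_(j <- s) din j (dpr j u).
Proof.
move=> us uz; apply: dsum_eq => i; rewrite (@dpr_sum s (fun j => dpr j u)) //.
by case: ifP => // /negbT /uz.
Qed.

Lemma dsum_out (Z : lmodType R) (g : forall j, {linear M j -> Z}) :
  exists h : {linear dsum -> Z}, forall j x, h (din j x) = g j x.
Proof.
pose s u := s2val (cid2 (dsum_fin u)).
have us u : uniq (s u) by exact: (s2valP (cid2 (dsum_fin u))).
have zs u : forall j : K, j \notin s u -> dpr j u = 0 by exact: (s2valP' (cid2 (dsum_fin u))).
pose h u := \sum_(j <- s u) g j (dpr j u).
have hE t u : uniq t -> (forall j : K, j \notin t -> dpr j u = 0) ->
    h u = \sum_(j <- t) g j (dpr j u).
  move=> ut tz; apply: big_supp => // j; first by move/zs ->; rewrite linear0.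
  by move/tz ->; rewrite linear0.
have lh : linear h.
  move=> a u v; pose t := undup (s u ++ s v).
  have ut : uniq t by apply: undup_uniq.
  have zt (j : K) : j \notin t -> dpr j u = 0 /\ dpr j v = 0.
    by rewrite mem_undup mem_cat negb_or => /andP[/zs ? /zs ?].
  rewrite (hE t u) ?(hE t v) ?(hE t) //; try by move=> j /zt[].
    by rewrite scaler_sumr -big_split; apply: eq_bigr => j _ /=; rewrite !linearP.
  by move=> j /zt[ju jv]; rewrite linearP ju jv scaler0 addr0.
exists (mklin lh) => j x; rewrite [LHS](hE [:: (j : K)]) //.
  by rewrite big_seq1 dpr_in.
move=> i; rewrite inE => /eqP ne; apply: dpr_in_ne => e; apply: ne; by rewrite e.
Qed.

Lemma dsum_ind (P : dsum -> Prop) : subm P -> (forall j x, P (din j x)) -> forall u, P u.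
Proof.
move=> HP Pin u; have [s us zs] := dsum_fin u.
by rewrite (dsum_dec us zs); apply: subm_sum.
Qed.

Lemma dsum_map_eq (Z : lmodType R) (f g : {linear dsum -> Z}) :
  (forall j x, f (din j x) = g (din j x)) -> forall u, f u = g u.
Proof.
move=> e; apply: dsum_ind => //; split; first by rewrite !linear0.
by move=> a x y; rewrite !linearP => -> ->.
Qed.
End DirectSum.
Arguments din [R J M].
Arguments dpr [R J M].
#[global] Opaque dsum din dpr.

Section DirectSumMap.
Variables (R : pzRingType) (J : Type) (M N : J -> lmodType R).
Variable f : forall j, {linear M j -> N j}.

Definition dsum_map : {linear dsum M -> dsum N} :=
  sval (cid (dsum_out (fun j => din j \o f j))).

Lemma dsum_map_in j x : dsum_map (din j x) = din j (f j x).
Proof. by rewrite /dsum_map; case: cid => h /= ->. Qed.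

Lemma dpr_map j u : dpr j (dsum_map u) = f j (dpr j u).
Proof.
apply: (dsum_map_eq (f := dpr j \o dsum_map) (g := f j \o dpr j)) => i x /=.
rewrite dsum_map_in; have [e|ne] := pselect (i = j); last by rewrite !dpr_in_ne ?linear0.
by case: j / e; rewrite !dpr_in.
Qed.
End DirectSumMap.
#[global] Opaque dsum_map.

Section Free.
Variables (R : pzRingType) (C : Type).

Definition free : lmodType R := dsum (fun _ : C => (R^o : lmodType R)).
Definition fgen (c : C) : free := din (M := fun _ : C => (R^o : lmodType R)) c (1 : R).

Lemma free_out (Z : lmodType R) (g : C -> Z) :
  exists h : {linear free -> Z}, forall c, h (fgen c) = g c.
Proof.
have lg c : linear ((fun a : R => a *: g c) : R^o -> Z).
  by move=> a x y; rewrite scalerDl -scalerA.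
have [h hE] := dsum_out (fun c => mklin (lg c)).
by exists h => c; rewrite hE /= scale1r.
Qed.

Lemma free_dec (u : free) : exists p : seq (R * C), u = \sum_(e <- p) e.1 *: fgen e.2.
Proof.
apply: (dsum_ind (P := fun u => exists p : seq (R * C), u = \sum_(e <- p) e.1 *: fgen e.2)).
  split; first by exists [::]; rewrite big_nil.
  move=> a x y [p ->] [q ->]; exists ([seq (a * e.1, e.2) | e <- p] ++ q).
  rewrite big_cat big_map scaler_sumr; congr (_ + _); apply: eq_bigr => e _ /=.
  by rewrite scalerA.
move=> c x; exists [:: (x : R, c)]; rewrite big_seq1 -linearZ /=.
by congr (din c _); rewrite /GRing.scale /= mulr1.
Qed.

Lemma free_ind (P : free -> Prop) : subm P -> (forall c, P (fgen c)) -> forall u, P u.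
Proof.
move=> HP Pg u; have [p ->] := free_dec u.
by apply: subm_sum => // e; apply: submZ.
Qed.

Lemma free_map_eq (Z : lmodType R) (f g : {linear free -> Z}) :
  (forall c, f (fgen c) = g (fgen c)) -> forall u, f u = g u.
Proof.
move=> e; apply: free_ind => //; split; first by rewrite !linear0.
by move=> a x y; rewrite !linearP => -> ->.
Qed.
End Free.

Section RowVectors.
Variables (R : pzRingType) (n : nat).

Lemma rv_out (Z : lmodType R) (g : 'I_n -> Z) :
  exists h : {linear 'rV[R]_n -> Z}, forall i, h (delta_mx 0 i) = g i.
Proof.
have lh : linear (fun v : 'rV[R]_n => \sum_i v 0 i *: g i).
  move=> a u v; rewrite scaler_sumr -big_split; apply: eq_bigr => i _ /=.
  by rewrite !mxE scalerDl scalerA.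
exists (mklin lh) => i /=; rewrite (bigD1 i) //= big1 ?addr0.
  by rewrite mxE !eqxx scale1r.
by move=> j ne; rewrite mxE (negbTE ne) andbF scale0r.
Qed.

Lemma rv_dec (v : 'rV[R]_n) : v = \sum_i v 0 i *: delta_mx 0 i.
Proof. exact: row_sum_delta. Qed.

Lemma rv_map_eq (Z : lmodType R) (f g : {linear 'rV[R]_n -> Z}) :
  (forall i, f (delta_mx 0 i) = g (delta_mx 0 i)) -> forall u, f u = g u.
Proof.
move=> e u; rewrite (rv_dec u) !lin_sum; apply: eq_bigr => i _.
by rewrite !linearZ /= e.
Qed.
End RowVectors.

(* The identity if i = j, and 0 if not. *)
Section Transport.
Variables (R : pzRingType) (I : eqType) (V : I -> lmodType R).

Definition tr i j : {linear V i -> V j} :=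
  match i =P j with
  | ReflectT e => eq_rect i (fun k => {linear V i -> V k}) idfun j e
  | ReflectF _ => \0
  end.

Lemma trE i x : tr i i x = x.
Proof. by rewrite /tr; case: eqP => // e; rewrite (eq_axiomK e). Qed.
Lemma tr_ne i j x : i != j -> tr i j x = 0.
Proof. by rewrite /tr; case: eqP. Qed.
Lemma trK i j x : i = j -> tr j i (tr i j x) = x.
Proof. by move=> <-; rewrite !trE. Qed.
End Transport.
Arguments tr [R I] V i j.
#[global] Opaque tr.

(** * Homotopies and cofibrant complexes *)

Section Homotopy.
Variable R : pzRingType.
Implicit Types X Y Z P : cpx R.

Lemma bnd_succ X n (x : X (n + 1)) :
  boundary x -> exists y : X n, cd X n (n + 1) y = x.
Proof. by move=> /boundaryE; rewrite addrK. Qed.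

Lemma cycle_succ X n (x : X n) : cd X n (n + 1) x = 0 -> cycle x.
Proof.
move=> h j; have [<-//|ne] := eqVneq (n + 1) j; exact: cd_shape.
Qed.

(* Indexing by n + 1 avoids transporting along n = n - 1 + 1. *)
Definition htpy X Y (f g : cmap X Y) :=
  exists h : forall n, {linear X (n + 1) -> Y n}, forall n (x : X (n + 1)),
    f (n + 1) x - g (n + 1) x =
    cd Y n (n + 1) (h n x) + h (n + 1) (cd X (n + 1) (n + 1 + 1) x).

Lemma forall_succ (Q : int -> Prop) : (forall n, Q (n + 1)) -> forall n, Q n.
Proof. by move=> h n; rewrite -(subrK 1 n); apply: h. Qed.

Lemma htpy_ext X Y (f g : cmap X Y) : (forall n x, f n x = g n x) -> htpy f g.
Proof.
move=> e; exists (fun n => \0) => n x; rewrite e subrr /= linear0 addr0 //.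
Qed.

Lemma htpy_refl X Y (f : cmap X Y) : htpy f f.
Proof. exact: htpy_ext. Qed.

Lemma htpy_sym X Y (f g : cmap X Y) : htpy f g -> htpy g f.
Proof.
case=> h hE; exists (fun n => (\- (h n))%R) => n x /=.
by rewrite linearN -opprD -hE opprB.
Qed.

Lemma htpy_trans X Y (f g k : cmap X Y) : htpy f g -> htpy g k -> htpy f k.
Proof.
case=> h hE [h' hE']; exists (fun n => (h n \+ h' n)%R) => n x /=.
by rewrite linearD addrACA -hE -hE' addrA subrK.
Qed.

Lemma htpy_compl X Y Z (f g : cmap X Y) (k : cmap Y Z) :
  htpy f g -> htpy (cmap_comp f k) (cmap_comp g k).
Proof.
case=> h hE; exists (fun n => (k n \o h n)) => n x /=.
by rewrite -linearB hE linearD cm_d.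
Qed.

Lemma cd_trC X i j k (c : X (i + 1)) :
  cd X j k (tr X (i + 1) j c) = tr X (j + 1) k (cd X (i + 1) (j + 1) c).
Proof.
have [<-|ne] := eqVneq (i + 1) j.
  rewrite trE; have [<-|ne] := eqVneq (i + 1 + 1) k; first by rewrite trE.
  by rewrite cd_shape // tr_ne.
by rewrite tr_ne // linear0 cd_shape ?linear0 // -subr_eq0 opprD addrACA subrr addr0 subr_eq0.
Qed.

Section Cylinder.
Variable X : cpx R.

(** The differential of the mapping cylinder of the identity, (x, y, z) |-> (dx - z, dy + z, -dz):
    chain maps out of the cylinder are pairs of chain maps with a homotopy between them. Here [tr]
    places z in degree [j] if j = i + 1, and vanishes otherwise as a differential must. *)
Fact cyl_linear i j : linear (fun p : X i * X i * X (i + 1) =>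
  (cd X i j p.1.1 - tr X (i + 1) j p.2, cd X i j p.1.2 + tr X (i + 1) j p.2,
   - cd X (i + 1) (j + 1) p.2)).
Proof.
move=> a [[x y] z] [[x' y'] z'] /=; rewrite !linearP /=; congr (_, _, _).
- by rewrite addrACA -scalerDr.
- by rewrite addrACA -scalerDr.
Qed.

Definition cyl_ob n : rmod R := (X n * X n * X (n + 1)%R)%type.
Definition cyl_d i j : {linear cyl_ob i -> cyl_ob j} := mklin (@cyl_linear i j).

Definition cyl : cpx R.
Proof.
apply: (@Cpx R cyl_ob cyl_d).
- move=> i j [[x y] z] ne /=; rewrite !cd_shape ?tr_ne ?subr0 ?addr0 ?oppr0 //.
  by rewrite (inj_eq (addIr 1)).
- move=> i j k [[x y] z] /=.
  rewrite !(linearB (cd X _ _), linearD (cd X _ _), linearN (cd X _ _), linearN (tr _ _ _)).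
  rewrite !cdd cd_trC oppr0 opprK !add0r.
  by rewrite addNr addrN oppr0.
Defined.

Definition cyl_in1 : cmap X cyl.
Proof.
apply: (@cmap_of R X cyl (fun n x => (x, 0, 0))).
- by move=> n a x y; congr (_, _, _); rewrite /= scaler0 addr0.
- by move=> i j x /=; rewrite !linear0 !addr0 ?add0r.
Defined.
Definition cyl_in2 : cmap X cyl.
Proof.
apply: (@cmap_of R X cyl (fun n x => (0, x, 0))).
- by move=> n a x y; congr (_, _, _); rewrite /= scaler0 addr0.
- by move=> i j x /=; rewrite !linear0 !addr0 ?add0r.
Defined.
Definition cyl_pr : cmap cyl X.
Proof.
apply: (@cmap_of R cyl X (fun n p => p.1.1 + p.1.2)).
- by move=> n a [[x y] z] [[x' y'] z'] /=; rewrite scalerDr addrACA.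
- by move=> i j [[x y] z] /=; rewrite linearD addrACA addNr addr0.
Defined.

Lemma cyl_qis : qis cyl_pr.
Proof.
split=> [|n y cy]; last first.
  exists (y, 0, 0); split.
    by move=> j /=; rewrite !linear0 cy !addr0.
  by exists n, 0; rewrite /= linear0 addr0 subrr.
apply: (@forall_succ (fun n => forall x : cyl n, cycle x -> boundary (cyl_pr n x) -> boundary x)) => n.
move=> [[a b] c] cx /bnd_succ /= [w wE].
have := cx (n + 1 + 1); rewrite /= !trE => -[ea eb ec].
(* With dw = a + b, the differential of (0, w, -a) is (a, dw - a, da) = (a, b, da), and da = c
   because (a, b, c) is a cycle. *)
exists n, (0, w, - a); rewrite /= !trE (linear0 (cd X _ _)) wE (linearN (cd X _ _)) !opprK add0r.
rewrite (addrAC a) subrr add0r; congr (_, _, _).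
by apply/eqP; rewrite -subr_eq0 ea.
Qed.
End Cylinder.

(** The two inclusions of [X] in its cylinder are sections of the same quasi-isomorphism [cyl_pr],
    so they agree in the localization, and a homotopy extends [f] and [g] to the cylinder. *)
Lemma dmap_htpy X Y (f g : cmap X Y) : htpy f g -> dmap f = dmap g.
Proof.
case=> h hE.
have [k [k1 k2]] : exists k : cmap (cyl X) Y,
    (forall n x, cmap_comp (cyl_in1 X) k n x = f n x) /\
    (forall n x, cmap_comp (cyl_in2 X) k n x = g n x).
  (* With this sign of [h], compatibility with the differentials is exactly the homotopy
     identity. *)
  have kl n : linear (fun p : cyl X n => f n p.1.1 + g n p.1.2 - h n p.2).
    move=> a [[x y] z] [[x' y'] z'] /=; rewrite !linearP /=.
    by rewrite !scalerDr [RHS]addrACA; congr (_ + _); rewrite [RHS]addrACA.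
  have kd i j (x : cyl X i) : f j (cd (cyl X) i j x).1.1 + g j (cd (cyl X) i j x).1.2
      - h j (cd (cyl X) i j x).2 = cd Y i j (f i x.1.1 + g i x.1.2 - h i x.2).
    have [<-|ne] := eqVneq (i + 1) j; last by rewrite !cd_shape //= !linear0 !addr0.
    case: x => [[a b] c] /=; rewrite !trE.
    rewrite !(linearB (f _), linearD (g _), linearN (h _), linearB (cd Y _ _), linearD (cd Y _ _)).
    have -> : f (i + 1) c = cd Y i (i + 1) (h i c)
        + h (i + 1) (cd X (i + 1) (i + 1 + 1) c) + g (i + 1) c by rewrite -hE subrK.
    rewrite !cm_d (addrACA (cd Y _ _ _)) opprK -[LHS]addrA; congr (_ + _).
    by rewrite opprD subrK opprD subrK.
  exists (cmap_of kl kd); by split=> n x /=; rewrite !linear0 ?addr0 ?add0r.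
have i12 : dmap (cyl_in1 X) = dmap (cyl_in2 X).
  have pr1 : dcomp (dmap (cyl_in1 X)) (dmap (cyl_pr X)) = dmap (cmap_id X).
    by rewrite dmapM; apply: dmap_ext => n x /=; rewrite addr0.
  have pr2 : dcomp (dmap (cyl_in2 X)) (dmap (cyl_pr X)) = dmap (cmap_id X).
    by rewrite dmapM; apply: dmap_ext => n x /=; rewrite add0r.
  rewrite -[LHS]dcomp1r -[RHS]dcomp1r -(dinvr (cyl_qis X)) !dcompA.
  by rewrite pr1 pr2.
by rewrite -(dmap_ext k1) -(dmap_ext k2) -!dmapM i12.
Qed.
End Homotopy.

Section Cofibrant.
Variable R : pzRingType.
Implicit Types P : cpx R.

(* rho relates p in P^n, a value at p and a value at dp.  Lifting and homotopy
   problems for maps out of P amount to choosing values v_n(p) linearly such that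
   rho holds; ext_rel says that this can be done for a single p once dp is settled. *)
Definition lin_rel P (V : int -> rmod R) (rho : forall n, P n -> V n -> V (n + 1) -> Prop) :=
  (forall n, rho n 0 0 0) /\
  (forall n a p v w p' v' w', rho n p v w -> rho n p' v' w' ->
     rho n (a *: p + p') (a *: v + v') (a *: w + w')).

Definition ext_rel P (V : int -> rmod R) (rho : forall n, P n -> V n -> V (n + 1) -> Prop) :=
  forall n p w, rho (n + 1) (cd P n (n + 1) p) w 0 -> exists v, rho n p v w.

(** Specializing [rho] gives projectivity of the terms, lifting along quasi-isomorphisms and
    uniqueness of lifts up to homotopy, so each source of cofibrant complexes requires only one
    induction. *)
Definition cofib P := forall V rho, @lin_rel P V rho -> @ext_rel P V rho ->
  exists v : forall n, {linear P n -> V n},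
    forall n p, rho n p (v n p) (v (n + 1) (cd P n (n + 1) p)).
End Cofibrant.

(** * Cofibrant resolutions by free modules on cells *)

Section CellResolution.
Variables (R : pzRingType) (X : cpx R).

(* Cell x p is a generator e with f e = x and de = p; it is made a cycle with
   f e = 0 if these data do not satisfy dp = 0 and f p = dx. *)
Inductive cell (n : int) : Type := Cell (x : X n) (p : seq (R^c * cell (n + 1))).

Definition celln n : rmod R := free (R^c) (cell n).
Definition csum (n : int) (p : seq (R^c * cell n)) : celln n := \sum_(e <- p) e.1 *: fgen R^c e.2.

(** A [foldr] and not a big operator, so that recursive calls on the cells inside [p] are recognized
    as structural. *)
Definition lcomb (V : rmod R) (C : Type) (f : C -> V) (p : seq (R^c * C)) : V :=
  foldr (fun e s => e.1 *: f e.2 + s) 0 p.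

Lemma lcombE (V : rmod R) (C : Type) (f : C -> V) (p : seq (R^c * C)) :
  lcomb f p = \sum_(e <- p) e.1 *: f e.2.
Proof. by elim: p => [|e p IH] /=; rewrite ?big_nil ?big_cons ?IH. Qed.

Fixpoint cval n (c : cell n) : celln (n + 1) * X n :=
  match c with
  | Cell x p =>
    if pselect (lcomb (fun e => (cval e).1) p = 0 /\
                lcomb (fun e => (cval e).2) p = cd X n (n + 1) x)
    then (csum p, x) else (0, 0)
  end.

(** As [cell] is nested in [seq], an inner fixpoint has to provide the hypotheses for the cells
    inside [p]. *)
Fixpoint cell_all (Q : forall n, cell n -> Prop)
   (H : forall n x p, foldr (fun e s => Q (n + 1) e.2 /\ s) True p -> Q n (Cell x p))
   n (c : cell n) : Q n c :=
  match c with
  | Cell x p => H n x p ((fix F q : foldr (fun e s => Q (n + 1) e.2 /\ s) True q :=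
      match q with
      | [::] => I
      | e :: q' => conj (cell_all H e.2) (F q')
      end) p)
  end.

Definition cell_d0 n : {linear celln n -> celln (n + 1)} :=
  sval (cid (free_out (fun c : cell n => (cval c).1))).
Definition cell_f0 n : {linear celln n -> X n} :=
  sval (cid (free_out (fun c : cell n => (cval c).2))).

Lemma cell_d0E n (c : cell n) : cell_d0 n (fgen R^c c) = (cval c).1.
Proof. by rewrite /cell_d0; case: cid. Qed.
Lemma cell_f0E n (c : cell n) : cell_f0 n (fgen R^c c) = (cval c).2.
Proof. by rewrite /cell_f0; case: cid. Qed.

Lemma cell_d0_sum n (p : seq (R^c * cell n)) :
  cell_d0 n (csum p) = lcomb (fun e => (cval e).1) p.
Proof.
by rewrite lcombE lin_sum; apply: eq_bigr => e _; rewrite linearZ /= cell_d0E.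
Qed.
Lemma cell_f0_sum n (p : seq (R^c * cell n)) :
  cell_f0 n (csum p) = lcomb (fun e => (cval e).2) p.
Proof.
by rewrite lcombE lin_sum; apply: eq_bigr => e _; rewrite linearZ /= cell_f0E.
Qed.

Lemma cvalP n (x : X n) (p : seq (R^c * cell (n + 1))) :
  (cell_d0 _ (csum p) = 0 /\ cell_f0 _ (csum p) = cd X n (n + 1) x /\
   cval (Cell x p) = (csum p, x)) \/ cval (Cell x p) = (0, 0).
Proof.
rewrite cell_d0_sum cell_f0_sum /=; case: pselect => [[h1 h2]|h]; [by left|by right].
Qed.

Lemma cval_valid n (x : X n) (p : seq (R^c * cell (n + 1))) :
  cell_d0 _ (csum p) = 0 -> cell_f0 _ (csum p) = cd X n (n + 1) x ->
  cval (Cell x p) = (csum p, x).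
Proof.
by rewrite cell_d0_sum cell_f0_sum /= => h1 h2; case: pselect => // -[].
Qed.

Arguments cval : simpl never.

Lemma cell_d0d0 n u : cell_d0 (n + 1) (cell_d0 n u) = 0.
Proof.
apply: (free_map_eq (f := cell_d0 (n + 1) \o cell_d0 n) (g := \0)) => -[x p] /=.
by rewrite cell_d0E; case: (cvalP x p) => [[h1 [h2 h3]]|h3]; rewrite h3 ?linear0.
Qed.

Lemma cell_f0d0 n u : cell_f0 (n + 1) (cell_d0 n u) = cd X n (n + 1) (cell_f0 n u).
Proof.
apply: (free_map_eq (f := cell_f0 (n + 1) \o cell_d0 n)
  (g := cd X n (n + 1) \o cell_f0 n)) => -[x p] /=.
rewrite cell_d0E cell_f0E; case: (cvalP x p) => [[h1 [h2 h3]]|h3]; rewrite h3 ?linear0 //=.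
Qed.

Definition cell_d i j : {linear celln i -> celln j} := tr celln (i + 1) j \o cell_d0 i.

Lemma cell_dE n u : cell_d n (n + 1) u = cell_d0 n u.
Proof. by rewrite /= trE. Qed.

Definition cell_cpx : cpx R.
Proof.
apply: (@Cpx R celln cell_d).
- by move=> i j u ne; rewrite /= tr_ne.
- move=> i j k u /=; have [<-|ne] := eqVneq (i + 1) j; last by rewrite (tr_ne _ ne) !linear0.
  by rewrite trE cell_d0d0 linear0.
Defined.

Definition cell_res : cmap cell_cpx X.
Proof.
exists cell_f0 => i j x /=; have [<-|ne] := eqVneq (i + 1) j.
  by rewrite trE cell_f0d0.
by rewrite tr_ne // linear0 cd_shape.
Defined.

Lemma cell_qis : qis cell_res.
Proof.
split=> [|n y cy].
  apply: forall_succ => n z cz /bnd_succ[y yE].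
  have [p pE] := free_dec z; move: cz yE; rewrite {}pE -/(csum p) => cz yE.
  exists n, (fgen R^c (Cell y p)); rewrite cell_dE cell_d0E cval_valid //.
  by have := cz (n + 1 + 1); rewrite cell_dE.
have fy : (cval (Cell y [::])) = (csum [::], y).
  by apply: cval_valid; rewrite /csum big_nil linear0 ?cy.
exists (fgen R^c (Cell y [::])); split.
  by apply: cycle_succ; rewrite cell_dE cell_d0E fy /= /csum big_nil.
by exists n, 0; rewrite linear0 /= cell_f0E fy subrr.
Qed.

Lemma cell_cofib : cofib cell_cpx.
Proof.
move=> V rho [rho0 rhoD] ext.
pose vv := fix vv n (c : cell n) : V n :=
  match c with
  | Cell x p =>
    (* [w] is the value already forced at the differential of the generator: that differential is 0
       if [cval] vanishes, and [csum p] otherwise. *)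
    let w := if pselect (cval (Cell x p) = (0, 0)) then 0 else lcomb (vv (n + 1)) p in
    match pselect (exists v, rho n (fgen R^c (Cell x p)) v w) with
    | left e => sval (cid e)
    | right _ => 0
    end
  end.
pose v n := sval (cid (free_out (vv n))).
have vE n (c : cell n) : v n (fgen R^c c) = vv n c by rewrite /v; case: cid.
have vS n (p : seq (R^c * cell n)) : v n (csum p) = lcomb (vv n) p.
  by rewrite lcombE lin_sum; apply: eq_bigr => e _; rewrite linearZ /= vE.
exists v => n; apply: free_ind.
  split; first by rewrite !linear0; apply: rho0.
  by move=> a x y hx hy; rewrite !linearP; apply: rhoD.
move=> c; elim/cell_all: c => {}n x p IH.
rewrite [cd _ _ _ _]cell_dE cell_d0E vE.
(* The induction hypotheses add up to [rho] at [csum q]. For a valid cell the differential of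
   [csum p] is 0, which is the premise of [ext]. *)
have sumP q : foldr (fun e s => rho (n + 1) (fgen R^c e.2) (v (n + 1) (fgen R^c e.2))
      (v (n + 1 + 1) (cd cell_cpx (n + 1) (n + 1 + 1) (fgen R^c e.2))) /\ s) True q ->
    rho (n + 1) (csum q) (lcomb (vv (n + 1)) q) (v (n + 1 + 1) (cell_d0 (n + 1) (csum q))).
  elim: q => [_|e q IHq [he /IHq hq]]; first by rewrite /csum big_nil /= !linear0; apply: rho0.
  rewrite /csum big_cons -/(csum q) /= !linearP; apply: rhoD => //.
  by move: he; rewrite [cd _ _ _ _]cell_dE vE.
have -> : v (n + 1) (cval (Cell x p)).1 =
    if pselect (cval (Cell x p) = (0, 0)) then 0 else lcomb (vv (n + 1)) p.
  case: pselect => [e|ne] /=; first by rewrite e linear0.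
  by case: (cvalP x p) => [[_ [_ h]]|//]; rewrite h vS.
rewrite [vv n _]/=; case: pselect => [e|[]]; first by case: cid.
apply: ext; rewrite [cd _ _ _ _]cell_dE cell_d0E.
case: pselect => [e|ne] /=; first by rewrite e; apply: rho0.
case: (cvalP x p) => [[h1 [h2 h3]]|//]; rewrite h3; have := sumP p IH.
by rewrite h1 linear0.
Qed.
End CellResolution.

Section PairMaps.
Variables (R : pzRingType) (U V W : lmodType R) (f : {linear U -> (V * W)%type}).
Fact lfst_linear : linear (fun x => (f x).1). Proof. by move=> a x y; rewrite linearP. Qed.
Fact lsnd_linear : linear (fun x => (f x).2). Proof. by move=> a x y; rewrite linearP. Qed.
Definition lfst : {linear U -> V} := mklin lfst_linear.
Definition lsnd : {linear U -> W} := mklin lsnd_linear.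
End PairMaps.

Section CofibrantTheory.
Variable R : pzRingType.
Implicit Types P X Y Z : cpx R.

Lemma cd_tr X i j k (x : X i) : i = j -> cd X j k (tr X i j x) = cd X i k x.
Proof. by move=> <-; rewrite trE. Qed.
Lemma tr_cd X i j k (x : X i) : j = k -> tr X j k (cd X i j x) = cd X i k x.
Proof. by move=> <-; rewrite trE. Qed.
Lemma cycle_pred X n (x : X (n - 1)) : cd X (n - 1) n x = 0 -> cycle x.
Proof. by move=> h; apply: cycle_succ; rewrite subrK. Qed.
Lemma cm_tr X Y (f : cmap X Y) i j (x : X i) : f j (tr X i j x) = tr Y i j (f i x).
Proof.
have [<-|ne] := eqVneq i j; first by rewrite !trE.
by rewrite !tr_ne // linear0.
Qed.

(** The relation ignores the value at dp, and outside degree [n] it only asks for a value in the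
    kernel of [g], since [tr] vanishes there. *)
Lemma cofib_proj P n : cofib P -> mprojective (P n).
Proof.
move=> cP X Y g sg h.
pose rho m (p : P m) (x : X) (_ : X) := g x = h (tr P m n p).
have [||v vE] := cP (fun _ => X) rho.
- split=> [m|m a p x w p' x' w' e e']; first by rewrite /rho !linear0.
  by rewrite /rho !linearP e e'.
- by move=> m p w _; apply: sg.
by exists (v n) => a; rewrite vE trE.
Qed.

(** The lift and the homotopy are found together: a value at p is a pair (y, x), with y the value of
    the lift and x that of the homotopy, one degree lower. *)
Lemma cofib_lift P Y X (s : cmap Y X) (phi : cmap P X) : cofib P -> qis s ->
  exists psi : cmap P Y, htpy (cmap_comp psi s) phi.
Proof.
move=> cP [si ss].
pose rho n (p : P n) (v : Y n * X (n - 1)) (w : Y (n + 1) * X (n + 1 - 1)) :=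
  cd Y n (n + 1) v.1 = w.1 /\
  s n v.1 - phi n p = cd X (n - 1) n v.2 + tr X (n + 1 - 1) n w.2.
have [||v vE] := cP (fun n => (Y n * X (n - 1)%R)%type : rmod R) rho.
- split=> [n|n a p [v1 v2] [w1 w2] p' [v1' v2'] [w1' w2'] [/= e1 e2] [/= e1' e2']].
    by rewrite /rho /= !linear0; split=> //; zmod.
  rewrite /rho /= !linearP /= e1 e1'; split=> //.
  apply: (etrans (y := a *: (s n v1 - phi n p) + (s n v1' - phi n p'))); first by zmodl.
  by rewrite e2 e2'; zmodl.
- move=> n p [y' x'] [/= cy' e]; rewrite linear0 addr0 in e.
  have eq : n + 1 - 1 = n by rewrite addrK.
  have dx' : cd X (n + 1 - 1) (n + 1) x' = cd X n (n + 1) (tr X (n + 1 - 1) n x').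
    by rewrite cd_tr.
  have by' : boundary y'.
    apply: si; first exact: cycle_succ.
    exists n, (phi n p + tr X (n + 1 - 1) n x').
    by rewrite linearD -dx' -e -cm_d; zmod.
  have [y1 y1E] := bnd_succ by'.
  (* [y1] has the right differential, but its image misses the target by the cycle [c]. Surjectivity
     on cohomology gives a cycle [y2] with s y2 - c = db, which is subtracted from [y1]. *)
  pose c := s n y1 - phi n p - tr X (n + 1 - 1) n x'.
  have cc : cycle c.
    by apply: cycle_succ; rewrite !linearB -!cm_d y1E e dx' subrr.
  have [y2 [cy2 /boundaryE[b bE]]] := ss _ _ cc.
  exists (y1 - y2, - b); split => /=; first by rewrite linearB y1E cy2 subr0.
  rewrite linearB linearN bE /c. zmod.
have cm i j x : (v j (cd P i j x)).1 = cd Y i j (v i x).1.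
  have [<-|ne] := eqVneq (i + 1) j; first by have [-> _] := vE i x.
  by rewrite !cd_shape // linear0.
exists (cmap_of (fun n => lfst_linear (v n)) cm).
exists (fun n => tr X (n + 1 - 1) n \o lsnd (v (n + 1))) => n x /=.
by have [_ ->] := vE (n + 1) x; rewrite cd_tr // addrK.
Qed.
(** The null homotopy [k] of s(phi - psi) is lifted along [s]: a value is a pair made of a
    contraction of phi - psi in [Y] and a second-order homotopy in [X] between [k] and the image of
    that contraction. Without the second component the induction would lose control of the
    choice. *)
Lemma cofib_uniq P Y X (s : cmap Y X) (phi psi : cmap P Y) : cofib P -> qis s ->
  htpy (cmap_comp phi s) (cmap_comp psi s) -> htpy phi psi.
Proof.
move=> cP [si ss] [h hE].
have [f fE] : exists f : forall n, {linear P n -> Y n}, forall n p, f n p = phi n p - psi n p.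
  by exists (fun n => (phi n \- psi n)%R).
have fd i j x : f j (cd P i j x) = cd Y i j (f i x) by rewrite !fE !cm_d linearB.
have [k kE] : exists k : forall n, {linear P n -> X (n - 1)},
    forall n p, k n p = h (n - 1) (tr P n (n - 1 + 1) p).
  by exists (fun n => h (n - 1) \o tr P n (n - 1 + 1)).
have sf n p : s n (f n p) = cd X (n - 1) n (k n p) + tr X (n + 1 - 1) n (k (n + 1) (cd P n (n + 1) p)).
  move: n p; apply: forall_succ => n p; rewrite fE linearB hE !kE; congr (_ + _).
    by have : n + 1 - 1 = n; [rewrite addrK | move: (n + 1 - 1) => m ->; rewrite trE].
  by have : n + 1 + 1 - 1 = n + 1; [rewrite addrK | move: (n + 1 + 1 - 1) => m ->; rewrite !trE].
pose rho n (p : P n) (v : Y (n - 1) * X (n - 1 - 1)) (w : Y (n + 1 - 1) * X (n + 1 - 1 - 1)) :=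
  f n p = cd Y (n - 1) n v.1 + tr Y (n + 1 - 1) n w.1 /\
  k n p - s _ v.1 = cd X (n - 1 - 1) (n - 1) v.2 - tr X (n + 1 - 1 - 1) (n - 1) w.2.
have [||v vE] := cP (fun n => (Y (n - 1)%R * X (n - 1 - 1)%R)%type : rmod R) rho.
- split=> [n|n a p [v1 v2] [w1 w2] p' [v1' v2'] [w1' w2'] [/= e1 e2] [/= e1' e2']].
    by rewrite /rho /= !linear0; split=> //; zmod.
  rewrite /rho /= !linearP e1 e1' /=; split; first by zmodl.
  apply: (etrans (y := a *: (k n p - s _ v1) + (k n p' - s _ v1'))); first by zmodl.
  by rewrite e2 e2'; zmodl.
- move=> n p [y' x'] [/= e1 e2]; rewrite !linear0 in e1 e2.
  have eq : n + 1 - 1 = n by rewrite addrK.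
  pose y0 := tr Y (n + 1 - 1) n y'; pose x0 := tr X (n + 1 - 1 - 1) (n - 1) x'.
  have dy0 : cd Y n (n + 1) y0 = f (n + 1) (cd P n (n + 1) p) by rewrite e1 addr0 cd_tr.
  have c1 : cycle (f n p - y0) by apply: cycle_succ; rewrite linearB dy0 fd subrr.
  have sy0 : s n y0 = tr X (n + 1 - 1) n (k (n + 1) (cd P n (n + 1) p)) - cd X (n - 1) n x0.
    have -> : k (n + 1) (cd P n (n + 1) p) = cd X (n + 1 - 1 - 1) (n + 1 - 1) x' + s _ y'.
      by rewrite -[LHS](subrK (s _ y')) e2; zmod.
    by rewrite linearD tr_cd // /x0 cd_tr ?eq // cm_tr; zmod.
  have /boundaryE[y1 y1E] : boundary (f n p - y0).
    apply: si => //; exists (n - 1), (k n p + x0).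
    by rewrite linearB sf sy0 linearD; zmod.
  have c2 : cycle (k n p + x0 - s _ y1).
    apply: cycle_pred; rewrite linearB -cm_d y1E linearB sf sy0 linearD; zmod.
  have [y2 [cy2 /boundaryE[b bE]]] := ss _ _ c2.
  exists (y1 + y2, - b); split => /=.
    by rewrite linearD y1E cy2 -/y0; zmod.
  by rewrite linearD linearN bE -/x0; zmod.
exists (fun n => tr Y (n + 1 - 1) n \o lfst (v (n + 1))) => n x /=.
by have [e _] := vE (n + 1) x; rewrite -fE e cd_tr // addrK.
Qed.
End CofibrantTheory.

Notation "f ;; g" := (dcomp f g) (at level 40, left associativity).

(** * Morphisms and coproducts in the derived category *)

Section MapsFromCofibrant.
Variable R : pzRingType.
Implicit Types X Y Z : cpx R.

Lemma dcomp_qisI X Y Z (s : cmap X Y) (u v : dhom Y Z) : qis s ->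
  dmap s ;; u = dmap s ;; v -> u = v.
Proof.
by move=> q e; rewrite -[u]dcomp1l -[v]dcomp1l -(dinvl q) -!dcompA e.
Qed.

Variables (P : cpx R) (cP : cofib P).

Lemma dcomp_cofib X Y (u : dhom X Y) (phi : cmap P X) :
  exists psi : cmap P Y, dmap phi ;; u = dmap psi.
Proof.
elim/dhom_ind: u phi => {X Y} [X Y f|X Y s q|X Y Z f g IHf IHg] phi.
- by exists (cmap_comp phi f); rewrite dmapM.
- have [psi h] := cofib_lift phi cP q; exists psi.
  by rewrite -(dmap_htpy h) -dmapM -dcompA dinvr dcomp1r.
- have [psi h] := IHf phi; have [chi h'] := IHg psi.
  by exists chi; rewrite dcompA h h'.
Qed.

Lemma dhom_map Y (u : dhom P Y) : exists psi : cmap P Y, u = dmap psi.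
Proof. by have [psi e] := dcomp_cofib u (cmap_id P); exists psi; rewrite -e dcomp1l. Qed.

(** Words act on chain maps out of [P], a formal inverse acting by a chosen lift. Up to homotopy the
    action respects [zz_eq], which is how homotopy classes are recovered from the localization. *)
Fixpoint zact X Y (u : zz X Y) : cmap P X -> cmap P Y :=
  match u with
  | zz_map X Y f => fun phi => cmap_comp phi f
  | zz_inv X Y s q => fun phi => sval (cid (cofib_lift phi cP q))
  | zz_comp X Y Z u v => fun phi => zact v (zact u phi)
  end.

Lemma zact_htpy X Y (u : zz X Y) phi psi : htpy phi psi -> htpy (zact u phi) (zact u psi).
Proof.
elim: u phi psi => {X Y} [X Y f|X Y s q|X Y Z u IHu v IHv] phi psi h /=.
- exact: htpy_compl.
- case: cid => f hf; case: cid => g hg /=; apply: (cofib_uniq cP q).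
  by apply: htpy_trans hf _; apply: htpy_trans h _; apply: htpy_sym.
- exact/IHv/IHu.
Qed.

Lemma zact_eq X Y (u v : zz X Y) : zz_eq u v -> forall phi, htpy (zact u phi) (zact v phi).
Proof.
elim=> {X Y u v} /=.
- by move=> X Y u phi; apply: htpy_refl.
- by move=> X Y u v _ h phi; apply: htpy_sym.
- by move=> X Y u v w _ h _ h' phi; apply: htpy_trans (h phi) (h' phi).
- move=> X Y Z u u' v v' _ h _ h' phi.
  by apply: htpy_trans (h' _) _; apply: zact_htpy.
- by move=> W X Y Z u v w phi; apply: htpy_refl.
- by move=> X Y u phi; apply: zact_htpy; apply: htpy_ext.
- by move=> X Y u phi; apply: htpy_ext.
- by move=> X Y f g e phi; apply: htpy_ext => n x /=; rewrite e.
- by move=> X Y Z f g phi; apply: htpy_ext.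
- move=> X Y s q phi; case: cid => psi h /=; apply: (cofib_uniq cP q).
  by apply: htpy_trans h _; apply: htpy_ext.
- move=> X Y s q phi; case: cid => psi h /=.
  by apply: htpy_trans h _; apply: htpy_ext.
Qed.

Lemma dmap_cofib Y (phi psi : cmap P Y) : dmap phi = dmap psi -> htpy phi psi.
Proof.
(* Both words act on the identity of [P]. *)
move=> /dpiP /zact_eq /(_ (cmap_id P)) /= h.
apply: htpy_trans (htpy_trans _ h) _; exact: htpy_ext.
Qed.
End MapsFromCofibrant.

(** * Bounded above complexes of projectives *)

Section BoundedAbove.
Variables (R : pzRingType) (P : cpx R) (b : int).
Hypotheses (P0 : forall n, (b < n)%R -> mzero (P n)) (pP : forall n, mprojective (P n)).

Lemma bounded_cofib : cofib P.
Proof.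
move=> V rho [rho0 rhoD] ext.
pose fam := forall n, {linear P n -> V n}.
pose good (k : nat) (v : fam) := forall n, (b - k%:Z < n)%R ->
   forall p, rho n p (v n p) (v (n + 1) (cd P n (n + 1) p)).
have step k v : good k v -> exists v', good k.+1 v' /\
    forall n, (b - k%:Z < n)%R -> forall p, v' n p = v n p.
  move=> gv; pose m := b - k%:Z.
  (* The admissible pairs (p, value) form a submodule that maps onto [P m] by [ext]; a section over
     the projective module [P m] selects the values linearly. *)
  pose S (u : P m * V m) := rho m u.1 u.2 (v (m + 1) (cd P m (m + 1) u.1)).
  have HS : subm S.
    split; first by rewrite /S /= !linear0; apply: rho0.
    by move=> a [p x] [q y] h h'; rewrite /S /= !linearP; apply: rhoD.
  pose pr1 : {linear smod HS -> P m} := lfst (sinc HS).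
  have spr1 : msurj pr1.
    move=> p; have [x hx] : exists x, rho m p x (v (m + 1) (cd P m (m + 1) p)).
      apply: ext; have := gv (m + 1) _ (cd P m (m + 1) p); rewrite cdd linear0.
      by apply; rewrite ltzD1.
    by have [u uE] := sinc_ex HS (hx : S (p, x)); exists u; rewrite -[pr1 u]/((sinc HS u).1) uE.
  have [sec secE] := pP spr1 (idfun : {linear P m -> P m}).
  pose w : {linear P m -> V m} := lsnd (sinc HS) \o sec.
  have wE p : rho m p (w p) (v (m + 1) (cd P m (m + 1) p)).
    by have := sincP (sec p); rewrite /S -[(sinc HS (sec p)).1]/(pr1 (sec p)) secE.
  pose vn n : {linear P n -> V n} := if n == m then (\0%R : {linear P n -> V n}) else v n.
  pose nf : fam := fun n => (tr V m n \o w \o tr P n m \+ vn n)%R.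
  have nfm p : nf m p = w p by rewrite /nf /vn /= eqxx !trE addr0.
  have new n p : (m < n)%R -> nf n p = v n p.
    move=> mn; rewrite /nf /vn /= gt_eqF // [tr P n m p]tr_ne ?linear0 ?add0r //.
    by rewrite gt_eqF.
  exists nf; split=> [n|n mn p]; last exact: new.
  move=> mn p; have [en|ne] := eqVneq n m.
    by move: p; rewrite en => p; rewrite nfm new ?ltzD1.
  have {}mn : (m < n)%R by move: ne; rewrite /m; lia.
  by rewrite !new //; [apply: gv | lia].
have good0 : good 0%N (fun n => \0).
  move=> n; rewrite subr0 => bn p; rewrite (P0 bn p) linear0; exact: rho0.
pose vs := fix vs k : {v | good k v} := match k with
  | 0%N => exist _ _ good0
  | k'.+1 => let c := cid (step k' _ (svalP (vs k'))) in exist _ (sval c) (proj1 (svalP c))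
  end.
have vsS k n p : (b - k%:Z < n)%R -> sval (vs k.+1) n p = sval (vs k) n p.
  by move=> kn /=; case: cid => v' [/= _ h]; apply: h.
have vsD k l n p : (b - k%:Z < n)%R -> sval (vs (l + k)%N) n p = sval (vs k) n p.
  move=> kn; elim: l => // l IH; rewrite addSn vsS //; lia.
(* After [kk n] stages the value in degree [n] is final. Degrees n and n + 1 are compared at the
   common stage kk n + kk (n + 1). *)
pose kk n : nat := `|b - n|%N.+1.
have kkn n : (b - (kk n)%:Z < n)%R by rewrite /kk; lia.
exists (fun n => sval (vs (kk n)) n) => n p.
rewrite -(vsD _ (kk (n + 1)) _ p (kkn n)) -(vsD _ (kk n) _ _ (kkn (n + 1))) addnC.
by apply: (svalP (vs _)); move: (kkn n); lia.
Qed.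
End BoundedAbove.

(** * Direct sums of complexes as coproducts in D(R) *)

Section Coproducts.
Variables (R : pzRingType) (I : Type).
Implicit Types X : I -> cpx R.

Section DirectSumComplex.
Variable X : I -> cpx R.

Definition dsumc_ob n : rmod R := dsum (fun i => X i n).
Definition dsumc_d n m : {linear dsumc_ob n -> dsumc_ob m} := dsum_map (fun i => cd (X i) n m).

Definition dsumc : cpx R.
Proof.
apply: (@Cpx R dsumc_ob dsumc_d).
- move=> n m u ne; apply: dsum_eq => i.
  by rewrite dpr_map cd_shape // linear0.
- move=> n m k u; apply: dsum_eq => i.
  by rewrite !dpr_map cdd linear0.
Defined.

Lemma dpr_cd n m i u : dpr i (cd dsumc n m u) = cd (X i) n m (dpr i u).
Proof. exact: dpr_map. Qed.
Lemma din_cd n m i x : cd dsumc n m (din i x) = din i (cd (X i) n m x).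
Proof. exact: dsum_map_in. Qed.

Definition dsumc_in i : cmap (X i) dsumc.
Proof. by exists (fun n => din (M := fun i => X i n) i) => n m x; rewrite din_cd. Defined.
Definition dsumc_pr i : cmap dsumc (X i).
Proof. by exists (fun n => dpr (M := fun i => X i n) i) => n m x; rewrite dpr_cd. Defined.

Lemma dsumc_out Z (g : forall i, cmap (X i) Z) :
  exists h : cmap dsumc Z, forall i n x, h n (din i x) = g i n x.
Proof.
pose h n : {linear dsumc n -> Z n} := sval (cid (dsum_out (fun i => g i n))).
have hE n i x : h n (din i x) = g i n x by rewrite /h; case: cid => k /= ->.
have hd i j x : h j (cd dsumc i j x) = cd Z i j (h i x).
  apply: (dsum_map_eq (f := h j \o cd dsumc i j) (g := cd Z i j \o h i)) => k y /=.
  by rewrite din_cd !hE cm_d.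
by exists (CMap hd) => i n x /=; rewrite hE.
Qed.

Lemma dsumc_cofib : (forall i, cofib (X i)) -> cofib dsumc.
Proof.
move=> cX V rho [rho0 rhoD] ext.
pose rhoi i n (p : X i n) v w := rho n (din i p : dsumc n) v w.
have ex i : exists v : forall n, {linear X i n -> V n},
    forall n p, rhoi i n p (v n p) (v (n + 1) (cd (X i) n (n + 1) p)).
  apply: cX.
    split; first by move=> n; rewrite /rhoi linear0.
    by move=> n a p v w p' v' w' h h'; rewrite /rhoi linearP; apply: rhoD.
  by move=> n p w h; apply: ext; rewrite din_cd.
pose vi i := sval (cid (ex i)).
have viE i : forall n p, rhoi i n p (vi i n p) (vi i (n + 1) (cd (X i) n (n + 1) p)).
  by rewrite /vi; case: cid.
pose v n : {linear dsumc n -> V n} := sval (cid (dsum_out (fun i => vi i n))).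
have vE n i x : v n (din i x) = vi i n x by rewrite /v; case: cid => k /= ->.
exists v => n; apply: dsum_ind.
  split; first by rewrite !linear0.
  by move=> a x y h h'; rewrite !linearP; apply: rhoD.
by move=> i x; rewrite din_cd !vE; apply: viE.
Qed.
End DirectSumComplex.

Lemma dsumc_map X Y (f : forall i, cmap (X i) (Y i)) :
  exists h : cmap (dsumc X) (dsumc Y),
   (forall i n x, h n (din i x) = din i (f i n x)) /\
   (forall i n u, dpr i (h n u) = f i n (dpr i u)).
Proof.
have hd i j (x : dsumc X i) : dsum_map (fun k => f k j) (cd (dsumc X) i j x) =
    cd (dsumc Y) i j (dsum_map (fun k => f k i) x).
  by apply: dsum_eq => k; rewrite dpr_map !dpr_cd dpr_map cm_d.
exists (@CMap R (dsumc X) (dsumc Y) (fun n => dsum_map (fun k => f k n)) hd).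
by split=> i n x; [exact: dsum_map_in|exact: (dpr_map (fun k => f k n))].
Qed.

Lemma dsumc_qis X Y (f : forall i, cmap (X i) (Y i)) (h : cmap (dsumc X) (dsumc Y)) :
  (forall i, qis (f i)) -> (forall i n x, h n (din i x) = din i (f i n x)) ->
  (forall i n u, dpr i (h n u) = f i n (dpr i u)) -> qis h.
Proof.
move=> qf hin hpr; split=> n.
  move=> u cu /boundaryE[w wE].
  have bi i : exists y : X i (n - 1), cd (X i) (n - 1) n y = dpr i u.
    apply: boundaryE; apply: (proj1 (qf i)).
      by move=> j; rewrite -dpr_cd cu linear0.
    by exists (n - 1), (dpr i w); rewrite -hpr -wE dpr_cd.
  pose y i := sval (cid (bi i)).
  have yE i : cd (X i) (n - 1) n (y i) = dpr i u by rewrite /y; case: cid.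
  have [s us zs] := dsum_fin u.
  exists (n - 1), (\sum_(i <- s) din i (y i)); rewrite lin_sum.
  rewrite [RHS](dsum_dec us zs); apply: eq_bigr => i _.
  by rewrite din_cd yE.
move=> u cu; have xi i : exists2 x : X i n, cycle x & boundary (f i n x - dpr i u).
  have [|x [cx bx]] := proj2 (qf i) n (dpr i u); last by exists x.
  by move=> j; rewrite -dpr_cd cu linear0.
pose x i := s2val (cid2 (xi i)).
have xc i : cycle (x i) by exact: (s2valP (cid2 (xi i))).
have xb i : exists b, cd (Y i) (n - 1) n b = f i n (x i) - dpr i u.
  exact: boundaryE (s2valP' (cid2 (xi i))).
pose b i := sval (cid (xb i)).
have bE i : cd (Y i) (n - 1) n (b i) = f i n (x i) - dpr i u by rewrite /b; case: cid.
have [s us zs] := dsum_fin u.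
exists (\sum_(i <- s) din i (x i)); split.
  by move=> j; rewrite lin_sum big1 // => i _; rewrite din_cd xc linear0.
exists (n - 1), (\sum_(i <- s) din i (b i)).
rewrite [X in _ = _ - X](dsum_dec us zs) !lin_sum -big_split; apply: eq_bigr => i _.
by rewrite din_cd bE hin linearB.
Qed.

Local Notation DT := (derived R).

(* The family is small: its index type lies in the universe of the carriers of
   modules.  So do, from here on, the index types in the definition of compact. *)
Theorem dsumc_coproduct X :
  @is_coproduct DT I X (dsumc X) (fun i => dmap (dsumc_in X i)).
Proof.
move=> Z g; pose P i := cell_cpx (X i); pose eps i : cmap (P i) (X i) := cell_res (X i).
have qe i : qis (eps i) by apply: cell_qis.
have cP i : cofib (P i) by apply: cell_cofib.
have [e [ein epr]] := dsumc_map eps.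
have qe' : qis e by exact: dsumc_qis qe ein epr.
have cE : cofib (dsumc P) by apply: dsumc_cofib.
have in_e i : dmap (eps i) ;; dmap (dsumc_in X i) = dmap (dsumc_in P i) ;; dmap e.
  by rewrite !dmapM; apply: dmap_ext => n x /=; rewrite ein.
(* On cofibrant resolutions of the summands the given morphisms become chain maps, and these extend
   to the direct sum. *)
have gi i : exists ga : cmap (P i) Z, dmap (eps i) ;; g i = dmap ga by apply: dhom_map.
pose ga i := sval (cid (gi i)).
have gaE i : dmap (eps i) ;; g i = dmap (ga i) by rewrite /ga; case: cid.
have [k kE] := dsumc_out ga.
exists (dinv qe' ;; dmap k : phom (dsumc X : DT) Z); split.
  move=> i; change (dmap (dsumc_in X i) ;; (dinv qe' ;; dmap k) = g i).
  apply: (dcomp_qisI (qe i)); rewrite dcompA in_e !dcompA -(dcompA (dmap _) (dmap e)).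
  by rewrite dinvr dcomp1r gaE dmapM; apply: dmap_ext => n x /=; rewrite kE.
move=> h hE; apply: (dcomp_qisI qe'); rewrite dcompA dinvr dcomp1l.
have [k' k'E] : exists k' : cmap (dsumc P) Z, dmap e ;; h = dmap k' by apply: dhom_map.
rewrite k'E; apply: dmap_htpy.
(* Uniqueness: equality on each summand is a homotopy, as [P i] is cofibrant, and chosen homotopies
   assemble to one on the direct sum. *)
have hi i : htpy (cmap_comp (dsumc_in P i) k) (cmap_comp (dsumc_in P i) k').
  apply: dmap_cofib => //; rewrite -!dmapM -k'E dcompA -in_e -dcompA (hE i : _ ;; _ = _).
  by rewrite gaE dmapM; apply: dmap_ext => n x /=; rewrite kE.
pose s i := sval (cid (hi i)).
have sE i n (x : P i (n + 1)) : k (n + 1) (din i x) - k' (n + 1) (din i x) =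
    cd Z n (n + 1) (s i n x) + s i (n + 1) (cd (P i) (n + 1) (n + 1 + 1) x).
  exact: (svalP (cid (hi i))).
pose t n : {linear dsumc P (n + 1) -> Z n} := sval (cid (dsum_out (fun i => s i n))).
have tE n i x : t n (din i x) = s i n x by rewrite /t; case: cid => q /= ->.
exists t => n.
pose F : {linear dsumc P (n + 1) -> Z (n + 1)} := (k (n + 1) \- k' (n + 1))%R.
pose G : {linear dsumc P (n + 1) -> Z (n + 1)} :=
  ((cd Z n (n + 1) \o t n) \+ (t (n + 1) \o cd (dsumc P) (n + 1) (n + 1 + 1)))%R.
apply: (dsum_map_eq (f := F) (g := G)) => i x.
by rewrite /F /G /= din_cd !tE sE.
Qed.

Theorem coproduct_transfer X S (th : cmap (dsumc X) S) : qis th ->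
  @is_coproduct DT I X S (fun i => dmap (cmap_comp (dsumc_in X i) th)).
Proof.
move=> q Z g; have [h [hE hu]] := @dsumc_coproduct X Z g.
exists (dinv q ;; h : phom (S : DT) Z); split.
  move=> i; change (dmap (cmap_comp (dsumc_in X i) th) ;; (dinv q ;; h) = g i).
  by rewrite -dmapM dcompA -(dcompA _ (dmap th)) dinvr dcomp1r; apply: hE.
move=> h' h'E; have -> : h = (dmap th ;; h' : phom (dsumc X : DT) Z).
  apply: hu => i; change (dmap (dsumc_in X i) ;; (dmap th ;; h') = g i).
  by rewrite dcompA dmapM; apply: h'E.
by rewrite dcompA dinvl dcomp1l.
Qed.
End Coproducts.

(** * Compact objects *)

Section AbGroups.
Variable A : abgrp.
Implicit Types a b c : A.

Lemma ab0D a : abD ab0 a = a.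
Proof. by rewrite abDC abD0. Qed.
Lemma abDI a b c : abD a b = abD a c -> b = c.
Proof.
move=> e; rewrite -[b]ab0D -[c]ab0D -(abDN a) (abDC a) -!abDA e //.
Qed.
Lemma ab_idem a : abD a a = a -> a = ab0.
Proof. by move=> e; apply: (@abDI a); rewrite abD0. Qed.
Lemma abDACA a b c d : abD (abD a b) (abD c d) = abD (abD a c) (abD b d).
Proof. by rewrite -!abDA; congr abD; rewrite !abDA (abDC b). Qed.
Lemma abNK a : abN (abN a) = a.
Proof. by apply: (@abDI (abN a)); rewrite abDN abDC abDN. Qed.
Lemma abN0 : abN (@ab0 A) = ab0.
Proof. by rewrite -[LHS]ab0D abDN. Qed.
Lemma abN_uniq a b : abD a b = ab0 -> b = abN a.
Proof. by move=> e; apply: (@abDI a); rewrite e abDN. Qed.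
Lemma abB_eq0 a b : abD a (abN b) = ab0 -> a = b.
Proof. by move=> e; rewrite -[b]abNK; apply: abN_uniq; rewrite abDC. Qed.

HB.instance Definition _ := Monoid.isComLaw.Build A ab0 (@abD A)
  (@abDA A) (@abDC A) (@ab0D).
End AbGroups.

Section PreAdd.
Variable T : preadd.

Lemma pcomp0r (X Y Z : T) (f : phom X Y) : pcomp f (ab0 : phom Y Z) = ab0.
Proof. by apply: ab_idem; rewrite -pcompDr abD0. Qed.
Lemma pcomp0l (X Y Z : T) (f : phom Y Z) : pcomp (ab0 : phom X Y) f = ab0.
Proof. by apply: ab_idem; rewrite -pcompDl abD0. Qed.

Lemma pcomp_suml (X Y Z : T) (I : Type) (s : seq I) (F : I -> phom X Y) (f : phom Y Z) :
  pcomp (\big[@abD _/ab0]_(i <- s) F i) f = \big[@abD _/ab0]_(i <- s) pcomp (F i) f.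
Proof.
by elim: s => [|i s IH]; rewrite ?big_nil ?pcomp0l // !big_cons pcompDl IH.
Qed.
Lemma pcomp_sumr (X Y Z : T) (I : Type) (s : seq I) (f : phom X Y) (F : I -> phom Y Z) :
  pcomp f (\big[@abD _/ab0]_(i <- s) F i) = \big[@abD _/ab0]_(i <- s) pcomp f (F i).
Proof.
by elim: s => [|i s IH]; rewrite ?big_nil ?pcomp0r // !big_cons pcompDr IH.
Qed.

Lemma foldr_big (A : abgrp) (I : Type) (s : seq I) (F : I -> A) :
  foldr (fun i a => abD (F i) a) ab0 s = \big[@abD _/ab0]_(i <- s) F i.
Proof. by elim: s => [|i s IH]; rewrite ?big_nil // big_cons -IH. Qed.

Lemma In_mem (I : Type) (x : {classic I}) (t : seq {classic I}) : List.In x t <-> x \in t.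
Proof.
elim: t => //= y t IH; rewrite inE; split.
  by case=> [->|/IH ->]; rewrite ?eqxx ?orbT.
by case/orP => [/eqP->|/IH]; [left|right].
Qed.

Lemma NoDup_uniq (I : Type) (s : seq {classic I}) : List.NoDup s <-> uniq s.
Proof.
elim: s => [|x s IH] /=; first by split=> // _; constructor.
split=> [nd|/andP[xs /IH us]].
  apply/andP; split; last by apply/IH; inversion nd.
  by apply/negP => /In_mem; inversion nd.
by constructor => // /In_mem; apply/negP.
Qed.

Lemma is_sum_ofP (I : Type) (X : I -> T) (S : T) (iota : forall i, phom (X i) S) (c : T)
    (g : forall i, phom c (X i)) (f : phom c S) :
  is_sum_of iota g f <-> exists s : seq {classic I},
    [/\ uniq s, forall i : {classic I}, i \notin s -> g i = ab0 &
        f = \big[@abD _/ab0]_(i <- s) pcomp (g i) (iota i)].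
Proof.
split=> -[s [h1 h2 h3]]; exists s; split.
- exact/NoDup_uniq.
- by move=> i si; have [//|/h2/In_mem] := pselect (g i = ab0); rewrite (negbTE si).
- by rewrite h3 (foldr_big s (fun i => pcomp (g i) (iota i))).
- exact/NoDup_uniq.
- by move=> i gi; apply/In_mem/negPn/negP => /h2.
- by rewrite h3 -(foldr_big s (fun i => pcomp (g i) (iota i))).
Qed.

Lemma coprod_proj (I : Type) (X : I -> T) (S : T) (iota : forall i, phom (X i) S) :
  is_coproduct iota -> forall i, exists p : phom S (X i),
    pcomp (iota i) p = pid (X i) /\ forall j, j <> i -> pcomp (iota j) p = ab0.
Proof.
move=> cop i.
pose g j : phom (X j) (X i) :=
  match pselect (j = i) with left e => eq_rect j (fun k => phom (X j) (X k)) (pid (X j)) i e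
  | right _ => ab0 end.
have [p [pE _]] := cop (X i) g; exists p; split=> [|j ne]; rewrite pE /g; case: pselect => //.
by move=> e; rewrite (Prop_irrelevance e erefl).
Qed.

Lemma is_sum_of_proj (I : Type) (X : I -> T) (S : T) (iota : forall i, phom (X i) S) (c : T)
    (g : forall i, phom c (X i)) (f : phom c S) (i : I) (p : phom S (X i)) :
  pcomp (iota i) p = pid (X i) -> (forall j, j <> i -> pcomp (iota j) p = ab0) ->
  is_sum_of iota g f -> g i = pcomp f p.
Proof.
move=> pi pj /is_sum_ofP[s [us gs ->]]; rewrite pcomp_suml.
have pj' (j : {classic I}) : j != i :> {classic I} -> pcomp (pcomp (g j) (iota j)) p = ab0.
  by move=> /eqP ne; rewrite -pcompA pj // pcomp0r.
have [si|si] := boolP ((i : {classic I}) \in s).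
  by rewrite (bigD1_seq (i : {classic I})) //= -pcompA pi pcomp1r big1 ?abD0.
rewrite gs // big_seq big1 // => j sj; apply: pj'.
by apply: contraNneq si => <-.
Qed.

(* The components of f are f followed by the projections of the coproduct, so
   only the existence of a finite decomposition is at stake. *)
Lemma compactI (c : T) :
  (forall (I : Type) (X : I -> T) (S : T) (iota : forall i, phom (X i) S),
    is_coproduct iota -> forall f : phom c S,
    exists s : seq {classic I}, uniq s /\ exists g : (forall i, phom c (X i)),
      f = \big[@abD _/ab0]_(i <- s) pcomp (g i) (iota i)) ->
  compact c.
Proof.
move=> h I X S iota cop f; have [s [us [g fE]]] := h _ _ _ _ cop f.
pose g' (i : {classic I}) : phom c (X i) := if i \in s then g i else ab0.
exists g'; split.
  apply/is_sum_ofP; exists s; split=> //; first by move=> i /negbTE si; rewrite /g' si.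
  by rewrite fE !big_seq; apply: eq_bigr => i si; rewrite /g' si.
move=> k kE; apply: functional_extensionality_dep => i.
have [p [pi pj]] := coprod_proj cop i.
rewrite (is_sum_of_proj pi pj kE) (is_sum_of_proj (g := g') pi pj (f := f)) //.
apply/is_sum_ofP; exists s; split=> //; first by move=> j /negbTE sj; rewrite /g' sj.
by rewrite fE !big_seq; apply: eq_bigr => j sj; rewrite /g' sj.
Qed.
End PreAdd.

Section Compactness.
Variable R : pzRingType.
Implicit Types X Y Z P : cpx R.
Local Notation DT := (derived R).

Definition cmap_lsum X Y (I : Type) (s : seq I) (f : I -> cmap X Y) : cmap X Y :=
  foldr (fun i a => cmap_add (f i) a) (cmap_zero X Y) s.

Lemma cmap_lsumE X Y (I : Type) (s : seq I) (f : I -> cmap X Y) n x :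
  cmap_lsum s f n x = \sum_(i <- s) f i n x.
Proof. by elim: s => [|i s IH]; rewrite ?big_nil ?big_cons //= IH. Qed.

Lemma dmap_lsum X Y (I : Type) (s : seq I) (f : I -> cmap X Y) :
  dmap (cmap_lsum s f) = \big[@abD (@phom DT X Y)/ab0]_(i <- s) (dmap (f i) : @phom DT X Y).
Proof. by elim: s => [|i s IH]; rewrite ?big_nil // big_cons -IH /= dmapD. Qed.

(** Compactness of [c] in terms of chain maps, the form in which the factorization of cocycles uses
    it. *)
Lemma compact_map (c P : cpx R) (e : cmap P c) (I : Type) (X : I -> cpx R) (S : cpx R)
    (th : cmap (dsumc X) S) (phi : cmap P S) :
  @compact DT c -> cofib P -> qis e -> qis th ->
  exists (s : seq I) (ga : forall i, cmap P (X i)), htpy phi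
    (cmap_lsum s (fun i => cmap_comp (ga i) (cmap_comp (dsumc_in X i) th))).
Proof.
move=> cc cP qe qt.
have [g [[s [_ _ fE]] _]] := cc _ _ _ _ (coproduct_transfer qt) (dinv qe ;; dmap phi : @phom DT c S).
have gi i : exists ga : cmap P (X i), dmap e ;; g i = dmap ga by apply: dhom_map.
pose ga i := sval (cid (gi i)).
have gaE i : dmap e ;; g i = dmap (ga i) by rewrite /ga; case: cid.
exists s, ga; apply: (dmap_cofib cP); rewrite dmap_lsum.
rewrite -[LHS]dcomp1l -(dinvr qe) -[LHS]dcompA.
have -> : dinv qe ;; dmap phi = \big[@abD (@phom DT c S)/ab0]_(i <- s)
    pcomp (g i) (dmap (cmap_comp (dsumc_in X i) th) : @phom DT (X i) S).
  by rewrite [LHS]fE -(foldr_big s (fun i => pcomp (g i) (dmap (cmap_comp (dsumc_in X i) th) : @phom DT (X i) S))).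
rewrite [LHS](pcomp_sumr (T := DT) s (dmap e : @phom DT P c)).
by apply: eq_bigr => i _; rewrite [LHS](dcompA (dmap e)) gaE dmapM.
Qed.

Lemma compact_qis P c (e : cmap P c) : qis e -> @compact DT P -> @compact DT c.
Proof.
move=> qe cP; apply: compactI => I X S iota cop f.
have [g [/is_sum_ofP[s [us _ gE]] _]] := cP _ _ _ _ cop (dmap e ;; f : @phom DT P S).
exists s; split=> //; exists (fun i => dinv qe ;; g i : @phom DT c (X i)).
apply: (dcomp_qisI qe); rewrite [LHS]gE.
rewrite [RHS](pcomp_sumr (T := DT) s (dmap e : @phom DT P c)).
apply: eq_bigr => i _; change (g i ;; iota i = dmap e ;; (dinv qe ;; g i ;; iota i)).
by rewrite !dcompA dinvr dcomp1l.
Qed.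

Lemma fin_gen_dsum (M : rmod R) (I : Type) (N : I -> rmod R) (f : {linear M -> dsum N}) :
  fin_gen M -> exists s : seq {classic I}, forall i : {classic I}, i \notin s ->
    forall x, dpr i (f x) = 0.
Proof.
case=> n [p sp].
have fs k : exists2 s : seq {classic I}, uniq s &
    forall i : {classic I}, i \notin s -> dpr i (f (p (delta_mx 0 k))) = 0 by apply: dsum_fin.
pose s k := s2val (cid2 (fs k)).
have sE k : forall i : {classic I}, i \notin s k -> dpr i (f (p (delta_mx 0 k))) = 0.
  exact: (s2valP' (cid2 (fs k))).
exists (flatten [seq s k | k <- enum 'I_n]) => i si x; have [y <-] := sp x.
apply: (rv_map_eq (f := dpr i \o (f \o p)) (g := \0)) => k /=; apply: sE.
apply: contra si => si; apply/flattenP; exists (s k) => //.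
by apply: map_f; rewrite mem_enum.
Qed.

(** A chain map from [P] to a direct sum has nonzero components in finitely many summands only,
    since finitely many terms are nonzero and each is finitely generated. A general coproduct is
    compared with the direct sum by universal properties. *)
Lemma perfect_compact P (b : nat) : cofib P ->
  (forall n, (b%:Z < `|n|)%R -> mzero (P n)) -> (forall n, fin_gen (P n)) ->
  @compact DT P.
Proof.
move=> cP P0 fP; apply: compactI => I X S iota cop f.
pose inn i : @phom DT (X i) (dsumc X) := dmap (dsumc_in X i).
have [th [thE _]] := cop (dsumc X) inn.
have [th' [th'E _]] := dsumc_coproduct (X := X) iota.
have thK : th ;; th' = dmap (cmap_id S).
  have [k [_ ku]] := cop S iota; rewrite -(ku (th ;; th')); first apply: ku.
    by move=> i; apply: dcomp1r.
  by move=> i; rewrite [LHS](dcompA (iota i)) (thE i : _ ;; _ = _); apply: th'E.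
have [phi phiE] := dhom_map cP (f ;; th).
have fs n : exists s : seq {classic I}, forall i : {classic I}, i \notin s ->
    forall x, dpr i (phi n x) = 0 by apply: fin_gen_dsum.
pose s n := sval (cid (fs n)).
have sE n : forall i : {classic I}, i \notin s n -> forall x, dpr i (phi n x) = 0.
  by rewrite /s; case: cid.
(* The supports in the degrees from -b to b; all other terms of [P] vanish. *)
pose u := flatten ([seq s k%:Z | k <- seq.iota 0 b.+1] ++ [seq s (- k%:Z) | k <- seq.iota 0 b.+1]).
pose t := undup u.
have tz n (i : {classic I}) : i \notin t -> forall x, dpr i (phi n x) = 0.
  rewrite mem_undup => it x; have [bn|nb] := ltrP (b%:Z) `|n|.
    by rewrite (P0 n bn x) !linear0.
  apply: sE; apply: contra it => it; apply/flattenP; exists (s n) => //.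
  rewrite mem_cat; apply/orP; have [n0|n0] := lerP 0 n.
    left; apply/mapP; exists `|n|%N; last by rewrite gez0_abs.
    by rewrite mem_iota; move: nb; lia.
  right; apply/mapP; exists `|n|%N; last by congr s; lia.
  by rewrite mem_iota; move: nb; lia.
exists t; split; first exact: undup_uniq.
exists (fun i => dmap (cmap_comp phi (dsumc_pr X i)) : @phom DT P (X i)).
have phiD : dmap phi = dmap (cmap_lsum t (fun i =>
    cmap_comp (cmap_comp phi (dsumc_pr X i)) (dsumc_in X i))).
  apply: dmap_ext => n x; rewrite cmap_lsumE.
  by apply: dsum_dec; [apply: undup_uniq|move=> i it; apply: tz].
rewrite -[LHS]dcomp1r -thK dcompA phiE phiD dmap_lsum.
rewrite [LHS](pcomp_suml (T := DT) t _ (th' : @phom DT (dsumc X) S)).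
apply: eq_bigr => i _; rewrite -[in LHS]dmapM.
by rewrite -[LHS]dcompA; congr (_ ;; _); apply: th'E.
Qed.
End Compactness.

(** * Complexes with zero differential *)

Section Graded.
Variable R : pzRingType.
Implicit Types X Y Z P : cpx R.

Definition zdiff X := forall i j x, cd X i j x = 0.

Definition gcx (N : int -> rmod R) : cpx R :=
  @Cpx R N (fun i j => (\0 : {linear N i -> N j})%R) (fun i j x _ => erefl) (fun i j k x => erefl).

Lemma gcx_zdiff N : zdiff (gcx N).
Proof. by []. Qed.

Lemma zmap_ex X Y (f : forall n, {linear X n -> Y n}) : zdiff Y ->
  (forall n (x : X n), f (n + 1) (cd X n (n + 1) x) = 0) ->
  exists g : cmap X Y, forall n x, g n x = f n x.
Proof.
move=> zY f0; have fd i j x : f j (cd X i j x) = cd Y i j (f i x).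
  rewrite zY; have [<-|ne] := eqVneq (i + 1) j; first exact: f0.
  by rewrite cd_shape // linear0.
by exists (CMap fd).
Qed.

Lemma bij_qis X Y (f : cmap X Y) : (forall n, minj (f n)) -> (forall n, msurj (f n)) -> qis f.
Proof.
move=> fi fs; split=> n.
  move=> x cx /boundaryE[y yE]; have [z zE] := fs _ y.
  exists (n - 1), z; apply/eqP; rewrite -subr_eq0; apply/eqP/fi.
  by rewrite linearB cm_d zE yE subrr.
move=> y cy; have [x xE] := fs _ y; exists x; split.
  by move=> j; apply: fi; rewrite cm_d xE cy.
by exists n, 0; rewrite linear0 xE subrr.
Qed.

Fact deg_subm (N : int -> rmod R) (m n : int) : subm (fun x : N n => n = m \/ x = 0).
Proof.
split; first by right.
move=> a x y [|->]; first by left.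
by case=> [|->]; [left | right; rewrite scaler0 addr0].
Qed.

(* Spelled as submodules of the N n, so that the inclusion needs no transport
   along n = m. *)
Definition degpart (N : int -> rmod R) m : cpx R := gcx (fun n => smod (deg_subm N m n)).

Lemma degpart_dsum N : exists th : cmap (dsumc (degpart N)) (gcx N), qis th /\
  forall m n x, th n (din m x) = sinc (deg_subm N m n) x.
Proof.
have gi m : exists g : cmap (degpart N m) (gcx N), forall n x, g n x = sinc (deg_subm N m n) x.
  by apply: (@zmap_ex (degpart N m) (gcx N) (fun n => sinc (deg_subm N m n))) => // n x; rewrite linear0.
pose g m := sval (cid (gi m)).
have gE m : forall n x, g m n x = sinc (deg_subm N m n) x by rewrite /g; case: cid.
have [th thE] := dsumc_out g; exists th; split; last by move=> m n x; rewrite thE gE.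
have dprE n (u : dsumc (degpart N) n) : u = din n (dpr n u).
  apply: dsum_eq => m; have [e|ne] := pselect (n = m); first by case: m / e; rewrite dpr_in.
  rewrite dpr_in_ne //; apply: sinc_inj; rewrite linear0.
  by case: (sincP (dpr m u)).
apply: bij_qis => n.
  move=> u; rewrite (dprE n u) thE gE => h.
  have -> : dpr n u = 0 by apply: sinc_inj; rewrite h linear0.
  by rewrite linear0.
move=> x; have [y yE] := sinc_ex (deg_subm N n n) (or_introl (erefl n) : n = n \/ x = 0).
by exists (din n y); rewrite thE gE.
Qed.
End Graded.

(** * Factorization of cocycles through finitely presented modules *)

Section Factorization.
Variables (R : pzRingType) (c P : cpx R) (e : cmap P c).
Hypotheses (cc : @compact (derived R) c) (cP : cofib P) (qe : qis e).

Definition cocycle k (M : rmod R) (x : {linear P k -> M}) := forall i p, x (cd P i k p) = 0.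

Lemma cocycle_succ n (M : rmod R) (x : {linear P (n + 1) -> M}) :
  (forall p, x (cd P n (n + 1) p) = 0) -> cocycle x.
Proof.
move=> h i p; have [ei|ne] := eqVneq (i + 1) (n + 1).
  by move: p; rewrite (addIr 1 ei).
by rewrite cd_shape // linear0.
Qed.

(* All the universal cocycles P^n -> P^n / im d together form a map from c to a
   direct sum over n, which is homotopic to one with finitely many components. *)
Lemma cocycle_bounded : exists b : int, forall k, (k < b)%R -> forall (M : rmod R) (x : {linear P k -> M}),
  cocycle x -> exists s : {linear P (k + 1) -> M}, forall p, x p = s (cd P k (k + 1) p).
Proof.
have bs n : subm (fun p : P n => exists y : P (n - 1), cd P (n - 1) n y = p).
  split; first by exists 0; rewrite linear0.
  by move=> a x y [u <-] [v <-]; exists (a *: u + v); rewrite linearP.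
pose N n : rmod R := qmod (bs n).
have [phi phiE] : exists phi : cmap P (gcx N), forall n x, phi n x = qpi (bs n) x.
  apply: (@zmap_ex R P (gcx N) (fun n => qpi (bs n))) => // n x.
  by apply/qpi0; apply: boundaryE; exists n, x.
have [th [qth thE]] := degpart_dsum N.
have [s [ga [h hE]]] := compact_map phi cc cP qe qth.
have [b bE] : exists b : int, forall k, (k < b)%R -> k \notin s.
  elim: (s) => [|m s' [b bE]]; first by exists 0.
  exists (Order.min m b) => k; rewrite lt_min inE negb_or => /andP[km kb].
  by rewrite lt_eqF //= bE.
exists b => k; move: k; apply: forall_succ => n nb M x cx.
(* [b] is a lower bound of the finitely many surviving components. Below it the universal cocycle is
   a coboundary, and so is every cocycle, as it factors through the universal one. *)
have phi0 p : phi (n + 1) p = h (n + 1) (cd P (n + 1) (n + 1 + 1) p).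
  have := hE n p; rewrite cmap_lsumE big_seq big1 ?subr0 => [->|m ms] /=.
    by rewrite add0r.
  rewrite thE; case: (sincP (ga m (n + 1) p)) => [nm|//].
  by case/negP: (bE _ nb); rewrite nm.
have [g gE] : exists g : {linear N (n + 1) -> M}, forall p, g (qpi (bs (n + 1)) p) = x p.
  apply: surj_desc; first exact: qpi_surj.
  by move=> p /qpi0[y <-]; apply: cx.
by exists (g \o h (n + 1)) => p /=; rewrite -phi0 phiE gE.
Qed.

(** A cocycle with values in a free module is a morphism to a direct sum of shifted copies of [R];
    by compactness finitely many coordinates suffice up to a coboundary. *)
Lemma cocycle_free k (C : Type) (x : {linear P k -> free R^c C}) : cocycle x ->
  exists m (f : {linear 'rV[R^c]_m -> free R^c C}) (y : {linear P k -> 'rV[R^c]_m})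
    (s : {linear P (k + 1) -> free R^c C}),
    cocycle y /\ forall p, x p = f (y p) + s (cd P k (k + 1) p).
Proof.
move: k x; apply: forall_succ => k x cx.
(* [R] is put in every degree, to spare transports; the map [phi] below is nonzero in degree k + 1
   only. *)
pose X (i : C) : cpx R := gcx (fun n => (R^c)^o : rmod R).
pose S : cpx R := gcx (fun n => free R^c C : rmod R).
have [th thE] : exists th : cmap (dsumc X) S, forall n u, th n u = u.
  apply: (@zmap_ex R (dsumc X) S (fun n => (idfun : {linear free R^c C -> free R^c C}))) => // n u.
  by apply: dsum_eq => i; rewrite (linear0 (dpr i)); exact: (@dpr_cd R C X n (n + 1) i u).
have qth : qis th.
  apply: bij_qis => n u; first by rewrite thE.
  by exists u; rewrite thE.
have [phi phiE] : exists phi : cmap P S, forall n p, phi n p = x (tr P n (k + 1) p).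
  apply: (@zmap_ex R P S (fun n => x \o tr P n (k + 1))) => // n p /=.
  have [en|ne] := eqVneq (n + 1) (k + 1); last by rewrite tr_ne // linear0.
  by rewrite tr_cd // cx.
have [s [ga [h hE]]] := compact_map phi cc cP qe qth.
have gac i j p : ga i (k + 1) (cd P j (k + 1) p) = 0 by rewrite cm_d.
pose m := size s; pose si (j : 'I_m) := tnth (in_tuple s) j.
have [f fE] := rv_out (fun j => fgen R^c (si j)).
have ly : linear (fun p => \row_(j < m) (ga (si j) (k + 1) p : R^c)).
  by move=> a p q; apply/rowP => j; rewrite !mxE linearP.
exists m, f, (mklin ly), (h (k + 1)); split=> [i p|p].
  by apply/rowP => j; rewrite !mxE gac.
have := hE k p; rewrite phiE trE [cd S _ _ _]/= add0r => /eqP; rewrite subr_eq => /eqP ->.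
rewrite addrC; congr (_ + _); rewrite cmap_lsumE big_tnth [in RHS](rv_dec (mklin ly p)) lin_sum.
apply: eq_bigr => j _; rewrite linearZ /= fE mxE thE -/(si j) /fgen -linearZ /=.
by congr (din _ _); rewrite /GRing.scale /= mulr1.
Qed.
End Factorization.

Section FinitelyPresented.
Variable R : pzRingType.

Lemma im_subm (X Y : rmod R) (f : {linear X -> Y}) : subm (fun y => exists x, f x = y).
Proof.
split; first by exists 0; rewrite linear0.
by move=> a x y [u <-] [v <-]; exists (a *: u + v); rewrite linearP.
Qed.

Lemma ker_subm (X Y : rmod R) (f : {linear X -> Y}) : subm (fun x => f x = 0).
Proof.
split; first by rewrite linear0.
by move=> a x y fx fy; rewrite linearP fx fy scaler0 addr0.
Qed.

Lemma fp_quot m n (r : {linear 'rV[R^c]_m -> 'rV[R^c]_n}) : fin_pres (qmod (im_subm r)).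
Proof.
exists m, n, r, (qpi (im_subm r)); split; last exact: qpi_surj.
by move=> y; apply: qpi0.
Qed.

Lemma fp_fg (M : rmod R) : fin_pres M -> fin_gen M.
Proof. by case=> m [n [r [p [_ sp]]]]; exists n, p. Qed.

Lemma rV_projective n : mprojective ('rV[R^c]_n : rmod R).
Proof.
move=> X Y g sg v; pose y i := sval (cid (sg (v (delta_mx 0 i)))).
have yE i : g (y i) = v (delta_mx 0 i) by rewrite /y; case: cid.
have [h hE] := rv_out y; exists h.
by apply: (rv_map_eq (f := g \o h)) => i /=; rewrite hE yE.
Qed.

Lemma rV_fp n : fin_pres ('rV[R^c]_n : rmod R).
Proof.
exists 0%N, n, (\0 : {linear 'rV[R^c]_0 -> 'rV[R^c]_n})%R, idfun; split; last by move=> y; exists y.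
by move=> y; split=> [/= ->|[x <-]] //; exists 0.
Qed.
End FinitelyPresented.

Section Factorization2.
Variables (R : pzRingType) (c P : cpx R) (e : cmap P c).
Hypotheses (cc : @compact (derived R) c) (cP : cofib P) (qe : qis e).

Definition fp_factors k (M : rmod R) (x : {linear P k -> M}) :=
  exists (F : rmod R) (f : {linear F -> M}) (y : {linear P k -> F}) (s : {linear P (k + 1) -> M}),
    [/\ fin_pres F, cocycle y & forall p, x p = f (y p) + s (cd P k (k + 1) p)].

(* Lift x to xt with values in a free cover L of M.  The obstruction xt d takes
   values in the kernel of L -> M, and by induction it factors, up to a coboundary,
   through a finitely presented module G.  The image of G lies in a finite free
   summand L0 of L; the component of xt outside L0 is then a cocycle with values in
   a free module, and that in L0 is one modulo the image of G. *)
Lemma fp_factors_step n :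
  (forall (M : rmod R) (x : {linear P n -> M}), cocycle x -> fp_factors x) ->
  forall (M : rmod R) (x : {linear P (n + 1) -> M}), cocycle x -> fp_factors x.
Proof.
move=> IH M x cx.
have [pi piE] := free_out (fun m : M => m).
have spi : msurj pi by move=> m; exists (fgen R^c m).
have [xt xtE] := cofib_proj (n := n + 1) cP spi x.
pose K : rmod R := smod (ker_subm pi); pose inK : {linear K -> free R^c M} := sinc (ker_subm pi).
have [y yE] : exists y : {linear P n -> K}, forall p, inK (y p) = xt (cd P n (n + 1) p).
  apply: (inj_lift (i := inK) (f := xt \o cd P n (n + 1))).
    by move=> u u0; apply: sinc_inj; rewrite linear0.
  by move=> p /=; apply: sinc_ex; rewrite xtE cx.
have cy : cocycle y by move=> i p; apply: sinc_inj; rewrite linear0 [LHS]yE cdd linear0.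
have [G [psi [y' [s [fpG cy' ysE]]]]] := IH _ y cy.
have [xh xhE] : exists xh : {linear P (n + 1) -> free R^c M}, forall p, xh p = xt p - inK (s p).
  by exists (xt \- (inK \o s))%R.
have pixh p : pi (xh p) = x p.
  by rewrite xhE linearB xtE (sincP (s p)) subr0.
have xhd p : xh (cd P n (n + 1) p) = inK (psi (y' p)).
  by rewrite xhE -yE ysE linearD addrK.
have [g [q sq]] := fp_fg fpG.
have [t0 t0E] := fin_gen_dsum (N := fun _ : M => (R^c)^o : rmod R) (inK \o psi) (fp_fg fpG).
pose t := undup t0; have ut : uniq t by apply: undup_uniq.
have tE (j : {classic M}) : j \notin t -> forall v, dpr j (inK (psi v)) = 0.
  by rewrite mem_undup; apply: t0E.
pose ti (j : 'I_(size t)) : M := tnth (in_tuple t) j.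
(* [b0] includes the finite free summand that contains the image of [G], and [a] below takes the
   coordinates in it. *)
pose b0 := sval (cid (rv_out (fun j => fgen R^c (ti j)))).
have b0E j : b0 (delta_mx 0 j) = fgen R^c (ti j) by rewrite /b0; case: cid.
have la : linear (fun u : free R^c M => \row_(j < size t) (dpr (ti j) u : R^c)).
  by move=> z u v; apply/rowP => j; rewrite !mxE linearP.
pose a := mklin la.
have baE v : b0 (a (inK (psi v))) = inK (psi v).
  rewrite [RHS](dsum_dec ut (u := inK (psi v))) => [|j tj]; last exact: tE.
  rewrite big_tnth (rv_dec (a _)) lin_sum; apply: eq_bigr => j _.
  rewrite linearZ /= b0E mxE /fgen -linearZ /=; congr (din _ _).
  by rewrite /GRing.scale /= mulr1.
have [x1 x1E] : exists x1 : {linear P (n + 1) -> free R^c M}, forall p, x1 p = xh p - b0 (a (xh p)).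
  by exists (xh \- (b0 \o (a \o xh)))%R.
have cx1 : cocycle x1 by apply: cocycle_succ => p; rewrite x1E xhd baE subrr.
have [m [f1 [x1' [s1 [cx1' x1sE]]]]] := cocycle_free cc cP qe cx1.
(* The module sought is the quotient of the finite free module with blocks [size t] and [m] by the
   images of the generators of [G], placed in the first block. These relations turn the component of
   [xh] in that block into a cocycle, and they die in [M] because [inK] lands in the kernel of
   [pi]. *)
have lr : linear (fun v : 'rV[R^c]_g => row_mx (a (inK (psi (q v)))) (0 : 'rV[R^c]_m)).
  by move=> z u v; rewrite !linearP scale_row_mx add_row_mx scaler0 addr0.
pose r := mklin lr.
have lx : linear (fun p => row_mx (a (xh p)) (x1' p)).
  by move=> z u v; rewrite !linearP scale_row_mx add_row_mx.
have lf : linear (fun v : 'rV[R^c]_(size t + m) => pi (b0 (lsubmx v)) + pi (f1 (rsubmx v))).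
  by move=> z u v; rewrite !linearP; zmodl.
have [f fE] : exists f : {linear qmod (im_subm r) -> M}, forall v, f (qpi (im_subm r) v) = mklin lf v.
  apply: surj_desc; first exact: qpi_surj.
  move=> v /qpi0[w <-] /=; rewrite row_mxKl row_mxKr baE linear0 linear0 addr0.
  exact: (sincP (psi (q w))).
exists (qmod (im_subm r)), f, (qpi (im_subm r) \o mklin lx), (pi \o s1)%R; split.
- exact: fp_quot.
- apply: cocycle_succ => p /=; rewrite xhd cx1'; apply/qpi0.
  by have [w wE] := sq (y' p); exists w; rewrite /= wE.
- move=> p; rewrite fE /= row_mxKl row_mxKr -pixh.
  have ex : xh p = b0 (a (xh p)) + x1 p by rewrite x1E; zmod.
  by rewrite [X in pi X = _]ex linearD x1sE linearD addrA.
Qed.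

Theorem fp_factor k : forall (M : rmod R) (x : {linear P k -> M}), cocycle x -> fp_factors x.
Proof.
have [b bE] := cocycle_bounded cc cP qe.
(* The start of the induction: below [b] cocycles are coboundaries, so the zero module serves. *)
have low j : (j < b)%R -> forall (N : rmod R) (y : {linear P j -> N}), cocycle y -> fp_factors y.
  move=> jb N y cy; have [s sE] := bE _ jb _ _ cy.
  exists ('rV[R^c]_0 : rmod R), (\0)%R, (\0)%R, s; split.
  - exact: rV_fp.
  - by [].
  - by move=> p; rewrite /= add0r.
have [kb|bk] := ltrP k b; first exact: low.
have -> : k = b - 1 + (`|k - b|%N.+1)%:Z by lia.
move: `|k - b|%N.+1 => l {bk}.
elim: l => [|l IH]; first by apply: low; lia.
have -> : b - 1 + l.+1%:Z = b - 1 + l%:Z + 1 by lia.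
exact: fp_factors_step.
Qed.
End Factorization2.

(** * Pure short exact sequences under T(c, -) for compact c *)

Section PureExact.
Variables (R : pzRingType) (c : cpx R) (cc : @compact (derived R) c).
Variables (A B C : cpx R) (i : cmap A B) (p : cmap B C).
Hypotheses (zA : zdiff A) (zB : zdiff B) (zC : zdiff C).

Let P := cell_cpx c.
Let e : cmap P c := cell_res c.
Let cP : cofib P := @cell_cofib R c.
Let qe : qis e := @cell_qis R c.

Lemma zmap_cocycle X (f : cmap P X) n : zdiff X -> cocycle (f n).
Proof. by move=> zX j x; rewrite cm_d zX. Qed.

Lemma zhtpyP X (f g : cmap P X) : zdiff X ->
  htpy f g <-> exists h : forall n, {linear P (n + 1) -> X n},
    forall n x, f n x - g n x = h n (cd P n (n + 1) x).
Proof.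
move=> zX; split=> -[h hE]; exists h.
  by apply: forall_succ => n x; rewrite hE zX add0r.
by move=> n x; rewrite hE zX add0r.
Qed.

Lemma zmap_lift : (forall n, pure_surj (p n)) -> forall phi : cmap P C,
  exists psi : cmap P B, htpy phi (cmap_comp psi p).
Proof.
move=> pp phi.
have ex n : exists (y : {linear P n -> B n}) (s : {linear P (n + 1) -> C n}),
    cocycle y /\ forall x, phi n x - p n (y x) = s (cd P n (n + 1) x).
  have [F [f [y [s [fF cy E]]]]] := fp_factor cc cP qe (zmap_cocycle phi n zC).
  have [g gE] := proj2 (pp n) F fF f.
  exists (g \o y), s; split=> [j x|x] /=; first by rewrite cy linear0.
  by rewrite gE E; zmod.
pose y n := sval (cid (ex n)); pose s n := sval (cid (svalP (cid (ex n)))).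
have ysE n : cocycle (y n) /\ forall x, phi n x - p n (y n x) = s n (cd P n (n + 1) x).
  exact: (svalP (cid (svalP (cid (ex n))))).
have [psi psiE] : exists psi : cmap P B, forall n x, psi n x = y n x.
  by apply: (@zmap_ex R P B y) => // n x; rewrite (proj1 (ysE (n + 1))).
exists psi; apply/zhtpyP => //; exists s => n x.
by rewrite -(proj2 (ysE n)) /= psiE.
Qed.

Lemma pure_epi_surj : (forall n, pure_surj (p n)) ->
  forall u : dhom c C, exists v : dhom c B, v ;; dmap p = u.
Proof.
move=> pp u; have [phi phiE] := dhom_map cP (dmap e ;; u).
have [psi psiE] := zmap_lift pp phi.
exists (dinv qe ;; dmap psi); apply: (dcomp_qisI qe).
by rewrite -dcompA dmapM -(dmap_htpy psiE) dcompA dinvr dcomp1l phiE.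
Qed.

Hypotheses (pi0 : forall n, mses (i n) (p n)).

Lemma ses_mid (u : dhom c B) : u ;; dmap p = dzero c C -> exists v : dhom c A, v ;; dmap i = u.
Proof.
move=> u0; have [phi phiE] := dhom_map cP (dmap e ;; u).
have /zhtpyP-/(_ zC)[h hE] : htpy (cmap_comp phi p) (cmap_zero P C).
  by apply: dmap_cofib => //; rewrite -dmapM -phiE -dcompA u0 dcomp0.
have ht n : exists g : {linear P (n + 1) -> B n}, forall a, p n (g a) = h n a.
  have [_ _ sp] := pi0 n; exact: (cofib_proj cP sp (h n)).
pose g n := sval (cid (ht n)).
have gE n a : p n (g n a) = h n a by rewrite /g; case: cid a.
have ha n : exists k : {linear P n -> A n}, forall x, i n (k x) = phi n x - g n (cd P n (n + 1) x).
  have [ii ei _] := pi0 n.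
  apply: (inj_lift (f := (phi n \- (g n \o cd P n (n + 1)))%R)) => // x.
  by apply/ei; rewrite /= linearB gE -hE /= subr0 subrr.
pose k n := sval (cid (ha n)).
have kE n x : i n (k n x) = phi n x - g n (cd P n (n + 1) x) by rewrite /k; case: cid x.
have [chi chiE] : exists chi : cmap P A, forall n x, chi n x = k n x.
  apply: (@zmap_ex R P A k) => // n x; have [ii _ _] := pi0 (n + 1); apply: ii.
  by rewrite kE cdd linear0 subr0 cm_d zB.
have ch : htpy phi (cmap_comp chi i).
  apply/zhtpyP => //; exists g => n x; rewrite /= chiE kE; zmod.
exists (dinv qe ;; dmap chi); apply: (dcomp_qisI qe).
by rewrite -dcompA dmapM -(dmap_htpy ch) dcompA dinvr dcomp1l phiE.
Qed.

(** A null homotopy [s] in [B] yields a cocycle [p s], a morphism c -> C[-1] that the connecting map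
    sends to [u] up to sign. By purity it lifts to a cocycle in [B] up to a coboundary; subtracting
    both lifts from [s] gives a null homotopy in [A]. *)
Lemma pure_mono_inj (pp : forall n, pure_surj (p n)) (u : dhom c A) :
  u ;; dmap i = dzero c B -> u = dzero c A.
Proof.
move=> u0; have [chi chiE] := dhom_map cP (dmap e ;; u).
have /zhtpyP-/(_ zB)[s sE] : htpy (cmap_comp chi i) (cmap_zero P B).
  by apply: dmap_cofib => //; rewrite -dmapM -chiE -dcompA u0 dcomp0.
have {}sE n x : i n (chi n x) = s n (cd P n (n + 1) x) by rewrite -sE /= subr0.
have ex n : exists (y : {linear P (n + 1) -> B n}) (w : {linear P (n + 1 + 1) -> B n}),
    cocycle y /\ forall x, p n (s n x) = p n (y x) + p n (w (cd P (n + 1) (n + 1 + 1) x)).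
  have cx : cocycle (p n \o s n : {linear P (n + 1) -> C n}).
    apply: cocycle_succ => x /=; rewrite -sE; have [_ ei _] := pi0 n.
    by apply/ei; exists (chi n x).
  have [F [f [y [w [fF cy E]]]]] := fp_factor cc cP qe cx.
  have [g gE] := proj2 (pp n) F fF f; have [_ _ sp] := pi0 n.
  have [w' w'E] := cofib_proj cP sp w.
  exists (g \o y), w'; split=> [j x|x] /=; first by rewrite cy linear0.
  by rewrite gE w'E -E.
pose y n := sval (cid (ex n)); pose w n := sval (cid (svalP (cid (ex n)))).
have ywE n : cocycle (y n) /\ forall x, p n (s n x) = p n (y n x) + p n (w n (cd P (n + 1) (n + 1 + 1) x)).
  exact: (svalP (cid (svalP (cid (ex n))))).
have ha n : exists k : {linear P (n + 1) -> A n},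
    forall x, i n (k x) = s n x - y n x - w n (cd P (n + 1) (n + 1 + 1) x).
  have [ii ei _] := pi0 n.
  apply: (inj_lift (f := (s n \- y n \- (w n \o cd P (n + 1) (n + 1 + 1)))%R)) => // x.
  by apply/ei; rewrite /= !linearB (proj2 (ywE n)); zmod.
pose k n := sval (cid (ha n)).
have kE n x : i n (k n x) = s n x - y n x - w n (cd P (n + 1) (n + 1 + 1) x).
  by rewrite /k; case: cid x.
apply: (dcomp_qisI qe); rewrite chiE dcomp0; apply: dmap_htpy; apply/zhtpyP => //.
exists k => n x; rewrite subr0; have [ii _ _] := pi0 n.
apply/eqP; rewrite -subr_eq0; apply/eqP; apply: ii.
by rewrite linearB kE sE cdd linear0 (proj1 (ywE n)); zmod.
Qed.
End PureExact.

(** * Functors on the compact objects *)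

Section AddFunctors.
Variable C : preadd.
Implicit Types F G H : addfun C.

Lemma fmap0 F (a b : C) (u : phom a b) : fmap u (ab0 : F b) = ab0.
Proof. by apply: ab_idem; rewrite -fmapD abD0. Qed.
Lemma fmap_zero F (a b : C) (x : F b) : fmap (ab0 : phom a b) x = ab0.
Proof. by apply: ab_idem; rewrite -fmap_add abD0. Qed.
Lemma nt0 F G (t : nat_trans F G) a : t a ab0 = ab0.
Proof. by apply: ab_idem; rewrite -ntD abD0. Qed.
Lemma ntN F G (t : nat_trans F G) a x : t a (abN x) = abN (t a x).
Proof. by apply: abN_uniq; rewrite -ntD abDN nt0. Qed.
Lemma fmapN F (a b : C) (u : phom a b) (x : F b) : fmap u (abN x) = abN (fmap u x).
Proof. by apply: abN_uniq; rewrite -fmapD abDN fmap0. Qed.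

Lemma fmap_sum F (a b : C) (u : phom a b) (I : Type) (s : seq I) (x : I -> F b) :
  fmap u (\big[@abD _/ab0]_(i <- s) x i) = \big[@abD _/ab0]_(i <- s) fmap u (x i).
Proof. by elim: s => [|i s IH]; rewrite ?big_nil ?fmap0 // !big_cons fmapD IH. Qed.
Lemma nt_sum F G (t : nat_trans F G) a (I : Type) (s : seq I) (x : I -> F a) :
  t a (\big[@abD _/ab0]_(i <- s) x i) = \big[@abD _/ab0]_(i <- s) t a (x i).
Proof. by elim: s => [|i s IH]; rewrite ?big_nil ?nt0 // !big_cons ntD IH. Qed.

Lemma nt_ext F G (s t : nat_trans F G) : (forall a x, s a x = t a x) -> s = t.
Proof.
case: s t => [s sD sn] [t tD tn] /= e.
have {}e : s = t by apply: functional_extensionality_dep => a; apply/funext => x.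
by case: t / e tD tn => tD tn; rewrite (Prop_irrelevance sD tD) (Prop_irrelevance sn tn).
Qed.

Definition nt_id F : nat_trans F F := @NatTrans C F F (fun a x => x) (fun _ _ _ => erefl) (fun _ _ _ _ => erefl).

Definition nt_comp F G H (s : nat_trans F G) (t : nat_trans G H) : nat_trans F H.
Proof.
exists (fun a x => t a (s a x)) => [a x y|a b u x]; first by rewrite !ntD.
by rewrite !nt_nat.
Defined.

Definition nt_zero F G : nat_trans F G.
Proof.
exists (fun a x => ab0) => [a x y|a b u x]; first by rewrite abD0.
by rewrite fmap0.
Defined.

Definition nt_opp F G (s : nat_trans F G) : nat_trans F G.
Proof.
exists (fun a x => abN (s a x)) => [a x y|a b u x]; last by rewrite nt_nat fmapN.
by apply/esym/abN_uniq; rewrite ntD abDACA !abDN abD0.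
Defined.
End AddFunctors.

Section Coproduct.
Variable T : preadd.
Variables (I : Type) (X : I -> T) (S : T) (iota : forall i, phom (X i) S).
Hypotheses (cop : is_coproduct iota) (cX : forall i, compact (X i)).

Definition cpt (i : I) : compacts T := exist (@compact T) (X i) (@cX i).

Lemma compact_sum (c : compacts T) (x : @yoneda T S c) :
  exists (g : forall i, phom c (cpt i)) (s : seq {classic I}),
    [/\ uniq s, forall i : {classic I}, i \notin s -> g i = ab0 &
        x = \big[@abD _/ab0]_(i <- s) fmap (g i) (iota i : @yoneda T S (cpt i))].
Proof. by have [g [/is_sum_ofP[s [h1 h2 h3]] _]] := svalP c _ _ _ _ cop x; exists g, s. Qed.

Lemma nt_determined (G : addfun (compacts T)) (t t' : nat_trans (yoneda S) G) :
  (forall i, t (cpt i) (iota i) = t' (cpt i) (iota i)) -> forall c x, t c x = t' c x.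
Proof.
move=> e c x; have [g [s [_ _ ->]]] := compact_sum x.
by rewrite !nt_sum; apply: eq_bigr => i _; rewrite !nt_nat e.
Qed.

(** For compact summands [y] turns the coproduct into a coproduct of representables, so the Yoneda
    lemma applies to each of them. *)
Lemma yoneda_extend (F : addfun (compacts T)) (xi : forall i, F (cpt i)) :
  exists u : nat_trans (yoneda S) F, forall i, u (cpt i) (iota i) = xi i.
Proof.
pose g c x := sval (cid (@compact_sum c x)).
pose s c x := sval (cid (svalP (cid (@compact_sum c x)))).
have gsE c x : [/\ uniq (s c x), forall i : {classic I}, i \notin s c x -> g c x i = ab0 &
        x = \big[@abD _/ab0]_(i <- s c x) fmap (g c x i) (iota i : @yoneda T S (cpt i))].
  exact: (svalP (cid (svalP (cid (@compact_sum c x))))).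
pose u c (x : @yoneda T S c) : F c := \big[@abD _/ab0]_(i <- s c x) fmap (g c x i) (xi i).
have uE c (h : forall i, phom c (cpt i)) (r : seq {classic I}) : uniq r ->
    (forall i : {classic I}, i \notin r -> h i = ab0) ->
    u c (\big[@abD _/ab0]_(i <- r) fmap (h i) (iota i : @yoneda T S (cpt i))) =
    \big[@abD _/ab0]_(i <- r) fmap (h i) (xi i).
  move=> ur zr; set x := \big[_/_]_(i <- r) _; have [us zs xE] := gsE c x.
  (* The uniqueness in the definition of [compact] makes the value independent of the
     decomposition. *)
  have eh : h = g c x.
    have [k [_ ku]] := svalP c _ _ _ _ cop x.
    have <- : k = h by apply: ku; apply/is_sum_ofP; exists r.
    by apply: ku; apply/is_sum_ofP; exists (s c x).
  rewrite {}eh in zr *.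
  apply: big_supp => // i; first by move/zs ->; rewrite fmap_zero.
  by move/zr ->; rewrite fmap_zero.
have uD c x y : u c (abD x y) = abD (u c x) (u c y).
  pose r := undup (s c x ++ s c y); have ur : uniq r by apply: undup_uniq.
  have rep z : (forall i, i \notin r -> i \notin s c z) ->
      exists2 h : (forall i, phom c (cpt i)), forall i : {classic I}, i \notin r -> h i = ab0 &
      z = \big[@abD _/ab0]_(i <- r) fmap (h i) (iota i : @yoneda T S (cpt i)).
    have [uz zz zE] := gsE c z => rz; exists (g c z) => [i /rz /zz //|].
    rewrite [LHS]zE; apply: big_supp => // i; first by move/zz ->; rewrite fmap_zero.
    by move=> /rz /zz ->; rewrite fmap_zero.
  have [|hx zx xE] := rep x; first by move=> i; rewrite mem_undup mem_cat negb_or => /andP[].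
  have [|hy zy yE] := rep y; first by move=> i; rewrite mem_undup mem_cat negb_or => /andP[].
  clearbody r.
  have sumD (F' : addfun (compacts T)) (z : forall i, F' (cpt i)) :
      abD (\big[@abD _/ab0]_(i <- r) fmap (hx i) (z i)) (\big[@abD _/ab0]_(i <- r) fmap (hy i) (z i)) =
      \big[@abD _/ab0]_(i <- r) fmap (abD (hx i) (hy i)) (z i).
    by rewrite -big_split; apply: eq_bigr => i _; rewrite fmap_add.
  by rewrite xE yE (sumD (yoneda S)) !uE // => i ir; rewrite zx // zy // abD0.
have uN a b (f : phom a b) x : u a (fmap f x) = fmap f (u b x).
  have [ux zx xE] := gsE b x; rewrite [u b x]/u.
  move: (g b x) (s b x) ux zx xE => h r ur zr ->.
  have comp (F' : addfun (compacts T)) (z : forall i, F' (cpt i)) :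
      fmap f (\big[@abD _/ab0]_(i <- r) fmap (h i) (z i)) =
      \big[@abD _/ab0]_(i <- r) fmap (pcomp f (h i)) (z i).
    by rewrite fmap_sum; apply: eq_bigr => i _; rewrite fmap_comp.
  by rewrite !comp uE // => i /zr ->; apply: (pcomp0r (T := compacts T)).
exists (NatTrans uD uN) => i /=.
pose h j : phom (cpt i) (cpt j) :=
  match pselect (i = j) with left e => eq_rect i (fun k => phom (cpt i) (cpt k)) (pid (cpt i)) j e
  | right _ => ab0 end.
have hi : h i = pid (cpt i).
  by rewrite /h; case: pselect => // e; rewrite (Prop_irrelevance e erefl).
have := uE (cpt i) h [:: (i : {classic I})].
rewrite !big_seq1 hi !fmap1; apply=> // j.
by rewrite inE => /eqP ne; rewrite /h; case: pselect => // e; case: ne.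
Qed.

Lemma yoneda_coprod_projective : fprojective (yoneda S).
Proof.
move=> F G t et v.
pose xi i := sval (cid (et (cpt i) (v (cpt i) (iota i)))).
have xiE i : t (cpt i) (xi i) = v (cpt i) (iota i) by rewrite /xi; case: cid.
have [u uE] := yoneda_extend xi; exists u => a x.
by apply: (nt_determined (t := nt_comp u t)) => i; rewrite /= uE xiE.
Qed.
End Coproduct.

Lemma dep_choice (T : nat -> Type) (good : forall k, T k -> Prop)
    (rel : forall k, T k -> T k.+1 -> Prop) (x0 : T 0%N) :
  good 0%N x0 -> (forall k x, good k x -> exists y, good k.+1 y /\ rel k x y) ->
  exists f : forall k, T k, [/\ f 0%N = x0, forall k, good k (f k) & forall k, rel k (f k) (f k.+1)].
Proof.
move=> g0 step.
pose f := fix f k : {x : T k | good k x} := match k with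
  | 0%N => exist _ x0 g0
  | k'.+1 => let c := cid (step k' _ (svalP (f k'))) in exist _ (sval c) (proj1 (svalP c))
  end.
exists (fun k => sval (f k)); split=> // k; first exact: svalP.
by move=> /=; case: cid => y /= [].
Qed.

(** * Comparison of projective resolutions, for modules and functors alike *)

Section Comparison.
Variables (O : Type) (hom : O -> O -> abgrp) (idm : forall X, hom X X).
Variable comp : forall X Y Z, hom X Y -> hom Y Z -> hom X Z.
Local Notation "f ;; g" := (comp f g) (at level 40, left associativity).
Hypotheses (compA : forall W X Y Z (f : hom W X) (g : hom X Y) (h : hom Y Z), f ;; (g ;; h) = f ;; g ;; h)
  (comp1l : forall X Y (f : hom X Y), idm X ;; f = f)
  (comp1r : forall X Y (f : hom X Y), f ;; idm Y = f)
  (compDl : forall X Y Z (f g : hom X Y) (h : hom Y Z), abD f g ;; h = abD (f ;; h) (g ;; h))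
  (compDr : forall X Y Z (h : hom X Y) (f g : hom Y Z), h ;; abD f g = abD (h ;; f) (h ;; g)).
Variables (zero : O -> Prop) (surj : forall X Y, hom X Y -> Prop)
  (exact : forall X Y Z, hom X Y -> hom Y Z -> Prop) (proj : O -> Prop).
Hypotheses (exact0 : forall X Y Z (f : hom X Y) (g : hom Y Z), exact f g -> f ;; g = ab0)
  (lift_surj : forall P X Y (e : hom X Y) (v : hom P Y), proj P -> surj e -> exists u, u ;; e = v)
  (lift_exact : forall P X Y Z (f : hom X Y) (g : hom Y Z) (v : hom P Y),
     proj P -> exact f g -> v ;; g = ab0 -> exists u, u ;; f = v)
  (zero_hom : forall X Y (f : hom X Y), zero Y -> f = ab0).

Lemma comp0r X Y Z (f : hom X Y) : f ;; (ab0 : hom Y Z) = ab0.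
Proof. by apply: ab_idem; rewrite -compDr abD0. Qed.
Lemma comp0l X Y Z (f : hom Y Z) : (ab0 : hom X Y) ;; f = ab0.
Proof. by apply: ab_idem; rewrite -compDl abD0. Qed.
Lemma compNr X Y Z (f : hom X Y) (g : hom Y Z) : f ;; abN g = abN (f ;; g).
Proof. by apply: abN_uniq; rewrite -compDr abDN comp0r. Qed.
Lemma compNl X Y Z (f : hom X Y) (g : hom Y Z) : abN f ;; g = abN (f ;; g).
Proof. by apply: abN_uniq; rewrite -compDl abDN comp0l. Qed.

Section ChainMaps.
Variables (A : O) (P : nat -> O) (dP : forall k, hom (P k.+1) (P k)) (eP : hom (P 0%N) A).
Variables (B : nat -> O) (dB : forall k, hom (B k.+1) (B k)) (eB : hom (B 0%N) A).
Hypotheses (pP : forall k, proj (P k)) (dP0 : dP 0 ;; eP = ab0)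
  (dPd : forall k, dP k.+1 ;; dP k = ab0).
Hypotheses (sB : surj eB) (xB0 : exact (dB 0) eB) (xB : forall k, exact (dB k.+1) (dB k)).

Lemma chain_lift : exists b : forall k, hom (P k) (B k),
  b 0%N ;; eB = eP /\ forall k, b k.+1 ;; dB k = dP k ;; b k.
Proof.
(* The invariant says that the composite to be lifted next is killed by the differential of [B], or
   by its augmentation. *)
pose good k : hom (P k) (B k) -> Prop := match k with
  | 0%N => fun x => dP 0 ;; (x ;; eB) = ab0
  | k'.+1 => fun x => dP k'.+1 ;; (x ;; dB k') = ab0
  end.
pose rel k (x : hom (P k) (B k)) (y : hom (P k.+1) (B k.+1)) := y ;; dB k = dP k ;; x.
have [x0 x0E] := lift_surj eP (pP 0%N) sB.
have g0 : good 0%N x0 by rewrite /good x0E.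
have step k x : good k x -> exists y, good k.+1 y /\ rel k x y.
  move=> gx; have [y yE] : exists y, y ;; dB k = dP k ;; x.
    case: k x gx => [|k] x gx; first by apply: (lift_exact (pP _) xB0); rewrite -compA.
    by apply: (lift_exact (pP _) (xB k)); rewrite -compA.
  by exists y; split; rewrite /rel //= yE compA dPd comp0l.
by have [b [b0 _ bE]] := dep_choice g0 step; exists b; rewrite b0.
Qed.
End ChainMaps.

(* Lifting the identity of A to maps P -> B -> P gives an endomorphism of P
   that is homotopic to the identity and vanishes in degree n + 1. *)
Theorem resolution_split (A : O) (n : nat) : resolution zero surj exact proj A n ->
  forall (P : nat -> O) (d : forall k, hom (P k.+1) (P k)) (e : hom (P 0%N) A),
  (forall k, proj (P k)) -> surj e -> exact (d 0%N) e -> (forall k, exact (d k.+1) (d k)) ->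
  exists h : hom (P n) (P n.+1), d n ;; h ;; d n = d n.
Proof.
case=> B [dB [eB [pB sB xB0 xB zB]]] P d e pP se xP0 xP.
have d0 := exact0 xP0; have dd k := exact0 (xP k).
have dB0 := exact0 xB0; have dBd k := exact0 (xB k).
have [b [b0 bE]] := chain_lift pP d0 dd sB xB0 xB.
have [a [a0 aE]] := chain_lift pB dB0 dBd se xP0 xP.
(* A chain endomorphism of [P] lifting 0 on [A], hence null-homotopic. The invariant [good] is what
   allows the next component of the homotopy to be lifted. *)
pose ga k := abD (idm (P k)) (abN (b k ;; a k)).
have ga0 : ga 0%N ;; e = ab0.
  by rewrite compDl compNl comp1l -compA a0 b0 abDN.
have gaE k : ga k.+1 ;; d k = d k ;; ga k.
  by rewrite compDl compNl comp1l compDr compNr comp1r -compA aE !compA bE.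
pose good k (h : hom (P k) (P k.+1)) := abD (ga k.+1) (abN (d k ;; h)) ;; d k = ab0.
have [h0 h0E] := lift_exact (pP _) xP0 ga0.
have g0 : good 0%N h0.
  by rewrite /good compDl compNl -compA h0E gaE abDN.
have step k h : good k h -> exists h', good k.+1 h' /\ True.
  move=> gh; have [h' h'E] := lift_exact (pP _) (xP k) gh; exists h'; split=> //.
  rewrite /good compDl compNl gaE -compA h'E compDr compNr [_ ;; (d k ;; h)]compA dd.
  by rewrite comp0l abN0 abD0 abDN.
have [h [_ gh _]] := dep_choice g0 step.
(* In degree n + 1 the term of [B] is zero, so [ga] is the identity there and the invariant at [n]
   becomes d h d = d. *)
exists (h n); have := gh n; rewrite /good compDl compNl => /abB_eq0 <-.
have -> : ga n.+1 = idm (P n.+1); last by rewrite comp1l.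
by rewrite /ga (zero_hom (b n.+1)) ?comp0l ?abN0 ?abD0 //; apply: zB.
Qed.
End Comparison.

Section FunctorResolutions.
Variable C : preadd.
Implicit Types F G H : addfun C.

Definition nt_add F G (s t : nat_trans F G) : nat_trans F G.
Proof.
exists (fun a x => abD (s a x) (t a x)) => [a x y|a b u x]; first by rewrite !ntD abDACA.
by rewrite !nt_nat fmapD.
Defined.

Definition nt_grp F G : abgrp.
Proof.
apply: (@AbGrp (nat_trans F G) (nt_zero F G) (@nt_opp C F G) (@nt_add F G)).
- by move=> s t u; apply: nt_ext => a x; apply: abDA.
- by move=> s t; apply: nt_ext => a x; apply: abDC.
- by move=> s; apply: nt_ext => a x; apply: abD0.
- by move=> s; apply: nt_ext => a x; apply: abDN.
Defined.

Section Kernel.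
Variables (G H : addfun C) (t : nat_trans G H).

Definition ker_car (a : C) := {x : G a | t a x = ab0}.

Lemma ker_eq a (x y : ker_car a) : sval x = sval y -> x = y.
Proof. by case: x y => [x p] [y q] /= e; apply: eq_exist. Qed.

Fact kerD a (x y : ker_car a) : t a (abD (sval x) (sval y)) = ab0.
Proof. by rewrite ntD (svalP x) (svalP y) abD0. Qed.
Fact kerN a (x : ker_car a) : t a (abN (sval x)) = ab0.
Proof. by rewrite ntN (svalP x) abN0. Qed.

Definition ker_ob (a : C) : abgrp.
Proof.
apply: (@AbGrp (ker_car a) (exist _ _ (nt0 t a)) (fun x => exist _ _ (kerN x))
  (fun x y => exist _ _ (kerD x y))).
- by move=> x y z; apply: ker_eq; apply: abDA.
- by move=> x y; apply: ker_eq; apply: abDC.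
- by move=> x; apply: ker_eq; apply: abD0.
- by move=> x; apply: ker_eq; apply: abDN.
Defined.

Fact ker_map_sub a b (u : phom a b) (x : ker_car b) : t a (fmap u (sval x)) = ab0.
Proof. by rewrite nt_nat (svalP x) fmap0. Qed.

Definition ker_map a b (u : phom a b) (x : ker_ob b) : ker_ob a :=
  exist _ (fmap u (sval (x : ker_car b))) (ker_map_sub u x) : ker_car a.

Definition ker_fun : addfun C.
Proof.
apply: (@AddFun C ker_ob ker_map).
- by move=> a b u x y; apply: ker_eq; apply: fmapD.
- by move=> a b u v x; apply: ker_eq; apply: fmap_add.
- by move=> a x; apply: ker_eq; apply: fmap1.
- by move=> a b c u v x; apply: ker_eq; apply: fmap_comp.
Defined.

Lemma ker_corestr F (s : nat_trans F G) : (forall a x, t a (s a x) = ab0) ->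
  exists s' : nat_trans F ker_fun, forall a x, sval (s' a x : ker_car a) = s a x.
Proof.
move=> ts; pose f a (x : F a) : ker_fun a := exist _ (s a x) (ts a x).
have fD a (x y : F a) : f a (abD x y) = abD (f a x) (f a y).
  by apply: ker_eq; apply: ntD.
have fN a b (u : phom a b) x : f a (fmap u x) = fmap u (f b x).
  by apply: ker_eq; apply: nt_nat.
by exists (NatTrans fD fN).
Qed.
End Kernel.

Lemma fproj_lift P F G H (f : nat_trans F G) (g : nat_trans G H) (v : nat_trans P G) :
  fprojective P -> fexact f g -> (forall a x, g a (v a x) = ab0) ->
  exists u : nat_trans P F, forall a x, f a (u a x) = v a x.
Proof.
move=> pP fg gv; have [v' v'E] := ker_corestr gv.
have gf a x : g a (f a x) = ab0 by apply/fg; exists x.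
have [f' f'E] := ker_corestr gf.
have ef : fepi f'.
  move=> a [y gy]; have /fg[x xE] := gy; exists x.
  by apply: ker_eq; rewrite f'E.
have [u uE] := pP _ _ f' ef v'; exists u => a x.
by rewrite -f'E uE v'E.
Qed.

Theorem fresolution_split (A : addfun C) (n : nat) :
  resolution (@fzero C) (@fepi C) (@fexact C) (@fprojective C) A n ->
  forall (P : nat -> addfun C) (d : forall k, nat_trans (P k.+1) (P k)) (e : nat_trans (P 0%N) A),
  (forall k, fprojective (P k)) -> fepi e -> fexact (d 0%N) e -> (forall k, fexact (d k.+1) (d k)) ->
  exists h : nat_trans (P n) (P n.+1), forall a x, d n a (h a (d n a x)) = d n a x.
Proof.
move=> rA P d e pP ee xe xd.
have [|||||||||h hE] := @resolution_split (addfun C) nt_grp (@nt_id C) (@nt_comp C) _ _ _ _ _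
  (@fzero C) (@fepi C) (@fexact C) (@fprojective C) _ _ _ _ A n rA P d e pP ee xe xd.
- by move=> W X Y Z f g h; apply: nt_ext.
- by move=> X Y f; apply: nt_ext.
- by move=> X Y f; apply: nt_ext.
- by move=> X Y Z f g h; apply: nt_ext => a x; apply: ntD.
- by move=> X Y Z h f g; apply: nt_ext.
- by move=> X Y Z f g fg; apply: nt_ext => a x; apply/fg; exists x.
- by move=> Q X Y f v pQ ef; have [u uE] := pQ _ _ f ef v; exists u; apply: nt_ext.
- move=> Q X Y Z f g v pQ fg vg; have [|u uE] := fproj_lift (v := v) pQ fg.
    by move=> a x; rewrite -[LHS]/(nt_comp v g a x) vg.
  by exists u; apply: nt_ext.
- by move=> X Y f zY; apply: nt_ext => a x; apply: zY.
by exists h => a x; move/(congr1 (fun t : nat_trans _ _ => t a x)): hE.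
Qed.

Lemma fproj_retract (P P' : addfun C) (r : nat_trans P P') (s : nat_trans P' P) :
  (forall a x, r a (s a x) = x) -> fprojective P -> fprojective P'.
Proof.
move=> rs pP F G t et v; have [u uE] := pP F G t et (nt_comp r v).
by exists (nt_comp s u) => a x; rewrite /= uE /= rs.
Qed.
End FunctorResolutions.

Section ModuleResolutions.
Variable R : pzRingType.
Implicit Types X Y Z P : rmod R.

Definition mgrp X Y : abgrp.
Proof.
apply: (@AbGrp (mhom X Y) (\0 : {linear X -> Y})%R (fun f => (\- f : {linear X -> Y})%R)
  (fun f g => (f \+ g : {linear X -> Y})%R)).
- by move=> f g h; apply: lin_ext => x /=; rewrite addrA.
- by move=> f g; apply: lin_ext => x /=; rewrite addrC.
- by move=> f; apply: lin_ext => x /=; rewrite addr0.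
- by move=> f; apply: lin_ext => x /=; rewrite addrN.
Defined.

Lemma mproj_lift P X Y Z (f : mhom X Y) (g : mhom Y Z) (v : mhom P Y) :
  mprojective P -> mexact f g -> (forall a, g (v a) = 0) ->
  exists u : mhom P X, forall a, f (u a) = v a.
Proof.
move=> pP fg gv; pose K : rmod R := smod (ker_subm g).
pose f' : mhom X K := slift (ker_subm g) (fun x => proj2 (fg (f x)) (ex_intro _ x erefl)).
have sf : msurj f'.
  by move=> y; have /fg[x xE] := sincP y; exists x; apply: sinc_inj; rewrite -xE.
have [u uE] := pP _ _ f' sf (slift (ker_subm g) gv); exists u => a.
by rewrite -[LHS]/(sinc (ker_subm g) (f' (u a))) uE.
Qed.

Theorem mresolution_split (A : rmod R) (n : nat) :
  resolution (@mzero R) (@msurj R) (@mexact R) (@mprojective R) A n ->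
  forall (P : nat -> rmod R) (d : forall k, mhom (P k.+1) (P k)) (e : mhom (P 0%N) A),
  (forall k, mprojective (P k)) -> msurj e -> mexact (d 0%N) e -> (forall k, mexact (d k.+1) (d k)) ->
  exists h : mhom (P n) (P n.+1), forall x, d n (h (d n x)) = d n x.
Proof.
move=> rA P d e pP ee xe xd.
have [|||||||||h hE] := @resolution_split (rmod R) mgrp (fun X => idfun : {linear X -> X})
  (fun X Y Z f g => g \o f : {linear X -> Z}) _ _ _ _ _
  (@mzero R) (@msurj R) (@mexact R) (@mprojective R) _ _ _ _ A n rA P d e pP ee xe xd.
- by move=> W X Y Z f g h; apply: lin_ext.
- by move=> X Y f; apply: lin_ext.
- by move=> X Y f; apply: lin_ext.
- by move=> X Y Z f g h; apply: lin_ext => x /=; rewrite linearD.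
- by move=> X Y Z h f g; apply: lin_ext.
- by move=> X Y Z f g fg; apply: lin_ext => x; apply/fg; exists x.
- by move=> Q X Y f v pQ ef; have [u uE] := pQ _ _ f ef v; exists u; apply: lin_ext.
- move=> Q X Y Z f g v pQ fg vg; have [|u uE] := mproj_lift (v := v) pQ fg.
    by move=> x; rewrite -[LHS]/((g \o v : {linear Q -> Z}) x) vg.
  by exists u; apply: lin_ext.
- by move=> X Y f zY; apply: lin_ext => x; apply: zY.
by exists h => x; move/(congr1 (fun t : mhom _ _ => t x)): hE.
Qed.

Lemma mproj_retract P P' (r : mhom P P') (s : mhom P' P) :
  (forall x, r (s x) = x) -> mprojective P -> mprojective P'.
Proof.
move=> rs pP X Y g sg v; have [u uE] := pP X Y g sg (v \o r).
by exists (u \o s) => a; rewrite /= uE /= rs.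
Qed.
End ModuleResolutions.

Lemma einf_some (Q : nat -> Prop) n : einf Q = Some n -> Q n.
Proof.
by rewrite /einf; case: pselect => // ex [<-]; case: ex_minnP => m /asboolP.
Qed.

Lemma split_section (R : pzRingType) (K Q M : rmod R) (i : mhom K Q) (p : mhom Q M)
    (r : mhom Q K) :
  mexact i p -> msurj p -> (forall y, r (i y) = y) -> exists s : mhom M Q, forall y, p (s y) = y.
Proof.
move=> xip sp rK; have pi y : p (i y) = 0 by apply/xip; exists y.
have [s sE] : exists s : mhom M Q, forall x, s (p x) = x - i (r x).
  apply: (surj_desc (f := (idfun \- (i \o r))%R)) => // x /xip[y <-] /=.
  by rewrite rK subrr.
exists s => y; have [x <-] := sp y.
by rewrite sE linearB pi subr0.
Qed.

Lemma ker_ses (R : pzRingType) (Q M : rmod R) (p : mhom Q M) :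
  minj (sinc (ker_subm p)) /\ mexact (sinc (ker_subm p)) p.
Proof.
split; first by move=> x x0; apply: sinc_inj; rewrite linear0.
move=> y; split=> [/(sinc_ex (ker_subm p))[u <-]|[x <-]]; first by exists u.
exact: (sincP x).
Qed.

(** Dependent choice for infinite resolutions cut into short sequences, with [good] the property
    inherited by syzygies. It serves both finitely generated free covers and pure covers. *)
Lemma syzygies (R : pzRingType) (good : rmod R -> Prop)
    (S : forall K Q M : rmod R, mhom K Q -> mhom Q M -> Prop) :
  (forall M, good M -> exists K Q (i : mhom K Q) (p : mhom Q M), good K /\ S _ _ _ i p) ->
  forall F, good F -> exists (M Q : nat -> rmod R) (i : forall k, mhom (M k.+1) (Q k))
    (p : forall k, mhom (Q k) (M k)), M 0%N = F /\ forall k, S _ _ _ (i k) (p k).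
Proof.
move=> step F gF.
pose T := {M | good M}.
pose D (M : T) := {K : T & {Q : rmod R & {i : mhom (sval K) Q & {p : mhom Q (sval M) | S _ _ _ i p}}}}.
have next (M : T) : D M.
  have [K /cid[Q /cid[i /cid[p [gK Sip]]]]] := cid (step _ (svalP M)).
  by exists (exist _ K gK), Q, i, p.
pose t := fix t k : T := if k is k'.+1 then projT1 (next (t k')) else exist _ F gF.
exists (fun k => sval (t k)), (fun k => projT1 (projT2 (next (t k)))).
exists (fun k => projT1 (projT2 (projT2 (next (t k))))).
exists (fun k => sval (projT2 (projT2 (projT2 (next (t k)))))).
by split=> // k; apply: (svalP (projT2 (projT2 (projT2 (next (t k)))))).
Qed.

(** * Finitely presented modules as compact objects *)

Section FiniteResolutions.
Variable R : pzRingType.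
Implicit Types M F Q : rmod R.
Lemma rV0_zero (x : 'rV[R^c]_0) : x = 0.
Proof. exact: thinmx0. Qed.
Lemma rV_fg k : fin_gen ('rV[R^c]_k : rmod R).
Proof. by exists k, idfun => x; exists x. Qed.

Hypothesis coh : coherent R.

(** The kernel of [p] is the image of [r], so its relations are the kernel of [r], which coherence
    makes finitely generated. *)
Lemma fp_syz F : fin_pres F -> exists m (p : mhom 'rV[R^c]_m F),
  msurj p /\ fin_pres (smod (ker_subm p)).
Proof.
case=> m [n [r [p [rp sp]]]]; exists n, p; split=> //.
have fK : fin_pres (smod (ker_subm r)).
  have := @coh 'rV[R^c]_m 'rV[R^c]_n r (smod (ker_subm r)) (sinc (ker_subm r))
    (@rV_projective R m) (rV_fg m) (@rV_projective R n) (rV_fg n).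
  move=> h; refine (h _ _).
    by move=> x x0; apply: sinc_inj; rewrite linear0.
  by move=> y; split=> [/(sinc_ex (ker_subm r))[x xE]|[x <-]]; [exists x | apply: (sincP x)].
have [l [q sq]] := fp_fg fK.
pose r' : mhom 'rV[R^c]_m (smod (ker_subm p)) :=
  slift (ker_subm p) (fun x => proj2 (rp (r x)) (ex_intro _ x erefl)).
have r'E x : sinc (ker_subm p) (r' x) = r x by [].
exists l, m, (sinc (ker_subm r) \o q), r'; split.
  move=> y; split=> [y0|[x <-]].
    have [|z zE] := sinc_ex (ker_subm r) (x := y); first by rewrite -r'E y0 linear0.
    by have [x xE] := sq z; exists x; rewrite /= xE.
  by apply: sinc_inj; rewrite r'E linear0 (sincP (q x)).
move=> y; have /rp[x xE] := sincP y; exists x.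
by apply: sinc_inj; rewrite r'E.
Qed.

Definition fgproj Q := mprojective Q /\ fin_gen Q.

Lemma rV_fgproj k : fgproj 'rV[R^c]_k.
Proof. by split; [apply: rV_projective | apply: rV_fg]. Qed.

Local Notation fgres := (resolution (@mzero R) (@msurj R) (@mexact R) fgproj).

Lemma fgres0 Q : fgproj Q -> fgres Q 0.
Proof.
move=> pQ; pose PP k : rmod R := if k is 0%N then Q else 'rV[R^c]_0.
exists PP, (fun k => (\0 : {linear PP k.+1 -> PP k})%R), idfun; split.
- by case=> [|k] //; apply: rV_fgproj.
- by move=> x; exists x.
- by move=> x; split=> [/= ->|[y <-]] //; exists 0.
- move=> k x; split=> // _; exists 0; rewrite linear0; exact/esym/rV0_zero.
- by case=> // k _ x; apply: rV0_zero.
Qed.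

Lemma fgres_cons K Q M (i : mhom K Q) (p : mhom Q M) n : fgproj Q -> minj i -> mexact i p ->
  msurj p -> fgres K n -> fgres M n.+1.
Proof.
move=> pQ ii xip sp [P [d [e [pP se x0 xk z]]]].
pose PP k : rmod R := if k is k'.+1 then P k' else Q.
pose dd k : mhom (PP k.+1) (PP k) := match k return mhom (PP k.+1) (PP k) with
  | 0%N => (i \o e : {linear P 0%N -> Q}) | k'.+1 => d k' end.
exists PP, dd, p; split=> //.
- by case.
- move=> y; rewrite xip; split=> [[u <-]|[x <-]]; last by exists (e x).
  by have [x xE] := se u; exists x; rewrite /= xE.
- case=> [|k] //= y; rewrite -x0; split=> [h|h]; last by rewrite -[LHS]/(i (e y)) h linear0.
  exact: ii.
- by case=> // k; apply: z.
Qed.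

(** The finite projective resolution need not be finitely generated, and the one by finite free
    modules need not be finite. Comparing them makes the n-th syzygy of the latter a summand of a
    finite free module, where it can be cut off. *)
Lemma fp_fgres F : fin_pres F -> (exists n, pdim F = Some n) -> exists n, fgres F n.
Proof.
move=> fF [n /einf_some rF].
have [|M [Q [i [p [MF ipE]]]]] := @syzygies R (@fin_pres R)
  (fun K Q M i p => [/\ fgproj Q, minj i, mexact i p & msurj p]) _ F fF.
  move=> M /fp_syz[m [p [sp fK]]]; have [ii xip] := ker_ses p.
  exists (smod (ker_subm p)), 'rV[R^c]_m, (sinc (ker_subm p)), p.
  by split=> //; split=> //; apply: rV_fgproj.
case: F / MF fF rF => _ rF.
have pQ k : fgproj (Q k) by case: (ipE k).
have sp k : msurj (p k) by case: (ipE k).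
have ii k : minj (i k) by case: (ipE k).
have xip k : mexact (i k) (p k) by case: (ipE k).
pose d k : mhom (Q k.+1) (Q k) := i k \o p k.+1.
have xpd k : mexact (d k) (p k).
  move=> x; rewrite xip; split=> [[u <-]|[y <-]]; last by exists (p k.+1 y).
  by have [y yE] := sp k.+1 u; exists y; rewrite /d /= yE.
have xdd k : mexact (d k.+1) (d k).
  move=> y; rewrite -xpd /d /=; split=> [|->]; [exact: ii | exact: linear0].
have [h hE] := mresolution_split rF (fun k => proj1 (pQ k)) (sp 0%N) (xpd 0%N) xdd.
have [s sE] : exists s : mhom (M n) (Q n), forall y, p n (s y) = y.
  (* As d = i p with [i] injective and [p] surjective, d h d = d says that p h is a retraction of
     [i]. *)
  apply: (split_section (r := p n.+1 \o h) (xip n) (sp n)) => y.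
  have [x <-] := sp n.+1 y; apply/eqP; rewrite -subr_eq0; apply/eqP/(ii n).
  by rewrite linearB; apply/eqP; rewrite subr_eq0; apply/eqP/(hE x).
have r0 : fgres (M n) 0.
  apply: fgres0; split; first by apply: (mproj_retract sE); case: (pQ n).
  have [m [q sq]] := proj2 (pQ n); exists m, (p n \o q) => y.
  have [x <-] := sp n y; have [z <-] := sq x; by exists z.
have rj : forall j m, fgres (M j) m -> exists m', fgres (M 0%N) m'.
  elim=> [|j IH] m rj; first by exists m.
  exact: IH (fgres_cons (pQ j) (ii j) (xip j) (sp j) rj).
exact: rj r0.
Qed.
End FiniteResolutions.

Section PerfectComplex.
Variables (R : pzRingType) (F : rmod R) (T : nat -> rmod R).
Variables (d : forall m, mhom (T m.+1) (T m)) (e : mhom (T 0%N) F) (N : nat).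
Hypotheses (pT : forall m, fgproj (T m)) (se : msurj e) (xe : mexact (d 0%N) e)
  (xd : forall m, mexact (d m.+1) (d m)) (zT : forall m, (N < m)%N -> mzero (T m)).

(* The resolution, reindexed by a : int with zeros in negative positions; the
   complex has the term of index k - n in degree n. *)
Definition zob (a : int) : rmod R := if a is Posz m then T m else 'rV[R^c]_0.

Definition zd (a b : int) : {linear zob a -> zob b} :=
  match a, b return {linear zob a -> zob b} with
  | Posz m, Posz l => d l \o tr T m l.+1
  | _, _ => \0%R
  end.

Definition zeps (a : int) : {linear zob a -> F} :=
  match a return {linear zob a -> F} with Posz 0 => e | _ => \0%R end.

Lemma zd_shape a b x : b + 1 != a -> zd a b x = 0.
Proof.
case: a b x => [m|m] [l|l] x //= ne; rewrite tr_ne ?linear0 //.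
by apply: contraNneq ne => ->; lia.
Qed.

Lemma zdd a b c x : zd b c (zd a b x) = 0.
Proof.
case: a b c x => [m|m] [l|l] [j|j] x //=; rewrite ?linear0 //.
have [el|ne] := eqVneq l j.+1; last by rewrite [tr _ _ _ _]tr_ne ?linear0.
by subst l; rewrite trE; apply/xd; exists (tr T m j.+2 x).
Qed.

Lemma zeps_d a b x : zeps b (zd a b x) = 0.
Proof.
case: a b x => [m|m] [[|l]|l] x //=; rewrite ?linear0 //.
by apply/xe; exists (tr T m 1%N x).
Qed.

Lemma zd_exact a x : zeps a x = 0 -> (forall b, zd a b x = 0) -> exists b y, zd b a y = x.
Proof.
case: a x => [[|m]|m] x /= ex dx.
- by have /xe[y <-] := ex; exists 1, y; rewrite /= trE.
- have := dx (Posz m); rewrite /= trE => /xd[y <-].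
  by exists (Posz m.+2), y; rewrite /= trE.
- exists 0, 0; rewrite linear0; exact/esym/rV0_zero.
Qed.

Lemma zeps_surj a y : a = 0 -> exists x, zeps a x = y /\ forall b, zd a b x = 0.
Proof.
move=> ->; have [x xE] := se y; exists x; split=> // -[l|l] //=.
by rewrite tr_ne ?linear0.
Qed.

Variable k : int.

Definition perf : cpx R.
Proof.
apply: (@Cpx R (fun n => zob (k - n)) (fun i j => zd (k - i) (k - j))).
- move=> i j x ne; apply: zd_shape; apply: contra ne => /eqP ne; apply/eqP; lia.
- by move=> a b c x; apply: zdd.
Defined.

Lemma perf_cofib : cofib perf.
Proof.
apply: (@bounded_cofib R perf k) => n.
  move=> kn x; have : k - n < 0 by lia.
  by move: x => /=; case: (k - n) => // m x _; apply: rV0_zero.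
by rewrite /=; case: (k - n) => [m|m]; [case: (pT m) | apply: rV_projective].
Qed.

Lemma perf_compact : @compact (derived R) perf.
Proof.
(* The nonzero terms lie in degrees k - N to k. *)
apply: (@perfect_compact R perf (N + `|k|%N)%N perf_cofib) => n.
  move=> kn x; have : (N%:Z < k - n) || (k - n < 0) by lia.
  move: x => /=; case: (k - n) => [m|m] x; last by move=> _; apply: rV0_zero.
  by rewrite orbF ltz_nat => nm; apply: (zT nm).
by rewrite /=; case: (k - n) => [m|m]; [case: (pT m) | apply: rV_fg].
Qed.

Lemma perf_cycle n (x : perf n) : cycle x -> forall b, zd (k - n) b x = 0.
Proof.
move=> cx b; have [i ei] : exists i, b = k - i by exists (k - b); lia.
by rewrite ei; exact: (cx i).
Qed.

(* The maps j identify X n with F if n = k, and with 0 if not. *)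
Lemma perf_qis (X : cpx R) (f : cmap perf X) (j : forall n, {linear X n -> F}) :
  zdiff X -> (forall n x, j n (f n x) = zeps (k - n) x) ->
  (forall n, minj (j n)) -> (forall n y, n <> k -> j n y = 0) -> qis f.
Proof.
move=> zX jf ji j0; split=> n.
  move=> x cx [i [y]]; rewrite zX => f0.
  have [||b [z zE]] := @zd_exact (k - n) x; [|exact: perf_cycle|].
    by rewrite -jf -f0 linear0.
  have [i' ei] : exists i', b = k - i' by exists (k - b); lia.
  by move: z zE; rewrite ei => z zE; exists i', z.
move=> y cy; have [en|ne] := pselect (n = k).
  have [|x [xE dx]] := @zeps_surj (k - n) (j n y); first by lia.
  exists x; split; first by move=> i; apply: dx.
  exists n, 0; rewrite linear0; apply/esym/ji.
  by rewrite linearB jf xE subrr.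
exists 0; split; first by move=> i; rewrite linear0.
exists n, 0; rewrite !linear0 sub0r; apply/esym/ji.
by rewrite linearN (j0 _ _ ne) oppr0.
Qed.

Lemma zeps_ne a x : a <> 0 -> zeps a x = 0.
Proof. by case: a x => [[|m]|m]. Qed.
End PerfectComplex.

Section FpStalks.
Variables (R : pzRingType) (F : rmod R).
Hypothesis rF : exists n, resolution (@mzero R) (@msurj R) (@mexact R) (@fgproj R) F n.

(** [M] in degree [k], built inside the constant family so that comparison with [M] needs no
    transport along n = k. *)
Definition gst (M : rmod R) (k : int) : cpx R := degpart (fun _ => M) k.

Lemma gst_compact k : @compact (derived R) (gst F k).
Proof.
have [N [T [d [e [pT se xe xd zT]]]]] := rF.
pose inc n : {linear gst F k n -> F} := sinc (deg_subm (fun _ => F) k n).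
have inS n x : n = k \/ zeps e (k - n) x = 0.
  by have [|ne] := pselect (n = k); [left | right; apply: zeps_ne; lia].
have [f fE] : exists f : cmap (perf xd k) (gst F k), forall n x, inc n (f n x) = zeps e (k - n) x.
  have [|f fE] := @zmap_ex R (perf xd k) (gst F k)
    (fun n => slift (deg_subm (fun _ => F) k n) (f := zeps e (k - n)) (inS n)) (@gcx_zdiff R _).
    by move=> n x; apply: sinc_inj; rewrite linear0 sinc_lift; apply: zeps_d.
  by exists f => n x; rewrite fE /inc sinc_lift.
have cP := perf_compact pT (xd := xd) zT (k := k).
refine (@compact_qis R _ _ f _ cP).
apply: (perf_qis se xe (xd := xd) (j := inc)) => //.
- by move=> n x x0; apply: sinc_inj; rewrite linear0.
- by move=> n y ne; case: (sincP y).
Qed.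
End FpStalks.

Section Stalks.
Variable R : pzRingType.
Implicit Types A B M F : rmod R.

Lemma stalk_zdiff M : zdiff (stalk M).
Proof. by []. Qed.

Definition stalk_lin A B (f : mhom A B) n : {linear stalk_ob A n -> stalk_ob B n} :=
  match n return {linear stalk_ob A n -> stalk_ob B n} with Posz 0 => f | _ => \0%R end.

Definition stalk_map A B (f : mhom A B) : cmap (stalk A) (stalk B) :=
  @CMap R (stalk A) (stalk B) (stalk_lin f) (fun i j x => linear0 _).

Lemma stalk_out M n (x : stalk_ob M n) : n <> 0 -> x = 0.
Proof. by case: n x => [[|n]|n] x // _; apply: rV0_zero. Qed.

Lemma stalk_map_comp A B M (f : mhom A B) (g : mhom B M) n x :
  cmap_comp (stalk_map f) (stalk_map g) n x = stalk_map (g \o f : {linear A -> M}) n x.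
Proof. by case: n x => [[|n]|n] x. Qed.

Lemma gst_stalk M : exists f : cmap (gst M 0) (stalk M), qis f.
Proof.
pose f n : {linear gst M 0 n -> stalk M n} :=
  match n return {linear gst M 0 n -> stalk M n} with
  | Posz 0 => sinc (deg_subm (fun _ => M) 0 0) | _ => \0%R end.
have [|g gE] := @zmap_ex R (gst M 0) (stalk M) f (@stalk_zdiff M).
  by move=> n x; rewrite linear0.
exists g; apply: bij_qis => n.
  move=> x; rewrite gE; have [n0|ne] := pselect (n = 0); last first.
    by move=> _; apply: sinc_inj; rewrite linear0; case: (sincP x).
  by subst n => h; apply: sinc_inj; rewrite linear0.
move=> y; have [n0|ne] := pselect (n = 0); last by exists 0; rewrite linear0 (stalk_out y ne).
subst n; have [x xE] := sinc_ex (deg_subm (fun _ => M) 0 0) (or_introl erefl : 0 = 0 \/ y = 0).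
by exists x; rewrite gE.
Qed.

Section FullyFaithful.
Variable F : rmod R.
Hypothesis rF : exists n, resolution (@mzero R) (@msurj R) (@mexact R) (@fgproj R) F n.

Lemma stalk_compact : @compact (derived R) (stalk F).
Proof.
have [f qf] := gst_stalk F.
exact: (@compact_qis R _ _ f qf (@gst_compact R F rF 0)).
Qed.

(** The last two properties drive full faithfulness: as the term in degree 1 vanishes, everything in
    degree 0 is a cycle, and the kernel of [e 0] consists of boundaries. *)
Lemma stalk_res : exists (P : cpx R) (e : cmap P (stalk F)),
  [/\ cofib P, qis e, mzero (P 1) & msurj (e 0 : {linear P 0 -> F})].
Proof.
have [N [T [d [e [pT se xe xd zT]]]]] := rF.
pose f n : {linear perf xd 0 n -> stalk F n} := tr (stalk F) 0 n \o (zeps e (0 - n) : {linear perf xd 0 n -> F}).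
have [|g gE] := @zmap_ex R (perf xd 0) (stalk F) f (@stalk_zdiff F).
  by move=> n x; rewrite /f /= [zeps _ _ _](zeps_d xe) linear0.
have qg : qis g.
  apply: (perf_qis se xe (xd := xd) (j := fun n => tr (stalk F) n 0 : {linear stalk F n -> F})) => //.
  - move=> n x; rewrite gE /f /=; have [n0|ne] := eqVneq 0 n.
      by rewrite trK.
    by rewrite zeps_ne ?linear0 //; move/eqP: ne; lia.
  - move=> n x; have [n0|ne] := pselect (n = 0); last by rewrite (stalk_out x ne).
    by subst n; rewrite trE.
  - by move=> n y ne; rewrite (stalk_out y ne) linear0.
exists (perf xd 0), g; split=> //.
- exact: perf_cofib.
- by move=> x; apply: rV0_zero.
move=> y; have [x xE] := se y; exists x.
by rewrite gE /f /= trE.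
Qed.

Lemma stalk_full B (u : dhom (stalk F) (stalk B)) : exists f : mhom F B, u = dmap (stalk_map f).
Proof.
have [P [e [cP qe z1 s0]]] := stalk_res.
have [phi phiE] := dhom_map cP (dmap e ;; u).
have [f fE] : exists f : mhom F B, forall x, f (e 0 x : F) = (phi 0 x : B).
  (* The kernel of [e 0] consists of boundaries, which [phi] kills since the stalk of [B] has no
     differential. *)
  apply: (surj_desc (f := phi 0 : {linear P 0 -> B}) s0) => x ex0.
  have [i [y <-]] : boundary x.
    apply: (proj1 qe); last by exists 0, 0; rewrite linear0.
    by apply: cycle_succ; apply: z1.
  by rewrite cm_d.
exists f; apply: (dcomp_qisI qe); rewrite phiE dmapM; apply: dmap_ext => n x.
have [n0|ne] := pselect (n = 0); last by rewrite [LHS](stalk_out _ ne) [RHS](stalk_out _ ne).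
by subst n; rewrite /= fE.
Qed.

Lemma stalk_faithful B (f : mhom F B) :
  dmap (stalk_map f) = dzero (stalk F) (stalk B) -> forall x, f x = 0.
Proof.
have [P [e [cP qe z1 s0]]] := stalk_res => f0 y; have [x <-] := s0 y.
have [h hE] : htpy (cmap_comp e (stalk_map f)) (cmap_zero P (stalk B)).
  by apply: dmap_cofib => //; rewrite -dmapM f0 dcomp0.
(* Homotopies are indexed one below the degree in question, so -1 stands for degree 0. Both homotopy
   terms vanish: one by the zero differential, the other as the term of [P] in degree 1 is zero. *)
have := hE (-1) x; rewrite (z1 (cd P (-1 + 1) (-1 + 1 + 1) x)) !linear0 !addr0 => h0; exact: h0.
Qed.
End FullyFaithful.
End Stalks.

(** * Pure projective resolutions *)

Section PureProjectives.
Variable R : pzRingType.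
Implicit Types F K M P X Y Z : rmod R.

Lemma pure_ker X Y (p : mhom X Y) : pure_surj p -> pure_ses (sinc (ker_subm p)) p.
Proof.
case=> sp lp; have [ii xip] := ker_ses p; split=> // F fF; split.
- by move=> u fu a; apply: ii.
- move=> v; split=> [pv|[u uE] a]; last by apply/xip; exists (u a).
  by apply: (inj_lift ii) => a; apply/xip.
- exact: lp.
Qed.

Lemma pure_ses_surj X Y Z (f : mhom X Y) (g : mhom Y Z) : pure_ses f g -> pure_surj g.
Proof. by case=> [[_ _ sg]] h; split=> // F /h[]. Qed.

(** Hom is left exact in any case, and every pure epimorphism ends a pure exact sequence that starts
    with its kernel. *)
Lemma pure_projP P :
  pure_projective P <-> forall Y Z (g : mhom Y Z), pure_surj g -> hom_surj P g.
Proof.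
split=> [pP Y Z g /pure_ker/pP[]//|h X Y Z f g pfg].
have [[fi xfg sg] _] := pfg; split.
- by move=> u fu a; apply: fi.
- move=> v; split=> [gv|[u uE] a]; last by apply/xfg; exists (u a).
  by apply: (inj_lift fi) => a; apply/xfg.
- by apply: h; apply: pure_ses_surj pfg.
Qed.

Lemma pure_proj_retract P Q (r : mhom P Q) (s : mhom Q P) :
  (forall x, r (s x) = x) -> pure_projective P -> pure_projective Q.
Proof.
move=> rs /pure_projP pP; apply/pure_projP => Y Z g pg v.
have [u uE] := pP _ _ g pg (v \o r).
by exists (u \o s) => a; rewrite /= uE /= rs.
Qed.

Lemma pure_proj_dsum J (F : J -> rmod R) : (forall j, fin_pres (F j)) -> pure_projective (dsum F).
Proof.
move=> fF; apply/pure_projP => Y Z g [_ lg] v.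
have uj j : exists u : mhom (F j) Y, forall a, g (u a) = v (din j a).
  by apply: (lg _ (fF j) (v \o din j)).
pose u j := sval (cid (uj j)).
have uE j a : g (u j a) = v (din j a) by rewrite /u; case: cid a.
have [h hE] := dsum_out u; exists h.
by apply: (dsum_map_eq (f := g \o h)) => j x /=; rewrite hE uE.
Qed.

Lemma pure_proj0 P : mzero P -> pure_projective P.
Proof.
move=> z; apply/pure_projP => Y Z g _ v; exists (\0)%R => a.
by rewrite (z a) !linear0.
Qed.

(** All finitely presented modules over [M] would form too large an index type; finite presentations
    with a map to [M] form a small one and still reach every such module up to isomorphism. *)
Record presented M := Presented {
  pr_m : nat; pr_n : nat; pr_rel : mhom 'rV[R^c]_pr_m 'rV[R^c]_pr_n;
  pr_map : mhom 'rV[R^c]_pr_n M; pr_mapP : forall x, pr_map (pr_rel x) = 0 }.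

Definition pr_mod M (j : presented M) : rmod R := qmod (im_subm (pr_rel j)).
Definition pr_pi M (j : presented M) : mhom 'rV[R^c]_(pr_n j) (pr_mod j) := qpi (im_subm (pr_rel j)).

Lemma pr_desc M (j : presented M) : exists q : mhom (pr_mod j) M,
  forall x, q (pr_pi j x) = pr_map j x.
Proof.
apply: (surj_desc (p := pr_pi j) (f := pr_map j)); first exact: qpi_surj.
by move=> x /qpi0[y <-]; apply: pr_mapP.
Qed.

Lemma pr_lift M G (v : mhom G M) : fin_pres G -> exists (j : presented M) (s : mhom G (pr_mod j)),
  forall (q : mhom (pr_mod j) M), (forall x, q (pr_pi j x) = pr_map j x) -> forall a, q (s a) = v a.
Proof.
case=> m [n [r [p [xrp sp]]]].
have vpr x : (v \o p : {linear _ -> _}) (r x) = 0.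
  by have /= -> : p (r x) = 0; [apply/xrp; exists x | rewrite linear0].
pose j := @Presented M m n r (v \o p : {linear _ -> _}) vpr; exists j.
have [s sE] : exists s : mhom G (pr_mod j), forall x, s (p x) = pr_pi j x.
  by apply: (surj_desc (f := pr_pi j) sp) => x /xrp xr; apply/qpi0.
by exists s => q qE a; have [x <-] := sp a; rewrite sE qE.
Qed.

Lemma pure_cover M : exists (J : Type) (F : J -> rmod R) (q : mhom (dsum F) M),
  (forall j, fin_pres (F j)) /\ pure_surj q.
Proof.
pose q0 (j : presented M) := sval (cid (pr_desc j)).
have q0E j x : q0 j (pr_pi j x) = pr_map j x by rewrite /q0; case: cid x.
have [q qE] := dsum_out q0.
exists (presented M), (@pr_mod M), q; split; first by move=> j; apply: fp_quot.
have lq : forall G, fin_pres G -> hom_surj G q.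
  move=> G fG v; have [j [s sE]] := pr_lift v fG.
  by exists (din j \o s) => a /=; rewrite qE; apply: sE.
(* Surjectivity is the lifting property for the free module of rank 1. *)
split=> // x; have [f fE] := rv_out (fun _ : 'I_1 => x).
have [u uE] := lq _ (@rV_fp R 1%N) f.
by exists (u (delta_mx 0 0)); rewrite uE fE.
Qed.

Lemma pure_proj_summand P : pure_projective P -> exists (J : Type) (F : J -> rmod R)
  (q : mhom (dsum F) P) (s : mhom P (dsum F)), (forall j, fin_pres (F j)) /\ forall x, q (s x) = x.
Proof.
move=> /pure_projP pP; have [J [F [q [fF pq]]]] := pure_cover P.
have [s sE] := pP _ _ q pq (idfun : {linear P -> P}).
by exists J, F, q, s; split.
Qed.

Lemma pure_exact_mono X Y Z K (f : mhom X Y) (g : mhom Y Z) (p : mhom Y K) (i : mhom K Z) :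
  minj i -> (forall x, i (p x) = g x) -> pure_exact f g -> pure_exact f p.
Proof.
move=> ii ip [xm xh]; have pg y : p y = 0 <-> g y = 0.
  by rewrite -ip; split=> [->|]; [rewrite linear0 | apply: ii].
split=> [y|F fF v]; first by rewrite pg.
by rewrite -(xh F fF v); split=> h a; apply/pg.
Qed.

Lemma ker_pure_surj X Y Z (f : mhom X Y) (g : mhom Y Z) : pure_exact f g ->
  exists p : mhom X (smod (ker_subm g)), pure_surj p /\ forall x, sinc (ker_subm g) (p x) = f x.
Proof.
case=> xfg lfg; have [ii xi] := ker_ses g.
have [p pE] : exists p : mhom X (smod (ker_subm g)), forall x, sinc (ker_subm g) (p x) = f x.
  by apply: (inj_lift ii) => x; apply/xi/xfg; exists x.
exists p; split=> //; split.
  move=> y; have /xfg[x xE] : g (sinc (ker_subm g) y) = 0 by apply/xi; exists y.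
  by exists x; apply: sinc_inj; rewrite pE.
move=> F fF v; have [h _] := lfg F fF (sinc (ker_subm g) \o v).
have [|u uE] := h; first by move=> a; apply/xi; exists (v a).
by exists u => a; apply: sinc_inj; rewrite pE uE.
Qed.
End PureProjectives.

(** * Pure resolutions under [y] *)

Section YonedaResolutions.
Variable R : pzRingType.
Hypothesis fpres : forall F : rmod R, fin_pres F ->
  exists n, resolution (@mzero R) (@msurj R) (@mexact R) (@fgproj R) F n.
Local Notation DT := (derived R).

Definition yon_map (T : preadd) (X Y : T) (u : phom X Y) : nat_trans (yoneda X) (yoneda Y).
Proof.
exists (fun (c : compacts T) (x : @yoneda T X c) => pcomp (x : phom (sval c) X) u : @yoneda T Y c).
- by move=> c x y; apply: pcompDl.
- by move=> a b f x; apply: esym (pcompA _ _ _).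
Defined.

Section GradedSum.
Variables (J : int -> Type) (F : forall n, J n -> rmod R).

Let G : cpx R := gcx (fun n => dsum (@F n)).
Let I := {n : int & J n}.
Let X (i : I) : cpx R := gst (F (projT2 i)) (projT1 i).

Lemma graded_dsum : exists th : cmap (dsumc X) G, qis th.
Proof.
pose gi (i : I) k : {linear X i k -> dsum (@F k)} :=
  tr (fun n => dsum (@F n)) (projT1 i) k \o (din (projT2 i) \o
   sinc (deg_subm (fun _ => F (projT2 i)) (projT1 i) k)).
have gx i : exists g : cmap (X i) G, forall k x, g k x = gi i k x.
  by apply: (@zmap_ex R (X i) G (gi i)) => // k x; rewrite linear0.
pose g i := sval (cid (gx i)).
have gE i : forall k x, g i k x = gi i k x by rewrite /g; case: cid.
have [th thE] := dsumc_out g.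
have outk k (i : I) : projT1 i <> k -> forall x : X i k, x = 0.
  by move=> ne x; apply: sinc_inj; rewrite linear0; case: (sincP x) => // e; case: ne.
have prE k (j : J k) (u : dsumc X k) : dpr j (th k u) =
    sinc (deg_subm (fun _ => F j) k k) (dpr (existT _ k j : I) u).
  apply: (dsum_map_eq (f := dpr j \o th k) (g := sinc (deg_subm (fun _ => F j) k k) \o
     dpr (M := fun i => X i k) (existT _ k j : I))) => -[n i] x /=.
  rewrite thE gE /gi /=; have [en|ne] := pselect (n = k); last first.
    by rewrite [x](outk k (existT _ n i)) // !linear0.
  subst n; rewrite trE; have [e|ne] := pselect (i = j).
    by subst i; rewrite !dpr_in.
  rewrite dpr_in_ne // dpr_in_ne ?linear0 // => e; apply: ne.
  have := projT2_eq e; rewrite (Prop_irrelevance (projT1_eq e) erefl); exact.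
exists th; apply: bij_qis => k.
  move=> u u0; apply: dsum_eq => -[n j]; have [en|ne] := pselect (n = k).
    by subst n; apply: sinc_inj; rewrite -prE u0 !linear0.
  by rewrite [LHS](outk k (existT _ n j)) // [RHS](outk k (existT _ n j)).
apply: dsum_ind.
  split; first by exists 0; rewrite linear0.
  by move=> a x y [u <-] [v <-]; exists (a *: u + v); rewrite linearP.
move=> j x; have [y yE] := sinc_ex (deg_subm (fun _ => F j) k k) (or_introl erefl : k = k \/ x = 0).
exists (din (existT _ k j : I) y); rewrite thE gE /gi /= trE.
by congr (din _ _).
Qed.

Lemma graded_sum_projective : (forall n (j : J n), fin_pres (F j)) -> fprojective (@yoneda DT G).
Proof.
move=> fF; have [th qth] := graded_dsum.
refine (@yoneda_coprod_projective DT I X G _ (coproduct_transfer qth) _).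
by move=> i; apply: gst_compact; apply: fpres; apply: fF.
Qed.
End GradedSum.

(** Degreewise, [X] is a retract of a direct sum of finitely presented modules, and in total such
    sums form a coproduct of shifted compact stalks. *)
Lemma zdiff_projective (X : cpx R) : zdiff X -> (forall n, pure_projective (X n)) ->
  fprojective (@yoneda DT X).
Proof.
move=> zX pX.
have ex n : {J : Type & {F : J -> rmod R & {q : mhom (dsum F) (X n) & {s : mhom (X n) (dsum F) |
    (forall j, fin_pres (F j)) /\ forall x, q (s x) = x}}}}.
  have [J /cid[F /cid[q /cid[s h]]]] := cid (pure_proj_summand (pX n)).
  by exists J, F, q, s.
pose J n := projT1 (ex n); pose F n : J n -> rmod R := projT1 (projT2 (ex n)).
pose q n : mhom (dsum (F n)) (X n) := projT1 (projT2 (projT2 (ex n))).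
pose s n : mhom (X n) (dsum (F n)) := sval (projT2 (projT2 (projT2 (ex n)))).
have fF n j : fin_pres (F n j) := proj1 (svalP (projT2 (projT2 (projT2 (ex n))))) j.
have qs n x : q n (s n x) = x := proj2 (svalP (projT2 (projT2 (projT2 (ex n))))) x.
clearbody J F q s; pose G := gcx (fun n => dsum (F n)).
have [|qq qqE] := @zmap_ex R G X q zX; first by move=> n x; rewrite linear0.
have [|ss ssE] := @zmap_ex R X G s (@gcx_zdiff R _); first by move=> n x; rewrite zX linear0.
apply: (fproj_retract (r := yon_map (dmap qq : @phom DT G X)) (s := yon_map (dmap ss : @phom DT X G))).
  move=> a x; rewrite /yon_map /=; change (x ;; dmap ss ;; dmap qq = x).
  rewrite -dcompA dmapM -[RHS]dcomp1r; congr (_ ;; _); apply: dmap_ext => n y /=.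
  by rewrite ssE qqE qs.
exact: graded_sum_projective.
Qed.

Local Notation ppres := (resolution (@mzero R) (@pure_surj R) (@pure_exact R) (@pure_projective R)).
Local Notation fres := (resolution (@fzero (compacts DT)) (@fepi (compacts DT))
  (@fexact (compacts DT)) (@fprojective (compacts DT))).

Lemma yoneda_zero (X : cpx R) : (forall n, mzero (X n)) -> fzero (@yoneda DT X).
Proof.
move=> z c x; rewrite -[x]dcomp1r -[RHS](dcomp0 _ x); congr (_ ;; _).
by apply: dmap_ext => n y; rewrite (z n y) [RHS](z n).
Qed.

Section PureSequence.
Variables (X : cpx R) (Z : nat -> cpx R) (D : forall k, cmap (Z k.+1) (Z k)) (E : cmap (Z 0%N) X).
Hypotheses (zX : zdiff X) (zZ : forall k, zdiff (Z k)).
Hypotheses (sE : forall n, pure_surj (E n : mhom (Z 0%N n) (X n)))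
  (x0 : forall n, pure_exact (D 0 n : mhom (Z 1%N n) (Z 0%N n)) (E n))
  (xD : forall k n, pure_exact (D k.+1 n : mhom (Z k.+2 n) (Z k.+1 n)) (D k n)).

Lemma pure_kernel (A B : cpx R) (f : cmap A B) (A' : cpx R) (g : cmap A' A) :
  zdiff A -> zdiff A' -> (forall n, pure_exact (g n : mhom (A' n) (A n)) (f n)) ->
  exists (K : cpx R) (i : cmap K A) (p : cmap A' K),
  [/\ zdiff K, forall n, minj (i n), forall n, mexact (i n : mhom (K n) (A n)) (f n),
     forall n, pure_surj (p n : mhom (A' n) (K n)) & forall n x, i n (p n x) = g n x].
Proof.
move=> zA zA' xg; pose K := gcx (fun n => smod (ker_subm (f n)) : rmod R).
have [|i iE] := @zmap_ex R K A (fun n => sinc (ker_subm (f n))) zA.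
  by move=> n x; rewrite linear0.
pose px n := cid (ker_pure_surj (xg n)).
have [|p pE] := @zmap_ex R A' K (fun n => sval (px n)) (@gcx_zdiff R _).
  by move=> n x; rewrite zA' linear0.
have eqi n : (i n : {linear _ -> _}) = sinc (ker_subm (f n)) by apply: lin_ext => x; apply: iE.
have eqp n : (p n : {linear _ -> _}) = sval (px n) by apply: lin_ext => x; apply: pE.
exists K, i, p; split=> //.
- by move=> n; rewrite eqi; apply: (proj1 (ker_ses (f n))).
- by move=> n; rewrite eqi; apply: (proj2 (ker_ses (f n))).
- by move=> n; rewrite eqp; apply: (proj1 (svalP (px n))).
- by move=> n x; rewrite iE pE; apply: (proj2 (svalP (px n))).
Qed.

Definition mono_on_compacts (A B : cpx R) (i : cmap A B) :=
  forall c, @compact DT c -> forall u : dhom c A, u ;; dmap i = dzero c B -> u = dzero c A.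

Lemma dcomp_exact0 (A B C : cpx R) (f : cmap A B) (g : cmap B C) (c : cpx R) (u : dhom c A) :
  (forall n, mexact (f n : mhom (A n) (B n)) (g n)) -> u ;; dmap f ;; dmap g = dzero c C.
Proof.
move=> fg; rewrite -dcompA dmapM -[RHS](dcomp0 _ u); congr (_ ;; _).
by apply: dmap_ext => n x /=; apply/fg; exists x.
Qed.

Lemma kernel_factor (A B : cpx R) (f : cmap A B) (A' : cpx R) (g : cmap A' A) :
  zdiff A -> zdiff A' -> zdiff B -> (forall n, pure_exact (g n : mhom (A' n) (A n)) (f n)) ->
  (forall n, pure_surj (f n : mhom (A n) (B n))) ->
  exists (K : cpx R) (i : cmap K A) (p : cmap A' K),
  [/\ zdiff K, forall n, minj (i n), mono_on_compacts i,
     (forall n, pure_surj (p n : mhom (A' n) (K n))) /\ (forall n x, i n (p n x) = g n x) &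
     forall c, @compact DT c -> forall y : dhom c A, y ;; dmap f = dzero c B ->
       exists x : dhom c A', x ;; dmap g = y].
Proof.
move=> zA zA' zB xg sf; have [K [i [p [zK ii xi pp ip]]]] := pure_kernel zA zA' xg.
have ses n : mses (i n : mhom (K n) (A n)) (f n) by split; [..|case: (sf n)].
exists K, i, p; split=> //.
  by move=> c cc u; apply: (pure_mono_inj cc zK zA ses sf).
move=> c cc y y0; have [v vE] := ses_mid zK zA zB ses y0.
have [w wE] := pure_epi_surj cc zA' zK pp v.
exists w; rewrite -vE -wE -dcompA dmapM; congr (_ ;; _).
by apply: dmap_ext => n x /=; rewrite ip.
Qed.

(** The long sequence is cut into short pure ones, [K] being the image of [D k]. The induction
    passes from [K] to the kernel of its cover [p], again a pure epimorphism. *)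
Lemma syzygy_factor k : exists (K : cpx R) (i : cmap K (Z k)) (p : cmap (Z k.+1) K),
  [/\ zdiff K, forall n, minj (i n), mono_on_compacts i,
     forall n, pure_surj (p n : mhom (Z k.+1 n) (K n)) & forall n x, i n (p n x) = D k n x].
Proof.
elim: k => [|k [K [i [p [zK ii mi pp ip]]]]].
  have [K [i [p [zK ii mi [pp ip] _]]]] := kernel_factor (@zZ 0%N) (@zZ 1%N) zX x0 sE.
  by exists K, i, p.
have xp n : pure_exact (D k.+1 n : mhom (Z k.+2 n) (Z k.+1 n)) (p n) :=
  pure_exact_mono (ii n) (ip n) (xD k n).
have [K' [i' [p' [zK' ii' mi' [pp' ip'] _]]]] := kernel_factor (@zZ k.+1) (@zZ k.+2) zK xp pp.
by exists K', i', p'.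
Qed.

Lemma yoneda_pure_exact : [/\ fepi (yon_map (dmap E : @phom DT _ _)),
  fexact (yon_map (dmap (D 0) : @phom DT _ _)) (yon_map (dmap E : @phom DT _ _)) &
  forall k, fexact (yon_map (dmap (D k.+1) : @phom DT _ _)) (yon_map (dmap (D k) : @phom DT _ _))].
Proof.
split.
- by move=> c y; apply: (pure_epi_surj (svalP c) (@zZ 0%N) zX sE y).
- move=> c y; split=> [y0|[x <-]]; last by apply: dcomp_exact0 => n; case: (x0 n).
  have [K [i [p [_ _ _ _ h]]]] := kernel_factor (@zZ 0%N) (@zZ 1%N) zX x0 sE.
  exact: h (svalP c) y y0.
move=> k c y; split=> [y0|[x <-]]; last by apply: dcomp_exact0 => n; case: (xD k n).
have [K [i [p [zK ii mi pp ip]]]] := syzygy_factor k.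
have xp n : pure_exact (D k.+1 n : mhom (Z k.+2 n) (Z k.+1 n)) (p n) :=
  pure_exact_mono (ii n) (ip n) (xD k n).
have [K' [i' [p' [_ _ _ _ h]]]] := kernel_factor (@zZ k.+1) (@zZ k.+2) zK xp pp.
(* As [D k] factors as [p] followed by [i], and [i] stays monic on compacts, y followed by [p] is
   already zero. *)
apply: (h (sval c) (svalP c)); apply: mi (svalP c) _ _.
rewrite -dcompA dmapM -[RHS]y0; congr (_ ;; _).
by apply: dmap_ext => n x /=; rewrite ip.
Qed.
End PureSequence.
(** The bound [N] is common to all degrees, so the resolutions of the [X n] combine to a resolution
    by complexes with zero differential. *)
Theorem yoneda_resolution (X : cpx R) N : zdiff X -> (forall n, ppres (X n) N) ->
  fres (@yoneda DT X) N.
Proof.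
move=> zX rX.
have ex n : {P : nat -> rmod R & {d : forall k, mhom (P k.+1) (P k) & {e : mhom (P 0%N) (X n) |
    [/\ forall k, pure_projective (P k), pure_surj e, pure_exact (d 0%N) e,
      forall k, pure_exact (d k.+1) (d k) & forall k, (N < k)%N -> mzero (P k)]}}}.
  have [P /cid[d /cid[e h]]] := cid (rX n).
  by exists P, d, e.
pose P n := projT1 (ex n); pose d n : forall k, mhom (P n k.+1) (P n k) := projT1 (projT2 (ex n)).
pose e n : mhom (P n 0%N) (X n) := sval (projT2 (projT2 (ex n))).
have pde n : [/\ forall k, pure_projective (P n k), pure_surj (e n), pure_exact (d n 0%N) (e n),
      forall k, pure_exact (d n k.+1) (d n k) & forall k, (N < k)%N -> mzero (P n k)].
  exact: (svalP (projT2 (projT2 (ex n)))).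
clearbody P d e; pose Z k := gcx (fun n => P n k).
have zZ k : zdiff (Z k) by [].
have exD k : exists D : cmap (Z k.+1) (Z k), forall n x, D n x = d n k x.
  by apply: (@zmap_ex R (Z k.+1) (Z k) (fun n => d n k)) => // n x; rewrite linear0.
pose D k := sval (cid (exD k)).
have DE k n : (D k n : mhom (P n k.+1) (P n k)) = d n k.
  by apply: lin_ext => x; rewrite /D; case: cid => f ->.
have [|E EE] := @zmap_ex R (Z 0%N) X e zX; first by move=> n x; rewrite linear0.
have EE' n : (E n : mhom (P n 0%N) (X n)) = e n by apply: lin_ext => x; rewrite EE.
have [||| h1 h2 h3] := @yoneda_pure_exact X Z D E zX zZ.
- by move=> n; rewrite [E n]EE'; case: (pde n).
- by move=> n; rewrite [E n]EE' [D 0%N n]DE; case: (pde n).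
- by move=> k n; rewrite [D k.+1 n]DE [D k n]DE; case: (pde n) => _ _ _ h _; exact: h.
exists (fun k => @yoneda DT (Z k)), (fun k => yon_map (dmap (D k) : @phom DT _ _)).
exists (yon_map (dmap E : @phom DT _ _)); split=> //.
- move=> k; have pk n : pure_projective (Z k n) by case: (pde n) => h _ _ _ _; exact: h.
  exact: zdiff_projective (@zZ k) pk.
- move=> k Nk; apply: yoneda_zero => n; case: (pde n) => _ _ _ _ z; exact: (z k Nk).
Qed.
End YonedaResolutions.

Section PureResolutions.
Variable R : pzRingType.
Implicit Types K M P Q X Y Z : rmod R.
Local Notation ppres := (resolution (@mzero R) (@pure_surj R) (@pure_exact R) (@pure_projective R)).

Lemma pure_exact_splice K Q M Q' (i : mhom K Q) (p : mhom Q M) (p' : mhom Q' K) :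
  minj i -> mexact i p -> pure_surj p' -> pure_exact (i \o p' : mhom Q' Q) p.
Proof.
move=> ii xip [sp lp]; split.
  move=> y; rewrite xip; split=> [[u <-]|[x <-]]; last by exists (p' x).
  by have [x <-] := sp u; exists x.
move=> F fF v; split=> [pv|[u uE] a]; last by rewrite -uE; apply/xip; exists (p' (u a)).
have [w wE] : exists w : mhom F K, forall a, i (w a) = v a.
  by apply: (inj_lift ii) => a; apply/xip.
by have [u uE] := lp F fF w; exists u => a; rewrite /= uE wE.
Qed.

Lemma pure_exact_inj X Y Z M (f : mhom X Y) (p : mhom Y Z) (g : mhom Z M) :
  minj g -> pure_exact f p -> pure_exact f (g \o p : mhom Y M).
Proof.
move=> gi [xfp lfp].
have gp y : g (p y) = 0 <-> p y = 0 by split=> [/gi//|->]; rewrite linear0.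
split=> [y|F fF v]; first by rewrite -xfp -gp.
by rewrite -(lfp F fF v); split=> h a; [exact: (proj1 (gp _) (h a)) | exact: (proj2 (gp _) (h a))].
Qed.

Lemma ppres0 P : pure_projective P -> ppres P 0.
Proof.
move=> pP; pose PP k : rmod R := if k is 0%N then P else 'rV[R^c]_0.
exists PP, (fun k => (\0 : {linear PP k.+1 -> PP k})%R), idfun; split.
- by case=> [|k] //; apply: pure_proj0 => x; apply: rV0_zero.
- by split=> [x|F fF v]; [exists x | exists v].
- split=> [x|F fF v]; first by split=> [/= ->|[y <-]] //; exists 0.
  by split=> [v0|[u uE] a]; [exists (\0)%R => a; rewrite [RHS]v0 | rewrite /= -uE].
- move=> k; split=> [x|F fF v].
    by split=> // _; exists 0; rewrite linear0; apply/esym/rV0_zero.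
  by split=> // _; exists (\0)%R => a; apply/esym/rV0_zero.
- by case=> // k _ x; apply: rV0_zero.
Qed.

Lemma ppres_cons K Q M (i : mhom K Q) (p : mhom Q M) n : pure_projective Q -> minj i ->
  mexact i p -> pure_surj p -> ppres K n -> ppres M n.+1.
Proof.
move=> pQ ii xip sp [P [d [e [pP se x0 xk z]]]].
pose PP k : rmod R := if k is k'.+1 then P k' else Q.
pose dd k : mhom (PP k.+1) (PP k) := match k return mhom (PP k.+1) (PP k) with
  | 0%N => (i \o e : {linear P 0%N -> Q}) | k'.+1 => d k' end.
exists PP, dd, p; split=> //.
- by case.
- exact: pure_exact_splice.
- by case=> [|k]; [exact: (pure_exact_inj ii x0) | exact: xk].
- by case=> // k; apply: z.
Qed.

Lemma resolution_le (O : Type) (hom : O -> O -> Type) zero surj exact proj (A : O) n m :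
  (n <= m)%N -> @resolution O hom zero surj exact proj A n -> @resolution O hom zero surj exact proj A m.
Proof.
move=> nm [P [d [e [h1 h2 h3 h4 h5]]]]; exists P, d, e; split=> // k mk.
exact/h5/(leq_ltn_trans nm).
Qed.
End PureResolutions.

(** * From projective resolutions of [yM] back to pure resolutions of [M] *)

Section Converse.
Variable R : pzRingType.
Implicit Types K M P Q B : rmod R.
Hypothesis fpres : forall F : rmod R, fin_pres F ->
  exists n, resolution (@mzero R) (@msurj R) (@mexact R) (@fgproj R) F n.
Local Notation DT := (derived R).
Local Notation ppres := (resolution (@mzero R) (@pure_surj R) (@pure_exact R) (@pure_projective R)).
Local Notation fres := (resolution (@fzero (compacts DT)) (@fepi (compacts DT))
  (@fexact (compacts DT)) (@fprojective (compacts DT))).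
Local Notation yst M := (@yoneda DT (stalk M)).
Local Notation ymap f := (yon_map (dmap (stalk_map f) : @phom DT _ _)).

Lemma stalk_dsum (J : Type) (F : J -> rmod R) :
  @is_coproduct DT J (fun j => stalk (F j)) (stalk (dsum F)) (fun j => dmap (stalk_map (din j))).
Proof.
pose X j : cpx R := stalk (F j).
have [th thE] := dsumc_out (fun j => stalk_map (din (M := F) j)).
have th0 u : th 0 u = u :> dsum F.
  by apply: (dsum_map_eq (f := th 0 : {linear dsum F -> dsum F}) (g := idfun)) => j x; rewrite thE.
have qth : qis th.
  apply: bij_qis => n.
    move=> u; have [n0|ne] := pselect (n = 0); first by subst n => h; rewrite -[u]th0.
    by move=> _; apply: dsum_eq => j; rewrite [LHS](stalk_out _ ne) [RHS](stalk_out _ ne).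
  move=> y; have [n0|ne] := pselect (n = 0); first by subst n; exists y; rewrite th0.
  by exists 0; rewrite linear0 (stalk_out y ne).
have e : (fun j => dmap (cmap_comp (dsumc_in X j) th)) = (fun j => dmap (stalk_map (din (M := F) j))).
  by apply: functional_extensionality_dep => j; apply: dmap_ext => n x; rewrite -thE.
by have := coproduct_transfer qth; rewrite e.
Qed.

(** A transformation out of [y] of the sum is determined by its values at the injections; these are
    morphisms between stalks with compact source, to which [stalk_full] applies. *)
Lemma dsum_full (J : Type) (F : J -> rmod R) B : (forall j, fin_pres (F j)) ->
  forall t : nat_trans (yst (dsum F)) (yst B),
  exists f : mhom (dsum F) B, forall c x, t c x = ymap f c x.
Proof.
move=> fF t; have cF j : @compact DT (stalk (F j)) := stalk_compact (fpres (fF j)).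
pose cp := @cpt DT J (fun j => stalk (F j)) cF.
have fj j : exists f : mhom (F j) B, t (cp j) (dmap (stalk_map (din j))) = dmap (stalk_map f).
  exact: (stalk_full (fpres (fF j))).
pose f0 j := sval (cid (fj j)).
have f0E j : t (cp j) (dmap (stalk_map (din j))) = dmap (stalk_map (f0 j)) by rewrite /f0; case: cid.
have [f fE] := dsum_out f0; exists f.
refine (@nt_determined DT J _ _ _ (@stalk_dsum J F) cF (yst B) t (ymap f) _) => j.
rewrite [LHS]f0E; change (dmap (stalk_map (f0 j)) = dmap (stalk_map (din (M := F) j)) ;; dmap (stalk_map f)).
rewrite dmapM; apply: dmap_ext => n x; rewrite stalk_map_comp.
by congr (stalk_map _ n x); apply: lin_ext => y; rewrite /= fE.
Qed.

Lemma dsum_faithful (J : Type) (F : J -> rmod R) B (f : mhom (dsum F) B) :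
  (forall j, fin_pres (F j)) -> (forall c x, ymap f c x = ab0) -> forall x, f x = 0.
Proof.
move=> fF f0; have cF j : @compact DT (stalk (F j)) := stalk_compact (fpres (fF j)).
apply: (dsum_map_eq (f := f) (g := \0%R)) => j x.
apply: (stalk_faithful (fpres (fF j)) (f := f \o din j)).
rewrite -[RHS](f0 (@cpt DT J (fun j => stalk (F j)) cF j) (dmap (stalk_map (din j)))).
change (dmap (stalk_map (f \o din j)) = dmap (stalk_map (din (M := F) j)) ;; dmap (stalk_map f)).
by rewrite dmapM; apply: dmap_ext => n y; rewrite stalk_map_comp.
Qed.

Lemma stalk_pure_surj P M (f : mhom P M) n : pure_surj f -> pure_surj (stalk_lin f n).
Proof.
case: n => [[|n]|n] // _; split.
- by move=> y; exists 0; apply/esym/rV0_zero.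
- by move=> F _ v; exists (\0)%R => a; apply/esym/rV0_zero.
- by move=> y; exists 0; apply/esym/rV0_zero.
- by move=> F _ v; exists (\0)%R => a; apply/esym/rV0_zero.
Qed.

Lemma stalk_pure_exact P M K (f : mhom P M) (g : mhom M K) n :
  pure_exact f g -> pure_exact (stalk_lin f n) (stalk_lin g n).
Proof.
case: n => [[|n]|n] // _; split.
- by move=> y; split=> // _; exists 0; apply/esym/rV0_zero.
- by move=> F _ v; split=> // _; exists (\0)%R => a; apply/esym/rV0_zero.
- by move=> y; split=> // _; exists 0; apply/esym/rV0_zero.
- by move=> F _ v; split=> // _; exists (\0)%R => a; apply/esym/rV0_zero.
Qed.

Lemma stalk_pure_proj P n : pure_projective P -> pure_projective (stalk_ob P n).
Proof. by case: n => [[|n]|n] // _; apply: pure_proj0 => x; apply: rV0_zero. Qed.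

Theorem yoneda_stalk_resolution M n : fres (yst M) n -> ppres M n.
Proof.
move=> rM.
pose full Q := forall B (t : nat_trans (yst Q) (yst B)),
  exists f : mhom Q B, forall c x, t c x = ymap f c x.
pose faithful Q := forall B (f : mhom Q B), (forall c x, ymap f c x = ab0) -> forall x, f x = 0.
have [|Ms [Q [i [p [MF ipE]]]]] := @syzygies R (fun _ => True)
  (fun K Q M i p => [/\ pure_projective Q, full Q, faithful Q, minj i /\ mexact i p & pure_surj p])
  _ M I.
  move=> N _; have [J [F [q [fF pq]]]] := pure_cover N.
  exists (smod (ker_subm q)), (dsum F), (sinc (ker_subm q)), q; split=> //; split=> //.
  - exact: pure_proj_dsum.
  - by move=> B; apply: dsum_full.
  - by move=> B f; apply: dsum_faithful.
  - exact: ker_ses.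
case: M / MF rM => rM.
have pQ k : pure_projective (Q k) by case: (ipE k).
have fQ k : full (Q k) by case: (ipE k).
have ffQ k : faithful (Q k) by case: (ipE k).
have ii k : minj (i k) by case: (ipE k) => _ _ _ [].
have xip k : mexact (i k) (p k) by case: (ipE k) => _ _ _ [].
have sp k : pure_surj (p k) by case: (ipE k).
pose d k : mhom (Q k.+1) (Q k) := i k \o p k.+1.
have xpd k : pure_exact (d k) (p k) by apply: pure_exact_splice.
have xdd k : pure_exact (d k.+1) (d k) := pure_exact_inj (ii k) (xpd k.+1).
have [||| ye yx yd] := @yoneda_pure_exact R (stalk (Ms 0%N)) (fun k => stalk (Q k))
    (fun k => stalk_map (d k)) (stalk_map (p 0%N)) (@stalk_zdiff R _) (fun k => @stalk_zdiff R _).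
- by move=> m; apply: stalk_pure_surj.
- by move=> m; apply: stalk_pure_exact.
- by move=> k m; apply: stalk_pure_exact.
have [|h hE] := fresolution_split rM (P := fun k => yst (Q k)) _ ye yx yd.
  move=> k; apply: (zdiff_projective fpres) => [|m]; [exact: stalk_zdiff | exact: stalk_pure_proj].
have [eta etaE] := fQ n _ h.
pose dhd : mhom (Q n.+1) (Q n) := d n \o (eta \o d n).
(* The identity d h d = d is known for functors only. By additivity [y] kills the difference [g],
   and faithfulness brings the identity back to modules. *)
pose g : mhom (Q n.+1) (Q n) := (dhd \- d n)%R.
have dE x : d n (eta (d n x)) = d n x.
  suff /eqP : g x = 0 by rewrite subr_eq0 => /eqP.
  apply: (ffQ n.+1 _ g) => c y.
  have yd3 : y ;; dmap (stalk_map dhd) = y ;; dmap (stalk_map (d n)).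
    rewrite -[RHS](hE c y) etaE.
    change (y ;; dmap (stalk_map dhd) =
      y ;; dmap (stalk_map (d n)) ;; dmap (stalk_map eta) ;; dmap (stalk_map (d n))).
    rewrite -!dcompA; congr (_ ;; _); rewrite !dmapM; apply: dmap_ext => m x'.
    by case: m x' => [[|m]|m] x'.
  have gD : dmap (stalk_map dhd) = dadd (dmap (stalk_map g)) (dmap (stalk_map (d n))).
    rewrite -dmapD; apply: dmap_ext => -[[|m]|m] x' //=; rewrite ?addr0 //.
    by rewrite /g /= subrK.
  apply: (@abDI (@phom DT _ _) (y ;; dmap (stalk_map (d n)))).
  rewrite abDC abD0; change (dadd (y ;; dmap (stalk_map g)) (y ;; dmap (stalk_map (d n))) =
    y ;; dmap (stalk_map (d n))).
  by rewrite -dcompDr -gD yd3.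
have [s sE] : exists s : mhom (Ms n) (Q n), forall y, p n (s y) = y.
  apply: (split_section (r := p n.+1 \o eta) (xip n) (proj1 (sp n))) => y.
  have [x <-] := proj1 (sp n.+1) y; apply/eqP; rewrite -subr_eq0; apply/eqP/(ii n).
  by rewrite linearB; apply/eqP; rewrite subr_eq0; apply/eqP/(dE x).
have : ppres (Ms n) 0 by apply: ppres0; apply: (pure_proj_retract sE).
have rj : forall j m, ppres (Ms j) m -> ppres (Ms 0%N) (j + m).
  elim=> [//|j IH] m rj; rewrite addSnnS; apply: IH.
  exact: (ppres_cons (pQ j) (ii j) (xip j) (sp j) rj).
by move/rj; rewrite addn0.
Qed.

Theorem fpdim_stalk M : fpdim (yst M) = ppdim M.
Proof.
rewrite /fpdim /ppdim; congr einf; apply/funext => n; apply/propext; split.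
  exact: yoneda_stalk_resolution.
move=> rM; apply: (yoneda_resolution fpres (@stalk_zdiff R M)) => -[[|m]|m].
- exact: rM.
- apply: resolution_le (leq0n n) _; apply: ppres0; apply: pure_proj0 => x; exact: rV0_zero.
- apply: resolution_le (leq0n n) _; apply: ppres0; apply: pure_proj0 => x; exact: rV0_zero.
Qed.
End Converse.

(** * Hereditary rings and global dimensions *)

Section ExtendedNaturals.

Lemma einf_min (Q : nat -> Prop) n : Q n -> exists m, [/\ einf Q = Some m, Q m & (m <= n)%N].
Proof.
move=> Qn; rewrite /einf; case: pselect => [ex|[]]; last by exists n; apply/asboolP.
by exists (ex_minn ex); case: ex_minnP => m /asboolP Qm mn; split=> //; apply/mn/asboolP.
Qed.

Lemma enat_le_trans a b c : enat_le a b -> enat_le b c -> enat_le a c.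
Proof. by case: a b c => [a|] [b|] [c|] //=; apply: leq_trans. Qed.

Lemma enat_le_anti a b : enat_le a b -> enat_le b a -> a = b.
Proof. by case: a b => [a|] [b|] //= ab ba; congr Some; apply/eqP; rewrite eqn_leq ab. Qed.

Lemma le_esup (S : enat -> Prop) a : S a -> enat_le a (esup S).
Proof.
move=> Sa; rewrite /esup; case e : (einf _) => [m|]; last by case: a Sa.
exact: (einf_some e) Sa.
Qed.

Lemma esup_le (S : enat -> Prop) b : (forall a, S a -> enat_le a b) -> enat_le (esup S) b.
Proof.
case: b => [n|] h; last by case: (esup S).
by have [m [e _ mn]] := @einf_min (fun n => forall a, S a -> enat_le a (Some n)) n h; rewrite /esup e.
Qed.
End ExtendedNaturals.

Section Hereditary.
Variable R : pzRingType.
Implicit Types M P Q X Y : rmod R.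
Hypothesis her : hereditary R.

Lemma hereditary_pdim M : resolution (@mzero R) (@msurj R) (@mexact R) (@mprojective R) M 1.
Proof.
have : enat_le (pdim M) (Some 1%N).
  by apply: enat_le_trans her; apply: le_esup; exists M.
rewrite /pdim; case e : (einf _) => [m|] //= m1.
exact: resolution_le m1 (einf_some e).
Qed.

Lemma mproj_prod P Q : mprojective P -> mprojective Q -> mprojective (P * Q)%type.
Proof.
move=> pP pQ X Y g sg v.
have l1 : linear (fun x : P => v (x, 0)).
  by move=> a x y; rewrite -linearP; congr (v (_, _)); rewrite /= scaler0 addr0.
have l2 : linear (fun x : Q => v (0, x)).
  by move=> a x y; rewrite -linearP; congr (v (_, _)); rewrite /= scaler0 addr0.
have [u1 u1E] := pP X Y g sg (mklin l1); have [u2 u2E] := pQ X Y g sg (mklin l2).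
have lu : linear (fun x : P * Q => u1 x.1 + u2 x.2).
  by move=> a [x x'] [y y']; rewrite /= !linearP; zmodl.
exists (mklin lu) => -[x x']; rewrite /= linearD u1E u2E /= -linearD.
by congr (v (_, _)); rewrite /= ?addr0 ?add0r.
Qed.

(* Schanuel's argument, applied to M -> P -> P / M and a resolution of length 1. *)
Lemma hereditary_sub M P (i : mhom M P) : minj i -> mprojective P -> mprojective M.
Proof.
move=> ii pP; pose A : rmod R := qmod (im_subm i); pose pi : mhom P A := qpi (im_subm i).
have spi : msurj pi by apply: qpi_surj.
have xpi x : pi x = 0 <-> exists m, i m = x by apply: qpi0.
have [T [d [e [pT se xe xd zT]]]] := hereditary_pdim A.
have d0i x : d 0%N x = 0 -> x = 0.
  by move=> /xd[y <-]; rewrite (zT 2%N isT y) linear0.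
have [b bE] := pP _ _ e se pi; have [a aE] := pT 0%N _ _ pi spi e.
have [rho rhoE] : exists r : mhom P M, forall x, i (r x) = x - a (b x).
  apply: (inj_lift (f := (idfun \- (a \o b) : {linear P -> P})%R) ii) => x /=.
  by apply/xpi; rewrite linearB aE bE subrr.
have [b' b'E] : exists b' : mhom M (T 1%N), forall m, d 0%N (b' m) = b (i m).
  apply: (inj_lift (f := b \o i) d0i) => m /=.
  by apply/xe; rewrite bE; apply/xpi; exists m.
have [a' a'E] : exists a' : mhom (T 1%N) M, forall z, i (a' z) = a (d 0%N z).
  apply: (inj_lift (f := a \o d 0%N) ii) => z /=.
  by apply/xpi; rewrite aE; apply/xe; exists z.
have lr : linear (fun x : P * T 1%N => rho x.1 + a' x.2).
  by move=> c [x x'] [y y']; rewrite /= !linearP; zmodl.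
have ls : linear (fun m : M => (i m, b' m) : P * T 1%N).
  by move=> c x y; rewrite !linearP.
apply: (mproj_retract (r := mklin lr) (s := mklin ls)) (mproj_prod pP (pT 1%N)).
move=> m /=; apply/eqP; rewrite -subr_eq0; apply/eqP/ii.
by rewrite linearB linearD rhoE a'E b'E; zmod.
Qed.

Lemma fgproj_fp P : fgproj P -> fin_pres P.
Proof.
case=> pP [n [p sp]]; have [s sE] := pP _ _ p sp (idfun : {linear P -> P}).
exists n, n, (idfun \- (s \o p) : {linear 'rV[R^c]_n -> 'rV[R^c]_n})%R, p; split=> //.
move=> x; split=> [px|[y <-]] /=; first by exists x; rewrite /= px linear0 subr0.
by rewrite linearB sE subrr.
Qed.

(** The image of [f] is a submodule of a projective, hence projective; so P -> im f splits, and the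
    kernel is a retract of [P]. *)
Lemma hereditary_coherent : coherent R.
Proof.
move=> P Q f K i pP fP pQ fQ ii xi.
pose I : rmod R := smod (im_subm f); pose j : mhom I Q := sinc (im_subm f).
have pI : mprojective I.
  by apply: (hereditary_sub (i := j)) pQ => x x0; apply: sinc_inj; rewrite linear0.
have [f' f'E] : exists f' : mhom P I, forall x, j (f' x) = f x.
  by exists (slift (im_subm f) (fun x => ex_intro _ x erefl)).
have sf' : msurj f'.
  by move=> y; have [x xE] := sincP y; exists x; apply: sinc_inj; rewrite -xE; apply: f'E.
have [s sE] := pI _ _ f' sf' (idfun : {linear I -> I}).
have [r rE] : exists r : mhom P K, forall x, i (r x) = x - s (f' x).
  apply: (inj_lift (f := (idfun \- (s \o f') : {linear P -> P})%R) ii) => x /=.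
  by apply/xi; rewrite linearB -!f'E sE subrr.
have rK y : r (i y) = y.
  apply/eqP; rewrite -subr_eq0; apply/eqP/ii; rewrite linearB rE.
  have -> : f' (i y) = 0.
    by apply: sinc_inj; rewrite linear0 [LHS]f'E; apply/xi; exists y.
  by rewrite linear0; zmod.
apply: fgproj_fp; split; first exact: mproj_retract rK pP.
have [n [p sp]] := fP; exists n, (r \o p) => y.
by have [x xE] := sp (i y); exists x; rewrite /= xE rK.
Qed.

Lemma hereditary_pdim_finite M : exists n, pdim M = Some n.
Proof.
by have [m [e _ _]] := einf_min (hereditary_pdim M); exists m.
Qed.

(* P^n splits as cycles plus boundaries of degree n + 1, which gives a chain
   map from P to its cohomology. *)
Lemma hereditary_formal (X : cpx R) : exists (H : cpx R) (P : cpx R) (e : cmap P X) (f : cmap P H),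
  [/\ zdiff H, qis e & qis f].
Proof.
have [P [e [cP qe]]] : exists (P : cpx R) (e : cmap P X), cofib P /\ qis e.
  by exists (cell_cpx X), (cell_res X); split; [apply: cell_cofib | apply: cell_qis].
have pP n : mprojective (P n) by apply: cofib_proj.
pose B n : rmod R := smod (im_subm (cd P n (n + 1))).
pose jB n : mhom (B n) (P (n + 1)) := sinc (im_subm (cd P n (n + 1))).
have pB n : mprojective (B n).
  by apply: (hereditary_sub (i := jB n)) (pP _) => x x0; apply: sinc_inj; rewrite linear0.
have exd n : exists d : mhom (P n) (B n), forall x, jB n (d x) = cd P n (n + 1) x.
  by exists (slift (im_subm (cd P n (n + 1))) (fun x => ex_intro _ x erefl)).
pose d n := sval (cid (exd n)).
have dE n x : jB n (d n x) = cd P n (n + 1) x by rewrite /d; case: cid x.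
have sd n : msurj (d n).
  by move=> y; have [x xE] := sincP y; exists x; apply: sinc_inj; rewrite -xE; apply: dE.
have exs n : exists s : mhom (B n) (P n), forall y, d n (s y) = y.
  exact: (pB n _ _ (d n) (sd n) (idfun : {linear B n -> B n})).
pose s n := sval (cid (exs n)).
have sE n y : d n (s n y) = y by rewrite /s; case: cid y.
pose C n : rmod R := smod (ker_subm (cd P n (n + 1))).
pose jC n : mhom (C n) (P n) := sinc (ker_subm (cd P n (n + 1))).
have jCc n z : cd P n (n + 1) (jC n z) = 0 by apply: (sincP z).
(* The splitting [s] of the differential onto its image gives a retraction of [P n] onto the
   cycles. *)
have exr n : exists r : mhom (P n) (C n), forall x, jC n (r x) = x - s n (d n x).
  apply: (inj_lift (i := jC n) (f := (idfun \- (s n \o d n) : {linear P n -> P n})%R)).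
    by move=> x x0; apply: sinc_inj; rewrite linear0.
  move=> x; have x0 : cd P n (n + 1) (x - s n (d n x)) = 0 by rewrite linearB -!dE sE subrr.
  exact: sinc_ex x0.
pose r n := sval (cid (exr n)).
have rE n x : jC n (r n x) = x - s n (d n x) by rewrite /r; case: cid x.
have d0 n x : cd P n (n + 1) x = 0 -> d n x = 0.
  by move=> x0; apply: sinc_inj; rewrite linear0 [LHS]dE.
have rc n x : cd P n (n + 1) x = 0 -> jC n (r n x) = x.
  by move=> /d0 x0; rewrite rE x0 linear0 subr0.
have bs n : subm (fun z : C n => exists y : P (n - 1), cd P (n - 1) n y = jC n z).
  split; first by exists 0; rewrite !linear0.
  by move=> a x y [u uE] [v vE]; exists (a *: u + v); rewrite !linearP uE vE.
pose H := gcx (fun n => qmod (bs n)).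
(* Retract to cycles, then take the cohomology class. This is a chain map because the retraction
   fixes boundaries, whose class is zero. *)
have [|f fE] := @zmap_ex R P H (fun n => qpi (bs n) \o r n) (@gcx_zdiff R _).
  move=> n x /=; apply/qpi0; rewrite rc ?cdd //.
  by apply: boundaryE; exists n, x.
exists H, P, e, f; split=> //.
split=> n.
  move=> x cx [i [y]] /= h; rewrite fE /= in h.
  have /qpi0[z zE] := esym h.
  by exists (n - 1), z; rewrite zE rc // cx.
move=> y _; have [z zE] := qpi_surj y; exists (jC n z); split.
  by apply: cycle_succ; apply: jCc.
exists n, 0; rewrite linear0 fE /= -zE -linearB.
have -> : r n (jC n z) = z by apply: sinc_inj; apply: rc; apply: jCc.
by rewrite subrr linear0.
Qed.
End Hereditary.

Section Main.
Variable R : pzRingType.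
Local Notation DT := (derived R).

Lemma resolution_iso (X Y : cpx R) (u : dhom X Y) (v : dhom Y X) n :
  u ;; v = dmap (cmap_id X) -> v ;; u = dmap (cmap_id Y) ->
  resolution (@fzero (compacts DT)) (@fepi (compacts DT)) (@fexact (compacts DT))
    (@fprojective (compacts DT)) (@yoneda DT X) n ->
  resolution (@fzero (compacts DT)) (@fepi (compacts DT)) (@fexact (compacts DT))
    (@fprojective (compacts DT)) (@yoneda DT Y) n.
Proof.
move=> uv vu [P [d [e [pP ee xe xd zP]]]].
exists P, d, (nt_comp e (yon_map (u : @phom DT X Y))); split=> //.
- move=> c y; have [x xE] := ee c (y ;; v : @yoneda DT X c); exists x.
  by rewrite /= xE; change (y ;; v ;; u = y); rewrite -dcompA vu dcomp1r.
- move=> c x; rewrite -xe; split=> [h|h].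
    rewrite -[LHS](dcomp1r (e c x : dhom _ _)) -uv dcompA [_ ;; u]h.
    exact: (pcomp0l (T := DT)).
  by rewrite /= h; apply: (pcomp0l (T := DT)).
Qed.
End Main.

Theorem proposition1p4 (R : pzRingType) :
  (coherent R ->
   (forall M : rmod R, fin_pres M -> exists n : nat, pdim M = Some n) ->
   (forall M : rmod R, fpdim (yoneda (stalk M)) = ppdim M) /\
   enat_le (pgldim R) (pgldim_cat (derived R))) /\
  (hereditary R -> pgldim R = pgldim_cat (derived R)).
Proof.
have part1 : coherent R ->
   (forall M : rmod R, fin_pres M -> exists n : nat, pdim M = Some n) ->
   (forall M : rmod R, fpdim (yoneda (stalk M)) = ppdim M) /\
   enat_le (pgldim R) (pgldim_cat (derived R)).
  move=> coh fpd.
  have fpres F (fF : fin_pres F) := fp_fgres coh fF (fpd F fF).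
  split=> [M|]; first exact: fpdim_stalk.
  apply: esup_le => _ [M ->]; rewrite -(fpdim_stalk fpres).
  by apply: le_esup; exists (stalk M).
split=> // her.
have coh := hereditary_coherent her.
have fpd (M : rmod R) (_ : fin_pres M) := hereditary_pdim_finite her M.
have [_ le1] := part1 coh fpd; apply: enat_le_anti le1 _.
have fpres F (fF : fin_pres F) := fp_fgres coh fF (fpd F fF).
(* Only a finite value [N] has content; it bounds the pure resolutions of all cohomology modules of
   [X] at once. *)
apply: esup_le => _ [X ->]; case e : (pgldim R) => [N|]; last by case: (fpdim _).
have rN (M : rmod R) : resolution (@mzero R) (@pure_surj R) (@pure_exact R) (@pure_projective R) M N.
  have : enat_le (ppdim M) (Some N) by rewrite -e; apply: le_esup; exists M.
  rewrite /ppdim; case e' : (einf _) => [m|] //= mN.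
  exact: resolution_le mN (einf_some e').
have [H [P [q [f [zH qq qf]]]]] := hereditary_formal her X.
have rH := yoneda_resolution fpres zH (fun n => rN (H n)).
(* The roof [H] <- [P] -> [X] of quasi-isomorphisms carries the resolution from the cohomology to
   [X]. *)
have rX := resolution_iso (u := dinv qf ;; dmap q) (v := dinv qq ;; dmap f) _ _ rH.
have [||m [em _ mN]] := einf_min (rX _ _).
- by rewrite dcompA -(dcompA _ (dmap q)) dinvr dcomp1r dinvl.
- by rewrite dcompA -(dcompA _ (dmap f)) dinvr dcomp1r dinvl.
by rewrite /fpdim em.
Qed.
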